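(* Let $\mu\in\mathcal M_0(\mathbb Z)$ and let $\tau^{AY}_\mu$ be the randomized Azéma–Yor stopping time of the context. Then $\tau^{AY}_\mu\in\mathrm{SEP}(\mathbb F^{S,\boldsymbol\eta},\mu)$, i.e. $\tau^{AY}_\mu<\infty$ a.s., $S_{\tau^{AY}_\mu}\sim\mu$ and $(S_{t\wedge\tau^{AY}_\mu})_{t\ge0}$ is uniformly integrable. Moreover, for every filtration $\mathbb F$ with respect to which $S$ is a simple symmetric random walk and every $\sigma\in\mathrm{SEP}(\mathbb F,\mu)$, $$\mathbb P(S^*_\sigma\ge n)\le\mathbb P(S^*_{\tau^{AY}_\mu}\ge n)=\bar\mu(b_\mu(n))\frac{\psi_\mu(b_\mu(n))-b_\mu(n)}{n-b_\mu(n)}\qquad\text{for all integers } n\ge1,$$ with the convention $\frac00=1$.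
   Context: Discrete time $t\in\{0,1,2,\dots\}$; $S$ is a simple symmetric random walk with $S_0=0$; $S^*_t:=\max_{u\le t}S_u$; $H_j:=\inf\{t\ge0:S_t=j\}$ ($H_\infty:=\infty$). ''$S$ is a simple symmetric random walk with respect to $\mathbb F$'' means $S$ is $\mathbb F$-adapted and $S_{t+1}-S_t$ is independent of $\mathcal F_t$, equal to $\pm1$ with probability $1/2$ each. $\mathcal M_0(\mathbb Z)$: probability measures on $\mathbb Z$ with finite first moment and mean zero. $\mathrm{SEP}(\mathbb F,\mu)$: set of $\mathbb F$-stopping times $\tau$ with $S_\tau\sim\mu$ and $(S_{t\wedge\tau})_{t\ge0}$ uniformly integrable. For $\mu\in\mathcal M_0(\mathbb Z)$: $\bar\mu(x):=\mu([x,\infty))$, $\bar x:=\sup\{n:\mu(\{n\})>0\}$, $\underline x:=\inf\{n:\mu(\{n\})>0\}$; $\psi_\mu(x):=\frac1{\bar\mu(x)}\int_{[x,\infty)}y\,\mu(dy)$ if $\bar\mu(x)>0$, $\psi_\mu(x):=x$ otherwise; $b_\mu(y):=\sup\{x:\psi_\mu(x)\le y\}$, $y\ge0$. If $\mu=\delta_0$, set $\tau^{AY}_\mu:=0$. Otherwise ($\underline x<0<\bar x$): for $1\le n<\bar x$, list the finite nonempty set of integers $\{b_\mu(y):y\in[n,n+1]\}\cap(-\infty,n]$ as $x^n_1>\dots>x^n_{m_n+1}$; list the integers in $\{b_\mu(y):y\in[0,1]\}$ as $x^0_1>\dots>x^0_{m_0+1}$ if $\underline x>-\infty$, or as an infinite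 decreasing sequence $x^0_1>x^0_2>\dots$ if $\underline x=-\infty$ (then $m_0+1:=\infty$). For $1\le n<\bar x$ and for $n=0$ when $\underline x>-\infty$: $\Gamma^n:=\bar\mu(x^n_{m_n+1})\frac{\psi_\mu(x^n_{m_n+1})-x^n_{m_n+1}}{n-x^n_{m_n+1}}$; $g^n_k:=\frac{n+1-x^n_k}{\Gamma^n}\mu(\{x^n_k\})$ ($2\le k\le m_n$); $g^n_{m_n+1}:=\frac{n+1-x^n_{m_n+1}}{\Gamma^n}\big[\mu(\{x^n_{m_n+1}\})-\bar\mu(x^n_{m_n+1})\frac{n-\psi_\mu(x^n_{m_n+1})}{n-x^n_{m_n+1}}\big]$; $f^n_{m_n+1}:=0$, $f^n_k:=f^n_{k+1}+g^n_{k+1}$ ($1\le k\le m_n$), $f^n_0:=1$; $\rho^n_k:=1-f^n_k/f^n_{k-1}$ for $1\le k\le m_n$, $\rho^n_{m_n+1}:=1$. When $\underline x=-\infty$: $g^0_k:=(1-x^0_k)\mu(\{x^0_k\})$ ($k\ge2$), $f^0_k:=\sum_{i\ge k+1}g^0_i$ ($k\ge1$), $f^0_0:=1$, $\rho^0_k:=1-f^0_k/f^0_{k-1}$ ($k\ge1$). (These $\rho^n_k$ lie in $[0,1]$.) Let $\boldsymbol\eta=(\eta^n_k:0\le n<\bar x,\ k\in\mathbb Z\cap[1,m_n+1])$ be mutually independent Bernoulli variables independent of $S$ with $\mathbb P(\eta^n_k=0)=\rho^n_k=1-\mathbb P(\eta^n_k=1)$, and $\mathbb F^{S,\boldsymbol\eta}$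 the filtration $\mathcal F^{S,\boldsymbol\eta}_t:=\sigma(S_u,\ \eta^{S^*_u}_k: k\in\mathbb Z\cap[1,m_{S^*_u}+1],\ u\le t)$. Then $$\tau^{AY}_\mu:=\inf\{t\ge0:\ S_t\le x^{S^*_t}_k\text{ and }\eta^{S^*_t}_k=0\text{ for some }k\in\mathbb Z\cap[1,m_{S^*_t}+1]\}\wedge H_{\bar x}.$$ *)

(* Defs.v *)
From HB Require Import structures.
From mathcomp Require Import all_boot all_order all_algebra.
From mathcomp Require Import all_classical all_reals all_analysis.
Set Implicit Arguments. Unset Strict Implicit. Unset Printing Implicit Defensive.
Import Order.TTheory GRing.Theory Num.Theory.
Local Open Scope classical_set_scope.
Local Open Scope ring_scope.

Section TargetLaw.
Context {R : realType}.

Definition sumZ (f : int -> R) (A : set int) : R :=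
  fine (\esum_(y in A `&` [set y | 0 <= f y]) (f y)%:E)
  - fine (\esum_(y in A `&` [set y | f y < 0]) (- f y)%:E).

Definition isM0 (mu : int -> R) : Prop :=
  [/\ (forall z, 0 <= mu z),
      \esum_(z in [set: int]) (mu z)%:E = 1%E,
      (\esum_(z in [set: int]) ((`|z|%:~R : R) * mu z)%:E < +oo)%E &
      sumZ (fun z => z%:~R * mu z) [set: int] = 0].

Variable mu : int -> R.

Definition mubar (x : R) : R := sumZ mu [set y : int | x <= y%:~R].

Definition psi (x : R) : R :=
  if 0 < mubar x then
    sumZ (fun y => y%:~R * mu y) [set y : int | x <= y%:~R] / mubar x
  else x.

(* b_mu(y) = sup {x : psi x <= y}  (sup of the empty set is -oo) *)
Definition bmu (y : R) : \bar R :=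
  ereal_sup [set x%:E | x in [set x : R | psi x <= y]].

Definition below_xbar (n : nat) : Prop := exists z : int, n%:Z < z /\ 0 < mu z.

Definition xlow_finite : Prop := exists L : int, forall z, 0 < mu z -> L <= z.

Definition Xset (n : nat) : set int :=
  [set z | (exists y : R, n%:R <= y <= n%:R + 1 /\ bmu y = (z%:~R)%:E)
           /\ (n = 0%N \/ z <= n%:Z)].

(* z is the k-th largest element (k >= 1) of Xset n *)
Definition kth (n k : nat) (z : int) : Prop :=
  Xset n z /\ exists s : seq int,
    [/\ uniq s, (forall w, w \in s <-> (Xset n w /\ z < w)) & size s = k.-1].

Definition xnk (n k : nat) : int := xget 0 (kth n k).

(* k \in Z \cap [1, m_n + 1]  for an index 0 <= n < \bar x *)
Definition valid (n k : nat) : Prop :=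
  [/\ below_xbar n, (1 <= k)%N & exists z, kth n k z].

(* m_n (when Xset n is finite) *)
Definition mn (n : nat) : nat :=
  xget 0%N [set m : nat | (exists z, kth n m.+1 z) /\ ~ (exists z, kth n m.+2 z)].

Definition xlast (n : nat) : R := (xnk n (mn n).+1)%:~R.

Definition Gamma (n : nat) : R :=
  mubar (xlast n) * (psi (xlast n) - xlast n) / (n%:R - xlast n).

Definition gnk (n k : nat) : R :=
  if k == (mn n).+1 then
    (n%:R + 1 - xlast n) / Gamma n *
      (mu (xnk n (mn n).+1)
       - mubar (xlast n) * (n%:R - psi (xlast n)) / (n%:R - xlast n))
  else (n%:R + 1 - (xnk n k)%:~R) / Gamma n * mu (xnk n k).

(* f^n_0 = 1, f^n_{m_n+1} = 0, f^n_k = f^n_{k+1} + g^n_{k+1} *)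
Definition fnk (n k : nat) : R :=
  if k == 0%N then 1 else \sum_(k.+1 <= i < (mn n).+2) gnk n i.

(* the case n = 0, \underline x = -oo *)
Definition g0inf (k : nat) : R := (1 - (xnk 0 k)%:~R) * mu (xnk 0 k).
Definition f0inf (k : nat) : R :=
  if k == 0%N then 1
  else fine (\esum_(i in [set i : nat | (k < i)%N]) (g0inf i)%:E).

Definition rho (n k : nat) : R :=
  if (n == 0%N) && ~~ `[< xlow_finite >] then 1 - f0inf k / f0inf k.-1
  else if (k <= mn n)%N then 1 - fnk n k / fnk n k.-1
  else 1.

Definition frac00 (a c : R) : R := if (a == 0) && (c == 0) then 1 else a / c.

Definition ay_bound (n : nat) : R :=
  let b := fine (bmu n%:R) in mubar b * frac00 (psi b - b) (n%:R - b).

End TargetLaw.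

Section Processes.
Context {R : realType} {d : measure_display} {Omega : measurableType d}.

Definition Smax (S : nat -> Omega -> int) (t : nat) (w : Omega) : int :=
  \big[Order.max/S 0%N w]_(u < t.+1) S u w.

Definition filtration (F : nat -> set (set Omega)) : Prop :=
  forall t, [/\ sigma_algebra setT (F t), F t `<=` measurable & F t `<=` F t.+1].

Definition is_srw_wrt (P : probability Omega R) (F : nat -> set (set Omega))
    (S : nat -> Omega -> int) : Prop :=
  [/\ filtration F,
      (forall t z, F t [set w | S t w = z]),
      (forall w, S 0%N w = 0) &
      forall t,
        [/\ P [set w | (S t.+1 w - S t w)%R = 1%R] = (1 / 2 : R)%:E,
            P [set w | (S t.+1 w - S t w)%R = (-1)%R] = (1 / 2 : R)%:E &
            forall (A : set Omega) (B : set int), F t A ->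
              P (A `&` [set w | B (S t.+1 w - S t w)%R]) =
              (P A * P [set w | B (S t.+1 w - S t w)%R])%E]].

(* stopping times take values in nat \cup {oo}; None stands for oo *)
Definition stopping_time (F : nat -> set (set Omega)) (tau : Omega -> option nat) :=
  forall t, F t [set w | exists u, (u <= t)%N /\ tau w = Some u].

Definition stopped (S : nat -> Omega -> int) (tau : Omega -> option nat)
    (t : nat) (w : Omega) : int :=
  S (if tau w is Some u then minn t u else t) w.

Definition unif_integrable (P : probability Omega R) (X : nat -> Omega -> int) :=
  forall e : R, 0 < e -> exists K : R, forall t,
    (\int[P]_(w in [set w | (K < `|(X t w)%:~R : R|)%R]) (`|(X t w)%:~R : R|)%:E
       <= e%:E)%E.

Definition SEP (P : probability Omega R) (F : nat -> set (set Omega))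
    (S : nat -> Omega -> int) (mu : int -> R) (tau : Omega -> option nat) :=
  [/\ stopping_time F tau,
      P [set w | tau w <> None] = 1%E,
      (forall z, P [set w | exists t, tau w = Some t /\ S t w = z] = (mu z)%:E) &
      unif_integrable P (stopped S tau)].

Definition natF (S : nat -> Omega -> int) (t : nat) : set (set Omega) :=
  smallest (sigma_algebra setT)
    [set A | exists u z, (u <= t)%N /\ A = [set w | S u w = z]].

(* F^{S,eta}_t = sigma(S_u, eta^{S^*_u}_k : k in [1, m_{S^*_u}+1], u <= t) *)
Definition natF_eta (mu : int -> R) (S : nat -> Omega -> int)
    (eta : nat -> nat -> Omega -> bool) (t : nat) : set (set Omega) :=
  smallest (sigma_algebra setT)
    ([set A | exists u z, (u <= t)%N /\ A = [set w | S u w = z]] `|`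
     [set A | exists u n k b, [/\ (u <= t)%N, valid mu n k &
         A = [set w | Smax S u w = n%:Z /\ eta n k w = b]]]).

Definition first_time (Q : nat -> Prop) : option nat :=
  xget None [set o | match o with
                     | Some t => Q t /\ forall u, (u < t)%N -> ~ Q u
                     | None => forall t, ~ Q t end].

Definition omin (a b : option nat) : option nat :=
  match a, b with
  | Some x, Some y => Some (minn x y)
  | Some x, None => Some x
  | None, _ => b
  end.

Definition tauAY (mu : int -> R) (S : nat -> Omega -> int)
    (eta : nat -> nat -> Omega -> bool) (w : Omega) : option nat :=
  if `[< mu = (fun z : int => if z == 0 then 1 else 0) >] then Some 0%N
  else omin
    (first_time (fun t => exists k,
       let n := `|Smax S t w|%N in
       [/\ valid mu n k, S t w <= xnk mu n k & eta n k w = false]))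
    (* H_{\bar x}: hitting time of \bar x = max supp mu (+oo if unbounded) *)
    (first_time (fun t => 0 < mu (S t w) /\ forall z, 0 < mu z -> z <= S t w)).

End Processes.

(* Main.v *)
(** Upper bound.  For an integer b < n, the transform of S that is switched on
    from the first visit to n until sigma gives Doob's inequality
    (n - b) P(S*_sigma >= n) <= E[(S_sigma - b)^+]; uniform integrability
    identifies the right-hand side as the call price of mu at b, and b = b_mu(n)
    is the optimal choice.

    Attainment.  From the first visit to n the walk reaches x <= n before n + 1
    with probability 1 / (n + 1 - x) (gambler's ruin), and the coins eta^n_k are
    fresh at that moment.  Given that level n is reached before tau, the
    probability of stopping at x^n_k is thus
    rho^n_k (prod_(j < k) (1 - rho^n_j)) / (n + 1 - x^n_k).  By induction on n,
    level n is reached with probability at least gam n, the asserted bound.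
    Summing over levels, where the sums telescope, gives P(S_tau = z) >= mu z for
    every z; as mu has total mass 1, these are equalities and tau is finite.

    Uniform integrability.  It suffices that E[|S_T|; tau > T] tends to 0.
    Optional stopping gives E[S_T; tau > T] -> 0.  On tau > T the walk is bounded
    below uniformly, except possibly while the maximum is still 0, where optional
    stopping for 1 - S gives E[1 - S_T; tau > T, S*_T = 0] -> 1 - sum_k p_k = 0,
    with p_k the probability that k is the first index with eta^0_k = 0. *)
Require Import Defs.
From HB Require Import structures.
From mathcomp Require Import all_boot all_order all_algebra.
From mathcomp Require Import all_classical all_reals all_analysis.
From mathcomp Require Import measurable_realfun.
From mathcomp Require Import ring lra zify.
Set SsrOldRewriteGoalsOrder.
Set Implicit Arguments. Unset Strict Implicit. Unset Printing Implicit Defensive.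
Import Order.TTheory GRing.Theory Num.Theory.
Import numFieldNormedType.Exports.
Local Open Scope classical_set_scope.
Local Open Scope ring_scope.

(** * The target law *)

Section Moments.
Context {R : realType}.
Variable mu : int -> R.
Hypothesis muM0 : isM0 mu.

(** The bookkeeping of the attainment half rests on two functions of [z] attached to a level:
    [Tm n], the intended mass stopped at or above [z] while the maximum is [n], and [Lam n], the
    matching coin probabilities scaled by [gam n]. Their increments are proportional, the increment
    of [Lam n] at [z] being [n + 1 - z] times that of [Tm n], which is gambler's ruin read
    backwards; and both are constant off [Xset mu n]. Hence every sum over the barriers of a level
    telescopes, and the recursive weights f, g, rho are needed only through [Lam]. During the
    induction the probability of reaching a level is known only from below. Stopping probabilities
    are therefore computed relative to it, with the factor [gam n] kept on the other side, and no
    equality is claimed before the whole law has been collected. The function b_mu enters only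
    through the sign of [Phi], which is affine in the level and free of division. Atoms at b_mu, a
    finite top of the support and a support unbounded below then become cases of inequalities
    between [tailM], [call] and [gam]. *)

Definition EX (f : int -> R) : R := fine (\esum_(z in [set: int]) (f z * mu z)%:E).

(** Nonnegativity is built in because [EX] is an unordered sum of nonnegative terms; linear growth
    is what the first moment of [mu] can integrate. *)
Definition lingrowth (f : int -> R) : Prop :=
  exists C : R, forall z, 0 <= f z <= C * (1 + `|z|%:~R).

Lemma mu_ge0 z : 0 <= mu z. Proof. by case: muM0. Qed.
Hint Resolve mu_ge0 : core.

Lemma lingrowth_ge0 f z : lingrowth f -> 0 <= f z.
Proof. by case=> C /(_ z)/andP[]. Qed.

Lemma EX_fin f : lingrowth f ->
  \esum_(z in [set: int]) (f z * mu z)%:E \is a fin_num.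
Proof.
case: muM0 => _ m1 m2 _ [C Cf].
have C0 : 0 <= C.
  by have /andP[a b] := Cf 0; move: (le_trans a b); rewrite normr0 addr0 mulr1.
rewrite ge0_fin_numE; last first.
  by apply: esum_ge0 => z _; rewrite lee_fin mulr_ge0//; case/andP: (Cf z).
have hb : (\esum_(z in [set: int]) ((C * mu z)%:E + (C * (`|z|%:~R * mu z))%:E)%E < +oo)%E.
  have hZ (g : int -> R) : (forall z, 0 <= g z) ->
    (\esum_(z in [set: int]) (g z)%:E < +oo)%E ->
    (\esum_(z in [set: int]) (C * g z)%:E < +oo)%E.
    move=> g0 gf.
    have gfin : (\esum_(z in [set: int]) (g z)%:E)%E \is a fin_num.
      by rewrite ge0_fin_numE//; apply: esum_ge0 => z _; rewrite lee_fin.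
    apply: (@le_lt_trans _ _ (C%:E * \esum_(z in [set: int]) (g z)%:E)%E); last first.
      by rewrite -(fineK gfin) -EFinM ltry.
    apply: ge_ereal_sup => _ /= [X [finX XI] <-].
    under eq_fsbigr do rewrite EFinM.
    rewrite -ge0_mule_fsumr//.
    rewrite lee_wpmul2l ?lee_fin//; by apply: ereal_sup_ubound; exists X.
  rewrite esumD; first last.
  - by move=> z _; rewrite lee_fin !mulr_ge0.
  - by move=> z _; rewrite lee_fin mulr_ge0.
  apply: lte_add_pinfty; apply: hZ => //.
  - by rewrite m1 ltry.
  - by move=> z; rewrite mulr_ge0.
apply: le_lt_trans hb; apply: le_esum => z _.
rewrite -EFinD lee_fin.
have -> : C * mu z + C * (`|z|%:~R * mu z) = C * (1 + `|z|%:~R) * mu z by ring.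
by rewrite ler_wpM2r//; case/andP: (Cf z).
Qed.

Lemma lingrowthD f g : lingrowth f -> lingrowth g -> lingrowth (fun z => f z + g z).
Proof.
move=> [C Cf] [D Dg]; exists (C + D) => z.
have /andP[a b] := Cf z; have /andP[a' b'] := Dg z.
by rewrite mulrDl addr_ge0//= lerD.
Qed.

Lemma lingrowthZ k f : 0 <= k -> lingrowth f -> lingrowth (fun z => k * f z).
Proof.
move=> k0 [C Cf]; exists (k * C) => z.
by have /andP[a b] := Cf z; rewrite mulr_ge0//= -mulrA ler_wpM2l.
Qed.

Lemma le_lingrowth f g : (forall z, 0 <= f z <= g z) -> lingrowth g -> lingrowth f.
Proof.
move=> fg [C Cf]; exists C => z.
by have /andP[a b] := Cf z; have /andP[-> fgz]/= := fg z; rewrite (le_trans fgz).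
Qed.

Lemma lingrowth1 : lingrowth (fun=> 1).
Proof. by exists 1 => z; rewrite ler01 mul1r lerDl ler0z. Qed.

Lemma lingrowth_norm : lingrowth (fun z => `|z|%:~R).
Proof. by exists 1 => z; rewrite mul1r ler0z normr_ge0 lerDr ler01. Qed.

Lemma lingrowth_bool (b : int -> bool) : lingrowth (fun z => (b z)%:R).
Proof. by apply: le_lingrowth lingrowth1 => z; case: (b z); rewrite ler01 ?lexx. Qed.

Lemma lingrowth_restr f (b : int -> bool) :
  lingrowth f -> lingrowth (fun z => f z * (b z)%:R).
Proof.
move=> lf; apply: (le_lingrowth _ lf) => z.
have f0 := lingrowth_ge0 z lf.
by case: (b z); rewrite ?mulr1 ?mulr0 f0 lexx.
Qed.

Lemma EXD f g : lingrowth f -> lingrowth g ->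
  EX (fun z => f z + g z) = EX f + EX g.
Proof.
move=> lf lg; rewrite /EX -fineD ?EX_fin//; congr fine.
rewrite -esumD.
- by apply: eq_esum => z _; rewrite -EFinD mulrDl.
- by move=> z _; rewrite lee_fin mulr_ge0 ?(lingrowth_ge0 _ lf).
- by move=> z _; rewrite lee_fin mulr_ge0 ?(lingrowth_ge0 _ lg).
Qed.

Lemma eq_EX f g : f =1 g -> EX f = EX g.
Proof. by move=> fg; congr EX; exact/funext. Qed.

Lemma le_EX f g : (forall z, 0 <= f z <= g z) -> lingrowth g -> EX f <= EX g.
Proof.
move=> fg lg; have lf := le_lingrowth fg lg.
rewrite -lee_fin !fineK ?EX_fin//; apply: le_esum => z _.
by rewrite lee_fin ler_wpM2r//; case/andP: (fg z).
Qed.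

Lemma EX_ge0 f : (forall z, 0 <= f z) -> 0 <= EX f.
Proof.
by move=> f0; apply: fine_ge0; apply: esum_ge0 => z _; rewrite lee_fin mulr_ge0.
Qed.

Lemma EXZ k f : 0 <= k -> lingrowth f -> EX (fun z => k * f z) = k * EX f.
Proof.
move=> k0 lf.
(* One inequality for every factor is enough: used with [k^-1] on [k * f] it yields the reverse
   one. *)
have le1 (k' : R) g : 0 <= k' -> lingrowth g -> EX (fun z => k' * g z) <= k' * EX g.
  move=> k'0 lg; rewrite -lee_fin EFinM !fineK ?EX_fin//; last exact: lingrowthZ.
  apply: ge_ereal_sup => _ /= [X [finX XI] <-].
  under eq_fsbigr do rewrite -mulrA EFinM.
  rewrite -ge0_mule_fsumr//; last first.
    by move=> z; rewrite lee_fin mulr_ge0// (lingrowth_ge0 _ lg).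
  rewrite lee_wpmul2l ?lee_fin//; by apply: ereal_sup_ubound; exists X.
have [->|kn0] := eqVneq k 0.
  rewrite mul0r /EX esum1// => z _; by rewrite !mul0r.
have kp : 0 < k by rewrite lt_def kn0.
apply/eqP; rewrite eq_le le1//=.
have := @le1 k^-1 (fun z => k * f z); rewrite invr_ge0 => /(_ k0 (lingrowthZ k0 lf)).
under eq_EX do rewrite mulKf//.
by rewrite ler_pdivlMl.
Qed.

Lemma EX1 : EX (fun=> 1) = 1.
Proof.
case: muM0 => _ m1 _ _; rewrite /EX.
by under eq_esum do rewrite mul1r; rewrite m1.
Qed.

Lemma EX_pred1 x : EX (fun z => (z == x)%:R) = mu x.
Proof.
rewrite /EX.
rewrite (@eq_esum _ _ _ _ (fun z => if z \in [set x] then (mu z)%:E else 0%E)).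
  by rewrite -esum_mkcond esum_set1// lee_fin.
move=> z _; rewrite in_set1; case: eqP => _; by rewrite ?mul1r ?mul0r.
Qed.

Lemma EX_gt0 f z : lingrowth f -> 0 < f z -> 0 < mu z -> 0 < EX f.
Proof.
move=> lf fz mz.
have : EX (fun w => f z * (w == z)%:R) <= EX f.
  apply: le_EX => // w; case: eqP => [->|_]; first by rewrite mulr1 lexx ltW.
  by rewrite mulr0 lexx (lingrowth_ge0 _ lf).
rewrite (EXZ (ltW fz) (lingrowth_bool (fun w => w == z))) EX_pred1.
by apply: lt_le_trans; rewrite mulr_gt0.
Qed.

Lemma EX_eq0 f : (forall z, 0 < mu z -> f z = 0) -> EX f = 0.
Proof.
move=> f0; rewrite /EX esum1// => z _.
by have := mu_ge0 z; rewrite le_eqVlt => /predU1P[<-|/f0 ->]; rewrite ?mul0r ?mulr0.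
Qed.

(** Finitely many integers nearly exhaust the sum, and they lie in some interval [-N, N]. *)
Lemma EX_tail f (e : R) : lingrowth f -> 0 < e ->
  exists N : nat, EX (fun z => f z * (N%:Z < `|z|)%R%:R) <= e.
Proof.
move=> lf e0.
have fin := EX_fin lf.
have [_ [X [finX _] <-] hX] := ub_ereal_sup_adherent e0 fin.
have [N hN] : exists N : nat, forall z, X z -> `|z| <= N%:Z.
  have /finite_seqP[s ->] := finX.
  exists (\max_(z <- s) `|z|%N) => z /= zs.
  by rewrite -[`|z|]abszE lez_nat (leq_bigmax_seq _ zs isT).
exists N.
have hs : EX f = EX (fun z => f z * (`|z| <= N%:Z)%R%:R)
               + EX (fun z => f z * (N%:Z < `|z|)%R%:R).
  rewrite -EXD; [|exact: lingrowth_restr..].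
  by apply: eq_EX => z; rewrite -mulrDr ltNge; case: (_ <= _); rewrite /= ?addr0 ?add0r mulr1.
have lfN : lingrowth (fun z => f z * (`|z| <= N%:Z)%R%:R) by exact: lingrowth_restr.
have : (\sum_(i \in X) (f i * mu i)%:E <= (EX (fun z => f z * (`|z| <= N%:Z)%R%:R))%:E)%E.
  rewrite fineK ?EX_fin//; apply: esum_ge; exists X => //.
  by apply: lee_fsum => // z /hN ->; rewrite mulr1.
move=> /(lt_le_trans hX); rewrite -[ereal_sup _]/(\esum_(z in [set: int]) (f z * mu z)%:E) -(fineK fin) -/(EX f) -EFinB lte_fin hs => h.
lra.
Qed.

(** * Tail mass, call and put prices *)

Definition tailM (z : int) : R := EX (fun w => (z <= w)%R%:R).
Definition call (z : int) : R := EX (fun w => Num.max (w - z)%:~R 0).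
Definition put (z : int) : R := EX (fun w => Num.max (z - w)%:~R 0).

Lemma lingrowth_shift (z : int) : lingrowth (fun w => `|w - z|%:~R).
Proof.
exists (1 + `|z|%:~R) => w; rewrite ler0z normr_ge0/=.
have h : `|w - z| <= (1 + `|z|) * (1 + `|w|) by nia.
by rewrite -(ler_int R) in h; apply: le_trans h _; rewrite intrM !intrD.
Qed.

Lemma lingrowth_call z : lingrowth (fun w => Num.max (w - z)%:~R 0).
Proof.
apply: le_lingrowth (lingrowth_shift z) => w.
by rewrite le_max lexx orbT/= ge_max ler0z normr_ge0 andbT ler_int ler_norm.
Qed.

Lemma lingrowth_put z : lingrowth (fun w => Num.max (z - w)%:~R 0).
Proof.
apply: le_lingrowth (lingrowth_shift z) => w.
by rewrite le_max lexx orbT/= ge_max ler0z normr_ge0 andbT ler_int distrC ler_norm.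
Qed.

Lemma tailM_ge0 z : 0 <= tailM z. Proof. by apply: EX_ge0 => w; rewrite ler0n. Qed.

Lemma call_ge0 z : 0 <= call z. Proof. by apply: EX_ge0 => w; rewrite le_max lexx orbT. Qed.

Lemma put_ge0 z : 0 <= put z. Proof. by apply: EX_ge0 => w; rewrite le_max lexx orbT. Qed.

Lemma tailM_le1 z : tailM z <= 1.
Proof. by rewrite -EX1; apply: le_EX lingrowth1 => w; rewrite ler0n lern1 leq_b1. Qed.

Lemma tailM_rec z : tailM z = mu z + tailM (z + 1).
Proof.
rewrite -(EX_pred1 z) -EXD ?/tailM; [|exact: (lingrowth_bool _)..].
apply: eq_EX => w; case: (ltgtP z w) => [h|h|->].
- have -> : (z + 1 <= w) = true by lia.
  by rewrite add0r.
- have -> : (z + 1 <= w) = false by lia.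
  by rewrite add0r.
- have -> : (w + 1 <= w) = false by lia.
  by rewrite addr0.
Qed.

Lemma intr_max (a b : int) : (Num.max a b)%:~R = Num.max a%:~R b%:~R :> R.
Proof.
by case: (leP a b) => h; [rewrite max_r ?ler_int|rewrite max_l ?ler_int// ltW].
Qed.

Lemma call_rec z : call z = call (z + 1) + tailM (z + 1).
Proof.
rewrite -EXD ?/call; [|exact: lingrowth_call|exact: (lingrowth_bool _)].
apply: eq_EX => w; case: (leP (z + 1) w) => h.
- have h1 : (0 : R) <= (w - z)%:~R by rewrite ler0z; lia.
  have h2 : (0 : R) <= (w - (z + 1))%:~R by rewrite ler0z; lia.
  by rewrite !max_l//= !intrD opprD intrD; lra.
- have h1 : (w - z)%:~R <= (0 : R) by rewrite lerz0; lia.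
  have h2 : (w - (z + 1))%:~R <= (0 : R) by rewrite lerz0; lia.
  by rewrite !max_r//= addr0.
Qed.

Lemma tailM_gt0 z : (0 < tailM z) <-> (exists2 w, z <= w & 0 < mu w).
Proof.
split=> [h|[w zw mw]].
  apply: contrapT => hn; move: h; rewrite /tailM EX_eq0 ?ltxx// => w mw.
  case: (leP z w) => // zw; exfalso; apply: hn; by exists w.
by apply: (EX_gt0 (z := w)) => //; [exact: (lingrowth_bool _)|rewrite zw ltr01].
Qed.

Lemma put_gt0 z : (0 < put z) <-> (exists2 w, w < z & 0 < mu w).
Proof.
split=> [h|[w zw mw]].
  apply: contrapT => hn; move: h; rewrite /put EX_eq0 ?ltxx// => w mw.
  apply: max_r; rewrite lerz0 subr_le0 leNgt; apply/negP => zw.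
  by apply: hn; exists w.
apply: (EX_gt0 (z := w)) => //; first exact: lingrowth_put.
by rewrite lt_max ltr0z subr_gt0 zw.
Qed.

Lemma tailM_1sub z : 1 - tailM z = EX (fun w => (w < z)%R%:R).
Proof.
suff : EX (fun=> 1) = tailM z + EX (fun w => (w < z)%R%:R) by rewrite EX1; lra.
rewrite -EXD; [|exact: (lingrowth_bool _)..].
by apply: eq_EX => w; case: ltP => _; rewrite ?addr0 ?add0r.
Qed.

Lemma call_gt0 z : 0 < tailM (z + 1) -> 0 < call z.
Proof. by rewrite call_rec => h; rewrite ltr_wpDl// call_ge0. Qed.

(** Weights are nonnegative, so the positive and negative parts of [h y * mu y] are those of [h y]
    times [mu y]. This carries [mubar] and [psi] over to [EX]. *)
Lemma sumZ_EX (h : int -> R) A : sumZ (fun y => h y * mu y) A =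
  EX (fun y => Num.max (h y) 0 * (y \in A)%:R)
  - EX (fun y => Num.max (- h y) 0 * (y \in A)%:R).
Proof.
have inb (p : int -> bool) (y : int) : (y \in [set y | p y]) = p y.
  by apply/idP/idP; rewrite inE.
rewrite /sumZ /EX; congr (fine _ - fine _); rewrite esum_mkcond; apply: eq_esum => y _;
  rewrite in_setI inb; case: (y \in A); rewrite /= ?mulr0 ?mul0r// mulr1.
- case: ifPn => [h0|]; last first.
    rewrite -ltNge => h0; rewrite max_r ?mul0r// leNgt; apply/negP => hy.
    by move: h0; rewrite ltNge mulr_ge0// ltW.
  have [hy|hy] := leP 0 (h y) => //.
  have -> : mu y = 0; last by rewrite !mulr0.
  by apply/eqP; rewrite eq_le mu_ge0 andbT -(nmulr_rge0 _ hy).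
- case: ifPn => [h0|]; last first.
    rewrite -leNgt => h0; have [hy|hy] := leP 0 (- h y); last by rewrite mul0r.
    suff e0 : h y * mu y = 0 by rewrite mulNr e0 oppr0.
    by apply/eqP; rewrite eq_le h0 andbT mulr_le0_ge0// -oppr_ge0.
  have [hy|hy] := leP 0 (- h y); first by rewrite mulNr.
  by move: h0; rewrite ltNge mulr_ge0// -oppr_le0 ltW.
Qed.

Lemma mean0 : EX (fun z => Num.max z%:~R 0) = EX (fun z => Num.max (- z%:~R) 0).
Proof.
case: muM0 => _ _ _; rewrite (sumZ_EX (fun z => z%:~R)) => h.
transitivity (EX (fun y => Num.max y%:~R 0 * (y \in [set: int])%:R)).
  by apply: eq_EX => z; rewrite in_setT mulr1.
transitivity (EX (fun y => Num.max (- y%:~R) 0 * (y \in [set: int])%:R)).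
  lra.
by apply: eq_EX => z; rewrite in_setT mulr1.
Qed.

Lemma lingrowth_pos : lingrowth (fun z => Num.max z%:~R 0).
Proof. by have := lingrowth_call 0; under [X in lingrowth X]eq_fun do rewrite subr0. Qed.

Lemma lingrowth_neg : lingrowth (fun z => Num.max (- z%:~R) 0).
Proof. by have := lingrowth_put 0; under [X in lingrowth X]eq_fun do rewrite sub0r intrN. Qed.

(** Put-call parity: the difference of the two payoffs is [w - z], and [mu] has mean zero. *)
Lemma call_put z : call z = put z - z%:~R.
Proof.
have m0 := mean0.
have l1 := lingrowth_pos; have l2 := lingrowth_neg.
have l3 := lingrowth_call z; have l4 := lingrowth_put z.
(* [EX] is additive on nonnegative functions only, so the constant [z] has to stand on the side
   where it is nonnegative; its sign decides which. *)
wlog z0 : / 0 <= z.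
  move=> hw.
  case: (leP 0 z) => [|z0]; first exact: hw.
  have l5 : lingrowth (fun=> (- z)%:~R * 1).
    by apply: lingrowthZ lingrowth1; rewrite ler0z; lia.
  have : call z + EX (fun z => Num.max (- z%:~R) 0)
       = EX (fun z => Num.max z%:~R 0) + EX (fun=> (- z)%:~R * 1) + put z.
    rewrite -!EXD//; last exact: lingrowthD.
    apply: eq_EX => w.
    rewrite mulr1 -!intrN -[0 : R]/(0%:~R) -!(intr_max) -!intrD; congr intmul; lia.
  rewrite EXZ ?EX1 ?mulr1; [|by rewrite ler0z; lia|exact: lingrowth1].
  by rewrite m0 intrN; lra.
have l5 : lingrowth (fun=> z%:~R * 1).
  by apply: lingrowthZ lingrowth1; rewrite ler0z.
have : call z + EX (fun=> z%:~R * 1) + EX (fun z => Num.max (- z%:~R) 0)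
       = EX (fun z => Num.max z%:~R 0) + put z.
  rewrite -!EXD//; last exact: lingrowthD.
  apply: eq_EX => w.
  rewrite mulr1 -!intrN -[0 : R]/(0%:~R) -!(intr_max) -!intrD; congr intmul; lia.
rewrite EXZ ?EX1 ?mulr1; [|by rewrite ler0z|exact: lingrowth1].
by rewrite m0; lra.
Qed.

Lemma sumZ_tailM (z : int) : sumZ mu [set y | (z <= y)%R] = tailM z.
Proof.
have -> : sumZ mu [set y | (z <= y)%R] = sumZ (fun y => 1 * mu y) [set y | (z <= y)%R].
  by congr sumZ; apply/funext => y; rewrite mul1r.
rewrite sumZ_EX [X in _ - X]EX_eq0 ?subr0.
  apply: eq_EX => y; rewrite max_l// mul1r; congr (nat_of_bool _)%:R.
  by apply/idP/idP; rewrite inE.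
by move=> y _; rewrite max_r ?mul0r// lerN10.
Qed.

Lemma sumZ_call (z : int) : sumZ (fun y => y%:~R * mu y) [set y | (z <= y)%R]
  = call z + z%:~R * tailM z.
Proof.
have inb y : (y \in [set y : int | (z <= y)%R]) = (z <= y) by apply/idP/idP; rewrite inE.
rewrite sumZ_EX.
pose b (y : int) := (z <= y)%R.
rewrite (@eq_EX _ (fun y => Num.max y%:~R 0 * (b y)%:R)); last by move=> y; rewrite inb.
rewrite [X in _ - X](@eq_EX _ (fun y => Num.max (- y%:~R) 0 * (b y)%:R)); last by move=> y; rewrite inb.
have l1 := lingrowth_restr b lingrowth_pos.
have l2 := lingrowth_restr b lingrowth_neg.
have lb := lingrowth_bool b.
have lc := lingrowth_call z.
case: (leP 0 z) => z0.
  have zR : (0 : R) <= z%:~R by rewrite ler0z.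
  have : EX (fun y => Num.max y%:~R 0 * (b y)%:R)
     = call z + EX (fun y => z%:~R * (b y)%:R)
       + EX (fun y => Num.max (- y%:~R) 0 * (b y)%:R).
    have lz := lingrowthZ zR lb.
    rewrite -!EXD//; last exact: lingrowthD.
    apply: eq_EX => y; rewrite /b; case: leP => zy; rewrite ?mulr1 ?mulr0 ?addr0.
      rewrite -!intrN -[0 : R]/(0%:~R) -!(intr_max) -!intrD; congr intmul; lia.
    by rewrite max_r// lerz0; lia.
  by rewrite EXZ// -/(tailM z); lra.
have zR : (0 : R) <= (- z)%:~R by rewrite ler0z; lia.
have : EX (fun y => Num.max y%:~R 0 * (b y)%:R) + EX (fun y => (- z)%:~R * (b y)%:R)
     = call z + EX (fun y => Num.max (- y%:~R) 0 * (b y)%:R).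
  have lz := lingrowthZ zR lb; rewrite -!EXD//.
  apply: eq_EX => y; rewrite /b; case: leP => zy; rewrite ?mulr1 ?mulr0 ?addr0.
    rewrite -!intrN -[0 : R]/(0%:~R) -!(intr_max) -!intrD; congr intmul; lia.
  by rewrite max_r// lerz0; lia.
by rewrite EXZ// -/(tailM z) intrN; lra.
Qed.

(* The sign of [Phi] and the function b_mu *)
Opaque EX tailM call put.

(* [Phi y z >= 0] iff [psi_mu(z) <= y], so [Phi y] changes sign at [b_mu(y)]. *)
Definition Phi (y : R) (z : int) : R := (y - z%:~R) * tailM z - call z.

(** With X of law [mu], [Phi y z] is the expectation of y - X on X >= z; the recursion splits off
    the atom at [z]. *)
Lemma Phi_rec (y : R) z : Phi y z = (y - z%:~R) * mu z + Phi y (z + 1).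
Proof. by rewrite /Phi tailM_rec call_rec intrD; ring. Qed.

Lemma Phi_shift (y y' : R) z : Phi y' z = Phi y z + (y' - y) * tailM z.
Proof. by rewrite /Phi; ring. Qed.

(** Each atom passed between [z] and [w] lies at or below [y], hence contributes a nonnegative term
    [(y - v) * mu v]. *)
Lemma Phi_antitone (y : R) (z w : int) : z <= w -> w%:~R <= y + 1 -> Phi y w <= Phi y z.
Proof.
move=> zw; have -> : w = z + `|w - z|%N%:Z by lia.
elim: `|w - z|%N => [|j ih] wy; first by rewrite addr0.
apply: (@le_trans _ _ (Phi y (z + j%:Z))); last first.
  by apply: ih; apply: le_trans wy; rewrite ler_int; lia.
rewrite [leRHS]Phi_rec.
have -> : z + j%:Z + 1 = z + j.+1%:Z by lia.
rewrite lerDr mulr_ge0// subr_ge0.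
have e : (z + j.+1%:Z)%:~R = (z + j%:Z)%:~R + 1 :> R.
  by rewrite -[1 : R]/(1%:~R) -intrD; congr intmul; lia.
by move: wy; rewrite e lerD2r.
Qed.

Lemma call_eq0 z : tailM z = 0 -> call z = 0.
Proof.
move=> h; apply: EX_eq0 => w mw; apply: max_r; rewrite lerz0 subr_le0 leNgt.
apply/negP => zw; have : 0 < tailM z by apply/tailM_gt0; exists w => //; exact: ltW.
by rewrite h ltxx.
Qed.

Lemma Phi_lt0 (y : R) z : y < z%:~R -> 0 < tailM z -> Phi y z < 0.
Proof.
move=> yz z0; rewrite /Phi; have := call_ge0 z.
have : (y - z%:~R) * tailM z < 0 by rewrite pmulr_llt0// subr_lt0.
lra.
Qed.

Lemma mubarE x : mubar mu x = tailM (Num.ceil x).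
Proof.
rewrite /mubar -sumZ_tailM; congr sumZ; apply/seteqP; split => y /=;
  by rewrite ceil_le_int.
Qed.

Lemma psiE x : psi mu x = if 0 < tailM (Num.ceil x)
  then (Num.ceil x)%:~R + call (Num.ceil x) / tailM (Num.ceil x) else x.
Proof.
rewrite /psi mubarE; case: ifPn => // h.
have -> : [set y : int | x <= y%:~R] = [set y | (Num.ceil x <= y)%R].
  by apply/seteqP; split => y /=; rewrite ceil_le_int.
by rewrite sumZ_call; field; rewrite gt_eqF.
Qed.

Lemma mubar_int z : mubar mu z%:~R = tailM z.
Proof. by rewrite mubarE intrKceil. Qed.

Lemma psi_int z : 0 < tailM z -> psi mu z%:~R = z%:~R + call z / tailM z.
Proof. by move=> h; rewrite psiE intrKceil h. Qed.

Lemma psi_leE (x y : R) : 0 < tailM (Num.ceil x) ->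
  (psi mu x <= y) = (0 <= Phi y (Num.ceil x)).
Proof.
move=> h; rewrite psiE h /Phi subr_ge0 -lerBrDl ler_pdivrMr//.
Qed.

Lemma psi_ge (x : R) : x <= psi mu x.
Proof.
rewrite psiE; case: ifPn => // h; rewrite (le_trans (ceil_ge x))// lerDl.
by apply: divr_ge0; [exact: call_ge0|exact: tailM_ge0].
Qed.

(** [psi] sees a real [x] through its ceiling, so one strict sign at the integer [w] settles all
    reals above [w - 1]. *)
Lemma psi_gt (y x : R) (w : int) : Phi y w < 0 -> (w - 1)%:~R < x -> y < psi mu x.
Proof.
move=> yw wx.
have wc : w <= Num.ceil x.
  by have := wx; rewrite -ceil_gt_int; move: (Num.ceil x) => c; lia.
have key : (Num.ceil x)%:~R <= y + 1 -> Phi y (Num.ceil x) < 0.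
  by move=> h; apply: le_lt_trans yw; exact: Phi_antitone.
have [h|h] := ltP 0 (tailM (Num.ceil x)).
  rewrite ltNge psi_leE// -ltNge.
  by have [/key//|h'] := leP (Num.ceil x)%:~R (y + 1); apply: Phi_lt0 => //; lra.
(* Above the support [psi] is the identity and [Phi] vanishes, which contradicts the strict sign
   inherited from [w]. *)
have t0 : tailM (Num.ceil x) = 0 by apply/eqP; rewrite eq_le h tailM_ge0.
rewrite psiE t0 ltxx ltNge; apply/negP => xy.
have : Phi y (Num.ceil x) < 0.
  apply: key; have := ceilB1_lt x; rewrite intrD; lra.
by rewrite /Phi t0 call_eq0// mulr0 subr0 ltxx.
Qed.

Lemma bmu_le (y : R) w : Phi y w < 0 -> (bmu mu y <= ((w - 1)%:~R)%:E)%E.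
Proof.
move=> yw; apply: ge_ereal_sup => _ /= [x xy <-]; rewrite lee_fin leNgt.
by apply/negP => /(psi_gt yw); rewrite ltNge xy.
Qed.

Lemma bmu_ge (y w : R) : psi mu w <= y -> (w%:E <= bmu mu y)%E.
Proof. by move=> wy; apply: ereal_sup_ubound; exists w. Qed.

Lemma bmu_leid (y : R) : (bmu mu y <= y%:E)%E.
Proof.
apply: ge_ereal_sup => _ /= [x xy <-]; rewrite lee_fin.
exact: le_trans (psi_ge x) xy.
Qed.

(** The sign change of [Phi y] pins down the supremum over real [x]; mass above [z] keeps [psi] away
    from its default value at both [z] and [z + 1]. *)
Lemma bmuP (y : R) z : 0 < tailM (z + 1) ->
  (bmu mu y = (z%:~R)%:E) <-> (0 <= Phi y z /\ Phi y (z + 1) < 0).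
Proof.
move=> t1; have tz : 0 < tailM z by rewrite tailM_rec ltr_wpDl.
split=> [e|[h1 h2]].
  split.
    rewrite leNgt; apply/negP => /bmu_le; rewrite e lee_fin ler_int; lia.
  rewrite ltNge; apply/negP => h.
  have : ((z + 1)%:~R%:E <= bmu mu y)%E.
    by apply: bmu_ge; rewrite psi_leE intrKceil.
  by rewrite e lee_fin ler_int; lia.
apply/eqP; rewrite eq_le; apply/andP; split.
  by have := bmu_le h2; rewrite addrK.
by apply: bmu_ge; rewrite psi_leE intrKceil.
Qed.

(** With no mass above [z], [psi] fixes [z], so the general bound b_mu(y) <= y is attained. *)
Lemma bmu_id (y : R) z : y = z%:~R -> tailM (z + 1) = 0 -> bmu mu y = (z%:~R)%:E.
Proof.
move=> -> t1; apply/eqP; rewrite eq_le bmu_leid/=.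
have cz : call z = 0 by rewrite call_rec call_eq0 ?t1 ?addr0.
by apply: bmu_ge; rewrite psiE intrKceil cz mul0r addr0; case: ifP.
Qed.

(** * The value of b_mu at an integer level *)

(** When mass remains above [n] this is b_mu(n); for [n = 0] it is the lowest atom, and there is
    none if the support is unbounded below. *)
Definition anchor (n : nat) (a : int) : Prop :=
  0 <= Phi n%:R a /\ Phi n%:R (a + 1) < 0.

Lemma below_xbarE n : below_xbar mu n <-> 0 < tailM (n%:Z + 1).
Proof.
split=> [[z [nz mz]]|/tailM_gt0[z nz mz]].
  by apply/tailM_gt0; exists z => //; lia.
by exists z; split=> //; lia.
Qed.

Lemma tailM_antitone (z w : int) : z <= w -> tailM w <= tailM z.
Proof.
move=> zw; apply: le_EX; last exact: (lingrowth_bool _).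
by move=> v; rewrite ler0n ler_nat; lia.
Qed.

(* [Phi 1 z] is [1] minus the truncated moment of [1 - X] on [X < z]. *)
Lemma Phi1_tail e : 0 < e -> exists N : nat, forall z : int, z <= - N%:Z -> 1 - e <= Phi 1 z.
Proof.
move=> e0.
have [N hN] := EX_tail (lingrowthD lingrowth1 lingrowth_norm) e0.
exists N.+1 => z zN.
have -> : Phi 1 z = 1 - EX (fun w => (1 + `|w|%:~R) * (w < z)%R%:R).
  have -> : EX (fun w => (1 + `|w|%:~R) * (w < z)%R%:R)
      = put z + (1 - z)%:~R * EX (fun w => (w < z)%R%:R).
    have z1 : (0 : R) <= (1 - z)%:~R by rewrite ler0z; lia.
    have lb := lingrowth_bool (fun w => (w < z)%R).
    rewrite -EXZ// -EXD//; [|exact: lingrowth_put|exact: lingrowthZ].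
    apply: eq_EX => w; case: ltP => wz; rewrite ?mulr1 ?mulr0 ?addr0.
      by rewrite -[1 : R]/(1%:~R) -[0 : R]/(0%:~R) -intr_max -!intrD; congr intmul; lia.
    by rewrite max_r// lerz0; lia.
  by rewrite -tailM_1sub /Phi call_put intrB; ring.
rewrite lerD2l lerN2; apply: le_trans hN; apply: le_EX; last first.
  exact: lingrowth_restr (lingrowthD lingrowth1 lingrowth_norm).
move=> w; have h : (0 : R) <= 1 + `|w|%:~R by rewrite addr_ge0 ?ler0z.
by rewrite mulr_ge0 ?ler0n//= ler_wpM2l// ler_nat; lia.
Qed.

(** By parity [Phi 1 z] equals 1 - put z - (1 - z)(1 - tailM z), and the put is positive as soon as
    there is mass below [z]. *)
Lemma Phi1_lt1 (z : int) : z <= 1 -> (exists2 w, w < z & 0 < mu w) -> Phi 1 z < 1.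
Proof.
move=> z1 hw; have := hw => /put_gt0 p0.
have t1 : tailM z <= 1 := tailM_le1 z.
have : (1 - z%:~R) * tailM z <= 1 - z%:~R.
  by rewrite ler_piMr// subr_ge0 -[1 : R]/(1%:~R) ler_int.
by rewrite /Phi call_put; lra.
Qed.

Lemma Phi0_lt0 (z : int) : z <= 0 -> (exists2 w, w < z & 0 < mu w) -> Phi 0 z < 0.
Proof.
move=> z0 hw; have := hw => /put_gt0 p0.
have t1 : tailM z <= 1 := tailM_le1 z.
have : (0 - z%:~R) * tailM z <= - z%:~R.
  by rewrite sub0r ler_piMr// oppr_ge0 lerz0.
by rewrite /Phi call_put; lra.
Qed.

(** [Phi n] is negative at [n] and nonnegative far to the left, where [Phi 1] is already at least
    1/2; the anchor is the first nonnegative place met on the way down from [n]. *)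
Lemma anchor_exists n : below_xbar mu n -> (0 < n)%N -> exists a, anchor n a.
Proof.
move=> /below_xbarE hb n0.
have e2 : (0 : R) < 2^-1 by lra.
have [N hN] := Phi1_tail e2.
have hp : exists j, 0 <= Phi n%:R (n%:Z - j%:Z).
  exists (n + N)%N.
  have h1 : 1 - 2^-1 <= Phi 1 (n%:Z - (n + N)%N%:Z) by apply: hN; lia.
  rewrite (Phi_shift 1) addr_ge0 ?mulr_ge0 ?tailM_ge0//; first by lra.
  by rewrite subr_ge0 ler1n.
case: (ex_minnP hp) => j hj jmin; exists (n%:Z - j%:Z); split=> //.
have j0 : (0 < j)%N.
  rewrite lt0n; apply/eqP => j0; move: hj; rewrite j0 subr0 /Phi.
  rewrite -(pmulrn 1 n) subrr mul0r sub0r oppr_ge0 leNgt => /negP; apply.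
  exact: call_gt0.
rewrite ltNge; apply/negP => h; have := jmin j.-1.
have -> : n%:Z - j.-1%:Z = n%:Z - j%:Z + 1 by lia.
by move=> /(_ h); lia.
Qed.

(** For z <= 0 parity gives Phi 0 z <= - put z, so on level 0 the sign can change only at the lowest
    atom; that atom has to exist. *)
Lemma anchor0_exists : xlow_finite mu -> below_xbar mu 0 -> exists a, anchor 0 a.
Proof.
move=> [L hL] /below_xbarE hb.
have c0 : 0 < call 0 by apply: call_gt0.
have hex : exists j : nat, `[< 0 < mu (L + j%:Z) >].
  have /tailM_gt0[w _ mw] := hb; exists `|w - L|%N; apply/asboolP.
  by have -> : L + `|w - L|%N%:Z = w by have := hL _ mw; lia.
case: (ex_minnP hex) => j /asboolP hj jmin; set a := L + j%:Z in hj *.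
have amin w : 0 < mu w -> a <= w.
  move=> mw; have Lw := hL _ mw.
  have : (j <= `|w - L|)%N.
    by apply: jmin; apply/asboolP; have -> : L + `|w - L|%N%:Z = w by lia.
  by rewrite /a; lia.
have noput z : z <= a -> put z = 0.
  move=> za; apply/eqP; rewrite eq_le put_ge0 andbT leNgt; apply/negP.
  by move/put_gt0 => [w wa /amin aw]; lia.
have a0 : a < 0.
  rewrite ltNge; apply/negP => a0.
  by move: c0; rewrite call_put noput// subr0 ltxx.
have Ma : tailM a = 1.
  suff : 1 - tailM a = 0 by lra.
  rewrite tailM_1sub; apply: EX_eq0 => w /amin aw.
  by have -> : (w < a) = false by lia.
exists a; split; last first.
  by apply: Phi0_lt0; [lia|exists a => //; lia].
by rewrite /Phi Ma call_put noput//; lra.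
Qed.

Lemma noanchor0 : ~ xlow_finite mu -> forall z : int, exists2 w, w < z & 0 < mu w.
Proof.
move=> nf z; apply: contrapT => hn; apply: nf; exists z => w mw.
by rewrite leNgt; apply/negP => wz; apply: hn; exists w.
Qed.

Definition gam (n : nat) : R := if n == 0%N then 1 else ay_bound mu n.

(* [b] plays the role of [b_mu(m)]; the bound [(m - b) * gam m = call b] also
   covers the convention [0/0 = 1], where [b = m] is the top of the support. *)
Definition barrier (m : nat) (b : int) : Prop :=
  [/\ (m%:R - b%:~R) * gam m = call b, tailM (b + 1) <= gam m <= tailM b,
      b <= m%:Z /\ (tailM (m%:Z + 1) = 0 <-> b = m%:Z), 0 <= Phi m%:R b & forall z : int, z < m%:Z -> b < z -> Phi m%:R z < 0].

Lemma natr_intr (n : nat) : n%:R = (n%:Z)%:~R :> R.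
Proof. by []. Qed.

Lemma Phi_diag (n : nat) : Phi n%:R n%:Z = - call n%:Z.
Proof. by rewrite /Phi natr_intr subrr mul0r sub0r. Qed.

Lemma anchor_lt n a : below_xbar mu n -> anchor n a -> a < n%:Z.
Proof.
move=> /below_xbarE hb [h1 h2].
have M0 : 0 < tailM n%:Z by rewrite tailM_rec ltr_wpDl.
rewrite ltNge; apply/negP => na.
case: (ltgtP a n%:Z) => [|na'|e]; [lia| |].
  have ta : tailM a = 0.
    apply/eqP; rewrite eq_le tailM_ge0 andbT leNgt; apply/negP => ta.
    have := @Phi_lt0 n%:R a; rewrite natr_intr ltr_int na' => /(_ isT ta).
    by move: h1; rewrite natr_intr; lra.
  have ta1 : tailM (a + 1) = 0.
    by apply/eqP; rewrite eq_le tailM_ge0 andbT -ta tailM_antitone//; lia.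
  by move: h2; rewrite /Phi ta1 call_eq0// mulr0 subr0 ltxx.
move: h1; rewrite e Phi_diag oppr_ge0 leNgt => /negP; apply.
exact: call_gt0.
Qed.

Lemma anchor0_call a : below_xbar mu 0 -> anchor 0 a -> call a = - a%:~R.
Proof.
move=> hb ha; have a0 := anchor_lt hb ha; case: ha => h1 _.
rewrite call_put; suff -> : put a = 0 by rewrite sub0r.
apply/eqP; rewrite eq_le put_ge0 andbT leNgt; apply/negP => /put_gt0.
by move=> /Phi0_lt0; rewrite ltNge h1/= => h; have := h (ltW a0).
Qed.

(** On level 0 the quotient is 1 because mean zero gives [call a = - a] at the lowest atom; this is
    why [gam 0] is set to 1. *)
Lemma gam_anchor n a : below_xbar mu n -> anchor n a ->
  gam n = call a / (n%:R - a%:~R).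
Proof.
move=> hb ha; have an := anchor_lt hb ha.
have an' : (0 : R) < n%:R - a%:~R by rewrite natr_intr subr_gt0 ltr_int.
rewrite /gam; case: eqP => [n0|_].
  move: hb ha an'; rewrite n0 => hb ha an'.
  by rewrite (anchor0_call hb ha) sub0r divff// gt_eqF// -sub0r.
have M1 : 0 < tailM (a + 1).
  by apply: lt_le_trans (tailM_antitone _); [exact/below_xbarE/hb|lia].
have Ma : 0 < tailM a by rewrite tailM_rec ltr_wpDl.
have -> : ay_bound mu n = mubar mu a%:~R * frac00 (psi mu a%:~R - a%:~R) (n%:R - a%:~R).
  by rewrite /ay_bound (bmuP _ M1).2.
rewrite /frac00 mubar_int psi_int// [in X in _ && X]gt_eqF// andbF.
field; rewrite !gt_eqF//.
Qed.

Lemma gam_top (m : nat) : (0 < m)%N -> tailM (m%:Z + 1) = 0 -> gam m = tailM m%:Z.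
Proof.
move=> m0 t1; rewrite /gam -(prednK m0) /= prednK//.
rewrite /ay_bound (@bmu_id m%:R m%:Z)//= mubar_int.
have cz : call m%:Z = 0 by rewrite call_rec call_eq0 ?t1 ?addr0.
have -> : psi mu m%:Z%:~R = m%:R.
  by rewrite psiE intrKceil cz mul0r addr0; case: ifP.
by rewrite /frac00 natr_intr subrr eqxx /= mulr1.
Qed.

(** Once (n - a) gam n = call a is known, the two signs in [anchor n a] are the two comparisons of
    [gam n] with the tail just above and at [a]. *)
Lemma gam_anchor_bounds n a : below_xbar mu n -> anchor n a ->
  [/\ 0 < gam n, tailM (a + 1) < gam n, gam n <= tailM a &
      (n%:R - a%:~R) * gam n = call a].
Proof.
move=> hb ha; have an := anchor_lt hb ha; have g := gam_anchor hb ha.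
have an' : (0 : R) < n%:R - a%:~R by rewrite natr_intr subr_gt0 ltr_int.
have M1 : 0 < tailM (a + 1).
  by apply: lt_le_trans (tailM_antitone _); [exact/below_xbarE/hb|lia].
have e : (n%:R - a%:~R) * gam n = call a by rewrite g mulrC divfK// gt_eqF.
case: ha => h1 h2; split=> //.
- by rewrite g divr_gt0// call_gt0.
- rewrite -(ltr_pM2l an') e call_rec; move: h2; rewrite /Phi intrD; lra.
- rewrite -(ler_pM2l an') e; move: h1; rewrite /Phi; lra.
Qed.

Lemma anchor_barrier m b : below_xbar mu m -> anchor m b -> barrier m b.
Proof.
move=> hb ha; have [h1 h2 h3 h4] := gam_anchor_bounds hb ha.
have bm := anchor_lt hb ha; case: ha => a1 a2; split=> //.
- by rewrite (ltW h2) h3.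
- split; first exact: ltW.
  split=> [|e]; last by move: bm; rewrite e ltxx.
  by move/below_xbarE: hb => /[swap] ->; rewrite ltxx.
move=> z zm bz; apply: le_lt_trans a2; apply: Phi_antitone; first by lia.
by rewrite natr_intr -[1 : R]/(1%:~R) -intrD ler_int; lia.
Qed.

Lemma top_barrier (m : nat) : (0 < m)%N -> tailM (m%:Z + 1) = 0 -> barrier m m%:Z.
Proof.
move=> m0 t1; have cz : call m%:Z = 0 by rewrite call_rec call_eq0 ?t1 ?addr0.
rewrite /barrier gam_top//; split.
- by rewrite natr_intr subrr mul0r cz.
- by rewrite t1 tailM_ge0 lexx.
- by [].
- by rewrite Phi_diag cz oppr0.
- by move=> z; lia.
Qed.

Lemma barrier_exists m : (0 < m)%N -> exists b, barrier m b.
Proof.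
move=> m0; have [hb|hb] := pselect (below_xbar mu m).
  by have [b hb'] := anchor_exists hb m0; exists b; exact: anchor_barrier.
exists m%:Z; apply: top_barrier => //.
apply/eqP; rewrite eq_le tailM_ge0 andbT leNgt; apply/negP => h.
by apply: hb; exact/below_xbarE.
Qed.

Lemma barrier_gt m b z : barrier m b -> b < z -> z <= m%:Z + 1 -> Phi m%:R z <= 0.
Proof.
move=> [_ _ [bm _] _ hlt] bz zm; case: (ltP z m%:Z) => [h|h]; first exact/ltW/hlt.
rewrite /Phi natr_intr; have : (m%:~R - z%:~R) * tailM z <= 0.
  by rewrite mulr_le0_ge0 ?tailM_ge0// subr_le0 ler_int.
have := call_ge0 z; lra.
Qed.

Lemma barrier_le m b z : barrier m b -> z <= b -> 0 <= Phi m%:R z.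
Proof.
move=> [_ _ [bm _] hb _] zb; apply: le_trans hb _; apply: Phi_antitone => //.
by rewrite natr_intr -[1 : R]/(1%:~R) -intrD ler_int; lia.
Qed.

(** Vacuous when the level has no anchor, which covers level 0 with a support unbounded below. *)
Definition lower (n : nat) (z : int) : Prop := forall a, anchor n a -> a <= z.

Lemma lowerNE n z : below_xbar mu n -> (z <= n%:Z) -> lower n z <-> Phi n%:R (z + 1) < 0.
Proof.
move=> hb zn; split=> [hl|hz a ha]; last first.
  have an := anchor_lt hb ha; case: ha => a1 a2.
  rewrite leNgt; apply/negP => za; move: hz; rewrite ltNge => /negP; apply.
  apply: le_trans a1 _; apply: Phi_antitone; first by lia.
  by rewrite natr_intr -[1 : R]/(1%:~R) -intrD ler_int; lia.
have [[a ha]|nA] := pselect (exists a, anchor n a).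
  have az := hl _ ha; case: ha => _; apply: le_lt_trans.
  apply: Phi_antitone; first by lia.
  by rewrite natr_intr -[1 : R]/(1%:~R) -intrD ler_int; lia.
have n0 : n = 0%N.
  case: (posnP n) => // n0; exfalso; apply: nA; exact: anchor_exists.
move: zn hb; rewrite n0 => zn hb.
case: (ltP z 0) => z0.
  apply: Phi0_lt0; first by lia.
  apply: noanchor0 => hx; apply: nA; rewrite n0; exact: anchor0_exists.
have -> : z = 0 by lia.
rewrite /Phi mulrBl mul0r sub0r mul1r.
move/below_xbarE: hb => hb; have := call_ge0 (0 + 1); lra.
Qed.

(** b_mu takes the value [z] exactly for levels from psi(z) up to, but excluding, psi(z + 1). This
    interval is nonempty when [z] is an atom, and it meets [n, n + 1] when [z] lies between b_mu(n)
    and b_mu(n + 1). *)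
Lemma XsetE n b z : below_xbar mu n -> barrier n.+1 b ->
  Xset mu n z <-> [/\ 0 < mu z, lower n z, z <= b & n = 0%N \/ z <= n%:Z].
Proof.
move=> hb hB; have /below_xbarE hb' := hb.
have [_ _ [bn btop] _ blt] := hB.
have caseA : z <= n%:Z -> (exists y : R, n%:R <= y <= n%:R + 1 /\ bmu mu y = (z%:~R)%:E)
    <-> [/\ 0 < mu z, lower n z & z <= b].
  move=> zn.
  have M1 : 0 < tailM (z + 1) by apply: lt_le_trans hb' _; apply: tailM_antitone; lia.
  have Mz : 0 < tailM z by rewrite tailM_rec ltr_wpDl.
  split=> [[y [/andP[y1 y2]]]|[mz lz zb]].
    move=> /(bmuP _ M1)[p1 p2]; split.
    - rewrite lt_def mu_ge0 andbT; apply/eqP => m0.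
      by move: p1; rewrite Phi_rec m0 mulr0 add0r leNgt p2.
    - apply/(lowerNE hb zn); apply: le_lt_trans p2.
      by rewrite (Phi_shift n%:R y) lerDl mulr_ge0 ?tailM_ge0// subr_ge0.
    - rewrite leNgt; apply/negP => /blt => /(_ _)/wrap[]; first by lia.
      rewrite (Phi_shift y) ltNge addr_ge0 ?mulr_ge0 ?tailM_ge0// subr_ge0.
      by rewrite -natr1.
  (* [p] is psi(z), the least level at which b_mu is at least [z]; the witness is the larger of [n]
     and [p]. *)
  pose p := z%:~R + call z / tailM z.
  have php : Phi p z = 0 by rewrite /Phi /p; field; rewrite gt_eqF.
  have pn : p <= n%:R + 1.
    have := barrier_le hB zb; rewrite (Phi_shift p) php add0r.
    by rewrite pmulr_lge0// subr_ge0 natr1.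
  exists (Num.max n%:R p); split.
    by rewrite le_max lexx/= ge_max pn lerDl ler01.
  apply/(bmuP _ M1); split.
    rewrite (Phi_shift p) php add0r mulr_ge0 ?tailM_ge0// subr_ge0.
    by rewrite le_max lexx orbT.
  case: (leP p n%:R) => pn'; first exact/(lowerNE hb zn).
  have : 0 < (p - z%:~R) * mu z.
    by rewrite mulr_gt0// /p addrAC subrr add0r divr_gt0// call_gt0.
  by move: php; rewrite Phi_rec; lra.
(* Beyond [n] only z = 1 on level 0 is possible, and it belongs to the set exactly when 1 is the top
   of the support. *)
have [zn|nz] : z <= n%:Z \/ n%:Z < z by lia.
  rewrite /Xset/=; split=> [[/(caseA zn)[? ? ?] _]|[? ? ? ?]]; split=> //.
  + by right.
  + exact/(caseA zn).
split=> [[[y [/andP[y1 y2] e]] [n0|]]|[mz lz zb [n0|]]]; try by lia.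
  clear hB bn blt caseA y1; subst n.
  have z1 : z = 1.
    have : ((z%:~R)%:E <= y%:E)%E by rewrite -e bmu_leid.
    rewrite lee_fin => zy; have : z%:~R <= (1%:~R : R) by apply: le_trans zy _; rewrite add0r in y2.
    by rewrite ler_int; lia.
  have t2 : tailM 2 = 0.
    apply/eqP; rewrite eq_le tailM_ge0 andbT leNgt; apply/negP => t2.
    have := @bmuP y 1; rewrite -z1 e z1 => /(_ t2)[/(_ erefl)[p1 _] _].
    move: p1; rewrite /Phi leNgt => /negP; apply.
    have : 0 < call 1 by apply: call_gt0.
    have : (y - 1%:~R) * tailM 1 <= 0 by rewrite mulr_le0_ge0 ?tailM_ge0//; lra.
    lra.
  split.
  - by move: hb'; rewrite z1 tailM_rec t2 addr0.
  - by rewrite z1 => a /(anchor_lt hb); lia.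
  - by rewrite z1 (btop.1 t2).
  - by left.
clear caseA blt; subst n.
have z1 : z = 1 by lia.
split; last by left.
exists 1; split; first by rewrite add0r lexx ler01.
rewrite z1; apply: bmu_id => //.
by apply/btop; lia.
Qed.

(* [Hm n z] is the value of P(S_tau >= z, S*_tau < n). *)
Definition Hm (n : nat) (z : int) : R := Num.max (tailM z - gam n) 0.
(** The intended value of P(S_tau >= z, S*_tau = n). *)
Definition Tm (n : nat) (z : int) : R := Hm n.+1 z - Hm n z.
(** [gam n] times the probability that the first zero coin of level [n] belongs to a barrier at or
    above [z]. The clamp gives 0 above b_mu(n + 1) and [gam n] at or below b_mu(n). *)
Definition Lam (n : nat) (z : int) : R := Num.min (Num.max (Phi n.+1%:R z) 0) (gam n).

Lemma level_cases n : below_xbar mu n ->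
  (exists a, anchor n a) \/ (n = 0%N /\ forall z, exists2 w, w < z & 0 < mu w).
Proof.
move=> hb; case: (posnP n) => n0; last by left; exact: anchor_exists.
subst n; have [hx|hx] := pselect (xlow_finite mu); first by left; exact: anchor0_exists.
by right; split=> //; exact: noanchor0.
Qed.

Lemma gam_gt0 n : below_xbar mu n -> 0 < gam n.
Proof.
move=> hb; case: (level_cases hb) => [[a ha]|[-> _]]; last by rewrite /gam.
by case: (gam_anchor_bounds hb ha).
Qed.

Lemma Hm_barrier n (b z : int) : barrier n b -> Hm n z = if z <= b then tailM z - gam n else 0.
Proof.
move=> [_ /andP[h1 h2] _ _ _]; rewrite /Hm; case: leP => zb.
  by rewrite max_l// subr_ge0 (le_trans h2)// tailM_antitone.
by rewrite max_r// subr_le0 (le_trans _ h1)// tailM_antitone; lia.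
Qed.

Lemma Hm0 z : Hm 0 z = 0.
Proof. by rewrite /Hm /gam max_r// subr_le0 tailM_le1. Qed.

Lemma anchor_le_barrier n a b : below_xbar mu n -> anchor n a -> barrier n.+1 b -> a <= b.
Proof.
move=> hb ha hB; have an := anchor_lt hb ha; rewrite leNgt; apply/negP => ba.
have : Phi n.+1%:R a <= 0 by apply: barrier_gt hB ba _; lia.
rewrite -natr1 (Phi_shift n%:R); case: ha => h1 _.
have M1 : 0 < tailM a.
  by apply: lt_le_trans (tailM_antitone _); [exact/below_xbarE/hb|lia].
have -> : n%:R + 1 - n%:R = 1 :> R by ring.
by rewrite mul1r; lra.
Qed.

Lemma Lam_eq0 n (z : int) : below_xbar mu n -> n%:Z < z -> Lam n z = 0.
Proof.
move=> hb nz; have g0 := ltW (gam_gt0 hb); rewrite /Lam max_r ?min_l//.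
rewrite /Phi natr_intr; have : (n.+1%:~R - z%:~R) * tailM z <= 0.
  by rewrite mulr_le0_ge0 ?tailM_ge0// subr_le0 ler_int; lia.
have := call_ge0 z; lra.
Qed.

Lemma Lam_gt_barrier n (b z : int) : below_xbar mu n -> barrier n.+1 b -> b < z -> Lam n z = 0.
Proof.
move=> hb hB bz; have [/(Lam_eq0 hb)//|zn] := ltP n%:Z z.
have g0 := ltW (gam_gt0 hb).
by rewrite /Lam max_r ?min_l//; apply: barrier_gt hB bz _; lia.
Qed.

Lemma Lam_le_anchor n (a z : int) : below_xbar mu n -> anchor n a -> z <= a -> Lam n z = gam n.
Proof.
move=> hb ha za; have an := anchor_lt hb ha.
have [h1 h2 h3 h4] := gam_anchor_bounds hb ha.
have g : gam n <= Phi n.+1%:R z.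
  apply: (@le_trans _ _ (Phi n.+1%:R a)); last first.
    apply: Phi_antitone => //.
    by rewrite natr_intr -[1 : R]/(1%:~R) -intrD ler_int; lia.
  rewrite /Phi -h4 -natr1.
  have : (n%:R + 1 - a%:~R) * gam n <= (n%:R + 1 - a%:~R) * tailM a.
    rewrite ler_wpM2l// natr_intr -[1 : R]/(1%:~R) -intrD -intrB ler0z; lia.
  lra.
by rewrite /Lam min_r// le_max g.
Qed.

Lemma Phi_lt_gam n (z : int) : below_xbar mu n -> z <= n%:Z + 1 ->
  (forall a, anchor n a -> a < z) -> Phi n.+1%:R z < gam n.
Proof.
move=> hb zn hl; case: (level_cases hb) => [[a ha]|[n0 hw]]; last first.
  by subst n; apply: Phi1_lt1 => //; lia.
have az := hl _ ha; have an := anchor_lt hb ha.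
have [h1 h2 h3 h4] := gam_anchor_bounds hb ha.
apply: (@le_lt_trans _ _ (Phi n.+1%:R (a + 1))).
  apply: Phi_antitone; first by lia.
  by rewrite natr_intr -[1 : R]/(1%:~R) -intrD ler_int; lia.
rewrite /Phi; have := h4; rewrite call_rec intrD -natr1 => h5.
have : (n%:R + 1 - a%:~R) * tailM (a + 1) < (n%:R + 1 - a%:~R) * gam n.
  rewrite ltr_pM2l// natr_intr -[1 : R]/(1%:~R) -intrD -intrB ltr0z; lia.
lra.
Qed.

Lemma Lam_mid n (b z : int) : below_xbar mu n -> barrier n.+1 b -> z <= b ->
  (forall a, anchor n a -> a < z) -> Lam n z = Phi n.+1%:R z.
Proof.
move=> hb hB zb hl; have [_ _ [bn _] _ _] := hB.
have zn : z <= n%:Z + 1 by lia.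
have h := Phi_lt_gam hb zn hl.
by rewrite /Lam max_l ?min_l ?(ltW h)//; exact: barrier_le hB zb.
Qed.

(** Inside the range of barriers [Lam n] is [Phi] at level n + 1, and [Phi_rec] produces the atom at
    [z] with weight [n + 1 - z]. At the two ends the equations (m - b) gam m = call b, for m = n and
    m = n + 1, supply the partial masses. *)
Lemma Tm_Lam n (z : int) : below_xbar mu n -> z <= n%:Z + 1 ->
  (n%:R + 1 - z%:~R) * (Tm n z - Tm n (z + 1)) = Lam n z - Lam n (z + 1).
Proof.
move=> hb zn; have [b hB] := barrier_exists (ltn0Sn n).
have [e1 /andP[e2 e3] [bn btop] _ _] := hB; rewrite -natr1 in e1.
rewrite /Tm !(Hm_barrier _ hB).
case: (level_cases hb) => [[a ha]|[n0 hw]]; last first.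
  subst n; rewrite !Hm0.
  have hl (z' : int) : forall a, anchor 0 a -> a < z'.
    move=> a ha; exfalso; have [w wa mw] := hw a; have a0 := anchor_lt hb ha.
    case: ha => + _; rewrite leNgt => /negP; apply.
    by apply: Phi0_lt0; [lia|exists w].
  case: (ltgtP z b) => zb.
  - have -> : (z + 1 <= b) = true by lia.
    have zb1 : z + 1 <= b by lia.
    rewrite (Lam_mid hb hB (ltW zb) (hl z)) (Lam_mid hb hB zb1 (hl _)).
    by rewrite Phi_rec tailM_rec; ring.
  - have -> : (z + 1 <= b) = false by lia.
    by rewrite !(Lam_gt_barrier hb hB)//; [ring|lia].
  - have -> : (z + 1 <= b) = false by lia.
    have zb1 : b < z + 1 by lia.
    have zb2 : z <= b by lia.
    rewrite (Lam_mid hb hB zb2 (hl z)) (Lam_gt_barrier hb hB zb1).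
    by rewrite /Phi zb -e1 -natr1; ring.
have ab := anchor_le_barrier hb ha hB.
have [h1 h2 h3 h4] := gam_anchor_bounds hb ha.
have auniq a' : anchor n a' -> a' = a.
  move=> ha'; have l1 : lower n a by apply/lowerNE => //; [have := anchor_lt hb ha; lia|case: ha].
  have l2 : lower n a' by apply/lowerNE => //; [have := anchor_lt hb ha'; lia|case: ha'].
  by have := l1 _ ha'; have := l2 _ ha; lia.
have hl (z' : int) : a < z' -> forall a, anchor n a -> a < z' by move=> ? ? /auniq ->.
rewrite !(Hm_barrier _ (anchor_barrier hb ha)).
case: (ltgtP z a) => za.
- have -> : (z <= b) = true by lia.
  have -> : (z + 1 <= b) = true by lia.
  have -> : (z + 1 <= a) = true by lia.
  by rewrite !(Lam_le_anchor hb ha); [ring|lia|lia].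
- have -> : (z + 1 <= a) = false by lia.
  case: (ltgtP z b) => zb.
  + have -> : (z + 1 <= b) = true by lia.
    have zb1 : z + 1 <= b by lia.
    have za1 : a < z + 1 by lia.
    rewrite (Lam_mid hb hB (ltW zb) (hl _ za)) (Lam_mid hb hB zb1 (hl _ za1)).
    by rewrite Phi_rec tailM_rec -natr1; ring.
  + have -> : (z + 1 <= b) = false by lia.
    by rewrite !(Lam_gt_barrier hb hB)//; [ring|lia].
  + have -> : (z + 1 <= b) = false by lia.
    have zb1 : b < z + 1 by lia.
    have zb2 : z <= b by lia.
    rewrite (Lam_mid hb hB zb2 (hl _ za)) (Lam_gt_barrier hb hB zb1).
    by rewrite /Phi zb -e1 -natr1; ring.
- have -> : (z + 1 <= a) = false by lia.
  rewrite (Lam_le_anchor hb ha) ?za//.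
  have -> : (a <= b) = true by [].
  case: (ltgtP a b) => ab'; last 2 first.
  + by lia.
  + have -> : (a + 1 <= b) = false by lia.
    rewrite (Lam_gt_barrier hb hB); last by lia.
    move: e1; rewrite -ab' -h4; lra.
  have -> : (a + 1 <= b) = true by lia.
  rewrite (Lam_mid hb hB); [|lia|apply: hl; lia].
  rewrite /Phi; move: h4; rewrite call_rec intrD -natr1 tailM_rec; lra.
Qed.

Lemma Tm_eq0 n (z : int) : below_xbar mu n -> n%:Z < z -> Tm n z = 0.
Proof.
move=> hb nz; have [b hB] := barrier_exists (ltn0Sn n).
have [e1 /andP[e2 e3] [bn btop] _ _] := hB.
rewrite /Tm; have -> : Hm n z = 0.
  case: (level_cases hb) => [[a ha]|[-> hw]]; last exact: Hm0.
  rewrite (Hm_barrier _ (anchor_barrier hb ha)).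
  by have := anchor_lt hb ha; case: ifP => //; lia.
rewrite subr0 (Hm_barrier _ hB); case: ifP => // zb.
have bz : b = n.+1%:Z by lia.
have -> : z = n.+1%:Z by lia.
by rewrite gam_top ?subrr//; apply/btop.
Qed.

(** Off the set either the clamp is active at both points or there is no atom for [Phi] to pick up,
    so [Lam] is flat; [Tm] follows since the factor [n + 1 - z] is nonzero for z <= n. All
    telescoping sums rely on this. *)
Lemma Xset_const n (z : int) : below_xbar mu n -> ~ Xset mu n z ->
  Lam n z = Lam n (z + 1) /\ Tm n z = Tm n (z + 1).
Proof.
move=> hb nX; have [zn|nz] : z <= n%:Z \/ n%:Z < z by lia.
  have [b hB] := barrier_exists (ltn0Sn n).
  suff hL : Lam n z = Lam n (z + 1).
    split=> //; have := @Tm_Lam n z hb; rewrite hL subrr => /(_ _)/wrap[]; first by lia.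
    move=> /eqP; rewrite mulf_eq0 => /orP[/eqP h|/eqP]; last by lra.
    have : (z%:~R <= n%:Z%:~R :> R) by rewrite ler_int.
    by rewrite -natr_intr; lra.
  have [_ _ [bn btop] _ _] := hB.
  have [zb|bz] : z <= b \/ b < z by lia.
    have [lz|lz] := pselect (lower n z); last first.
      have [a [ha az]] : exists a, anchor n a /\ z < a.
        apply: contrapT => hn; apply: lz => a ha; rewrite leNgt; apply/negP => az.
        by apply: hn; exists a.
      by rewrite !(Lam_le_anchor hb ha)//; lia.
    have m0 : mu z = 0.
      apply/eqP; rewrite eq_le mu_ge0 andbT leNgt; apply/negP => mz; apply: nX.
      by apply/(XsetE _ hb hB); split=> //; right.
    have hl : forall a, anchor n a -> a < z.
      move=> a ha; have := lz _ ha; rewrite le_eqVlt => /predU1P[az|//].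
      exfalso; case: ha => + ; rewrite az Phi_rec m0 mulr0 add0r; lra.
    rewrite (Lam_mid hb hB)// Phi_rec m0 mulr0 add0r.
    have [zb'|bz] : z + 1 <= b \/ b < z + 1 by lia.
      by rewrite (Lam_mid hb hB)// => a /hl; lia.
    have ez : z = b by lia.
    rewrite (Lam_gt_barrier hb hB)//.
    have := barrier_le hB zb; rewrite Phi_rec m0 mulr0 add0r => p0.
    have : Phi n.+1%:R (z + 1) <= 0 by apply: barrier_gt hB bz _; lia.
    lra.
  by rewrite !(Lam_gt_barrier hb hB)//; lia.
by rewrite !(Lam_eq0 hb) ?(Tm_eq0 hb)//; lia.
Qed.

(** If b_mu increases strictly from [n] to [n + 1], a tail value separates the two bounds; if it
    stays put, both levels divide the same call price, the higher one by a larger distance. *)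
Lemma gamS n : below_xbar mu n -> gam n.+1 <= gam n.
Proof.
move=> hb; have [b hB] := barrier_exists (ltn0Sn n).
have [e1 /andP[e2 e3] [bn btop] _ _] := hB.
case: (level_cases hb) => [[a ha]|[-> hw]]; last first.
  by rewrite {2}/gam /=; have [c [_ /andP[_ h] _ _ _]] := barrier_exists (ltn0Sn 0);
    exact: le_trans h (tailM_le1 _).
have [h1 h2 h3 h4] := gam_anchor_bounds hb ha.
have := anchor_le_barrier hb ha hB; rewrite le_eqVlt => /predU1P[ab|ab]; last first.
  by apply: le_trans e3 _; apply: le_trans (ltW h2); apply: tailM_antitone; lia.
have an := anchor_lt hb ha.
have an' : (0 : R) < n%:R - a%:~R by rewrite natr_intr subr_gt0 ltr_int.
have e4 : (n%:R + 1 - a%:~R) * gam n.+1 = (n%:R - a%:~R) * gam n.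
  by rewrite natr1 h4 ab.
have p : (0 : R) < n%:R + 1 - a%:~R by lra.
by rewrite -(ler_pM2l p) e4 ler_pM2r//; lra.
Qed.

Lemma Tm_bounds n z : below_xbar mu n -> 0 <= Tm n z <= gam n - gam n.+1.
Proof.
move=> hb; have := gamS hb; rewrite /Tm /Hm.
have [h1|h1] := leP (tailM z - gam n.+1) 0; have [h2|h2] := leP (tailM z - gam n) 0;
  lra.
Qed.

(** Once [gam N] has fallen to [tailM (z + 1)] the truncation in [Hm] acts at neither point, and the
    difference is the whole atom. *)
Lemma full_mass (z : int) : 0 < tailM (z + 1) -> below_xbar mu 0 ->
  exists N, (forall m, (m < N)%N -> below_xbar mu m) /\ Hm N z - Hm N (z + 1) = mu z.
Proof.
move=> tz b0.
suff [N [hN hg]] : exists N, (forall m, (m < N)%N -> below_xbar mu m) /\ gam N <= tailM (z + 1).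
  exists N; split=> //; rewrite /Hm !max_l ?subr_ge0//; first by rewrite (tailM_rec z); lra.
  by apply: le_trans hg _; apply: tailM_antitone; lia.
have [ab|] := pselect (forall m, below_xbar mu m).
  pose p := (z + 1)%:~R + call (z + 1) / tailM (z + 1).
  have php : Phi p (z + 1) = 0 by rewrite /Phi /p; field; rewrite gt_eqF.
  (* Large enough that psi(z + 1) <= N and z + 1 < N, which forces b_mu(N) >= z + 1. *)
  pose N := (`|Num.ceil p| + `|z| + 2)%N.
  have pN : p <= N%:R.
    apply: le_trans (ceil_ge p) _; rewrite natr_intr ler_int /N; move: (Num.ceil p) => c; lia.
  exists N; split=> //.
  have N0 : (0 < N)%N by rewrite /N addn2.
  have [b hB] := barrier_exists N0; have [_ /andP[_ e3] _ _ blt] := hB.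
  apply: le_trans e3 _; apply: tailM_antitone; rewrite leNgt; apply/negP => bz.
  have : Phi N%:R (z + 1) < 0 by apply: blt => //; rewrite /N; move: (Num.ceil p) => c; lia.
  rewrite (Phi_shift p) php add0r ltNge => /negP; apply.
  by rewrite mulr_ge0 ?tailM_ge0// subr_ge0.
(* For a bounded support N is its top, where [gam N] is the mass of the top atom. *)
move=> /existsNP nb.
have nb' : exists m, `[< ~ below_xbar mu m >] by case: nb => m hm; exists m; apply/asboolP.
case: (ex_minnP nb') => N /asboolP hN Nmin; exists N.
have ltN m : (m < N)%N -> below_xbar mu m.
  by move=> mN; apply: contrapT => hm; have := Nmin m (asboolT hm); lia.
split=> //.
have N0 : (0 < N)%N by rewrite lt0n; apply/eqP => e; apply: hN; rewrite e.
have t0 : tailM (N%:Z + 1) = 0.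
  apply/eqP; rewrite eq_le tailM_ge0 andbT leNgt; apply/negP => h.
  by apply: hN; apply/below_xbarE.
rewrite gam_top//; apply: tailM_antitone; rewrite leNgt; apply/negP => h.
have : tailM (z + 1) <= tailM (N%:Z + 1) by apply: tailM_antitone; lia.
by rewrite t0 leNgt tz.
Qed.

Lemma Xset_le n z : below_xbar mu n -> Xset mu n z -> z <= n%:Z + 1.
Proof.
move=> hb; have [b hB] := barrier_exists (ltn0Sn n).
by move=> /(XsetE _ hb hB)[_ _ zb _]; have [_ _ [bn _] _ _] := hB; lia.
Qed.

(** * Enumeration of the barriers of a level *)

(** Positions are counted downwards from [n + 1], an upper bound of [Xset mu n]; the value is the
    number of barriers strictly above [n + 1 - j]. *)
Definition rank (n j : nat) : nat :=
  count (fun i => `[< Xset mu n (n%:Z + 1 - i%:Z) >]) (iota 0 j).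

Lemma rankS n j : rank n j.+1 = (rank n j + `[< Xset mu n (n%:Z + 1 - j%:Z)%R >])%N.
Proof. by rewrite /rank -addn1 iotaD count_cat /= add0n addn0. Qed.

Lemma leq_rank n i j : (i <= j)%N -> (rank n i <= rank n j)%N.
Proof.
move=> ij; rewrite -(subnKC ij); elim: (j - i)%N => [|l ih]; first by rewrite addn0.
by rewrite addnS rankS; lia.
Qed.

Lemma rank_surj n j m : (m < rank n j)%N ->
  exists i, [/\ (i < j)%N, Xset mu n (n%:Z + 1 - i%:Z) & rank n i = m].
Proof.
elim: j => [|j ih]; first by rewrite /rank.
rewrite rankS; have [mj|mj] := ltnP m (rank n j).
  by move=> _; have [i [? ? ?]] := ih mj; exists i; split=> //; lia.
by case: asboolP => hX /=; [exists j; split=> //; lia|lia].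
Qed.

Lemma kthE n k z : below_xbar mu n ->
  kth mu n k z <-> exists j, [/\ z = n%:Z + 1 - j%:Z, Xset mu n z & rank n j = k.-1].
Proof.
move=> hb.
have key j : Xset mu n (n%:Z + 1 - j%:Z) -> forall s : seq int, uniq s ->
    (forall w, w \in s <-> (Xset mu n w /\ n%:Z + 1 - j%:Z < w)) -> size s = rank n j.
  move=> hX s us hs.
  pose s0 := [seq n%:Z + 1 - i%:Z | i <- iota 0 j & `[< Xset mu n (n%:Z + 1 - i%:Z) >]].
  have -> : rank n j = size s0 by rewrite size_map size_filter.
  apply: perm_size; apply: uniq_perm => //.
    rewrite map_inj_in_uniq ?filter_uniq ?iota_uniq//.
    by move=> x y _ _; lia.
  move=> w; apply/idP/idP => [/hs[wX jw]|/mapP[i]].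
    have wn := Xset_le hb wX.
    apply/mapP; exists `|(n%:Z + 1 - w)%R|%N; last by lia.
    rewrite mem_filter mem_iota add0n; apply/andP; split; last by lia.
    by apply/asboolP; have -> : n%:Z + 1 - `|(n%:Z + 1 - w)%R|%N%:Z = w by lia.
  rewrite mem_filter mem_iota => /andP[/asboolP hi ij] ->.
  by apply/hs; split=> //; lia.
split=> [[zX [s [us hs sz]]]|[j [-> zX rj]]].
  have zn := Xset_le hb zX; exists `|(n%:Z + 1 - z)%R|%N.
  have ez : n%:Z + 1 - `|(n%:Z + 1 - z)%R|%N%:Z = z by lia.
  by split=> //; rewrite -sz; apply/esym/key; rewrite ?ez.
split=> //.
exists [seq n%:Z + 1 - i%:Z | i <- iota 0 j & `[< Xset mu n (n%:Z + 1 - i%:Z) >]].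
split; last by rewrite size_map size_filter.
  rewrite map_inj_in_uniq ?filter_uniq ?iota_uniq//.
  by move=> x y _ _; lia.
move=> w; split=> [/mapP[i]|[wX jw]].
  rewrite mem_filter mem_iota => /andP[/asboolP hi ij] ->.
  by split=> //; lia.
have wn := Xset_le hb wX.
apply/mapP; exists `|(n%:Z + 1 - w)%R|%N; last by lia.
rewrite mem_filter mem_iota add0n; apply/andP; split; last by lia.
by apply/asboolP; have -> : n%:Z + 1 - `|(n%:Z + 1 - w)%R|%N%:Z = w by lia.
Qed.

Lemma rank_inj n i j : Xset mu n (n%:Z + 1 - i%:Z) -> Xset mu n (n%:Z + 1 - j%:Z) ->
  rank n i = rank n j -> i = j.
Proof.
have lt i' j' : Xset mu n (n%:Z + 1 - i'%:Z) -> (i' < j')%N -> (rank n i' < rank n j')%N.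
  move=> hi ij; have := leq_rank n ij; rewrite rankS.
  by case: asboolP => //; lia.
move=> hi hj e; case: (ltngtP i j) => // ij.
- by have := lt _ _ hi ij; lia.
- by have := lt _ _ hj ij; lia.
Qed.

Lemma xnk_kth n k : valid mu n k -> kth mu n k (xnk mu n k).
Proof. by move=> [_ _ hz]; rewrite /xnk; case: xgetP => // h; case: hz => z /h. Qed.

Lemma xnk_spec n k : valid mu n k -> exists j,
  [/\ xnk mu n k = n%:Z + 1 - j%:Z, Xset mu n (n%:Z + 1 - j%:Z) & rank n j = k.-1].
Proof.
move=> hv; have hb : below_xbar mu n by case: hv.
by have /(kthE _ _ hb)[j [e + r]] := xnk_kth hv; rewrite e => ?; exists j.
Qed.

Lemma xnk_Xset n k : valid mu n k -> Xset mu n (xnk mu n k).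
Proof. by move=> /xnk_kth[]. Qed.

Lemma Xset_xnk n z : below_xbar mu n -> Xset mu n z ->
  exists k, valid mu n k /\ xnk mu n k = z.
Proof.
move=> hb zX; have zn := Xset_le hb zX; set j := `|(n%:Z + 1 - z)%R|%N.
have ez : z = n%:Z + 1 - j%:Z by rewrite /j; lia.
have hk : kth mu n (rank n j).+1 z by apply/(kthE _ _ hb); exists j.
have hv : valid mu n (rank n j).+1 by split=> //; exists z.
exists (rank n j).+1; split=> //.
have [i [-> hi ri]] := xnk_spec hv.
by rewrite ez; congr (_ - _%:Z); apply: rank_inj ri => //; rewrite -ez.
Qed.

Lemma xnk_antitone n k k' : valid mu n k -> valid mu n k' -> (k < k')%N ->
  xnk mu n k' < xnk mu n k.
Proof.
move=> hv hv' kk'; have [i [-> hi ri]] := xnk_spec hv.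
have [j [-> hj rj]] := xnk_spec hv'.
have k0 : (0 < k)%N by case: hv.
suff : (i < j)%N by lia.
by rewrite ltnNge; apply/negP => /(leq_rank n); rewrite ri rj; lia.
Qed.

Lemma valid_le n k k' : (0 < k)%N -> (k <= k')%N -> valid mu n k' -> valid mu n k.
Proof.
move=> k0; rewrite leq_eqVlt => /predU1P[->//|kk'] hv.
have [j [_ hj rj]] := xnk_spec hv; have hb : below_xbar mu n by case: hv.
have [|i [_ hi ri]] := @rank_surj n j k.-1; first by rewrite rj; lia.
split=> //; exists (n%:Z + 1 - i%:Z); apply/(kthE _ _ hb); by exists i.
Qed.

Lemma const_between (h : int -> R) (z w : int) : z <= w ->
  (forall v, z <= v < w -> h v = h (v + 1)) -> h z = h w.
Proof.
move=> zw; have -> : w = z + `|w - z|%N%:Z by lia.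
elim: `|w - z|%N => [|j ih] hc; first by rewrite addr0.
rewrite ih => [|v zv]; last by apply: hc; lia.
by rewrite hc; [congr h; lia|lia].
Qed.

(** No barrier lies strictly between two consecutive ones. Applied to [Lam n] and [Tm n], this
    matches the lower end of one increment with the upper end of the next. *)
Lemma const_xnkS n k (h : int -> R) : (0 < k)%N -> valid mu n k.+1 ->
  (forall z, ~ Xset mu n z -> h z = h (z + 1)) ->
  h (xnk mu n k.+1 + 1) = h (xnk mu n k).
Proof.
move=> k0 hv hc; have hv' : valid mu n k by apply: valid_le hv.
have hb : below_xbar mu n by case: hv.
have lt := xnk_antitone hv' hv (ltnSn k).
apply: const_between; first by lia.
move=> v vb; apply: hc => /(Xset_xnk hb)[l [hl el]].
have [lk|lk] := leqP l k.
  have : xnk mu n k <= xnk mu n l.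
    by move: lk; rewrite leq_eqVlt => /predU1P[->//|/(xnk_antitone hl hv')/ltW].
  by lia.
have : xnk mu n l <= xnk mu n k.+1.
  by move: lk; rewrite leq_eqVlt => /predU1P[->//|/(xnk_antitone hv hl)/ltW].
by lia.
Qed.

Lemma const_xnk1 n (h : int -> R) (w : int) : valid mu n 1 ->
  (forall z, ~ Xset mu n z -> h z = h (z + 1)) -> n%:Z + 1 < w ->
  h (xnk mu n 1 + 1) = h w.
Proof.
move=> hv hc nw; have hb : below_xbar mu n by case: hv.
have := Xset_le hb (xnk_Xset hv) => xn.
apply: const_between; first by lia.
move=> v vb; apply: hc => /(Xset_xnk hb)[l [hl el]].
have : xnk mu n l <= xnk mu n 1.
  have l0 : (0 < l)%N by case: hl.
  by move: l0; rewrite leq_eqVlt => /predU1P[<-//|/(xnk_antitone hv hl)/ltW].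
by lia.
Qed.

Lemma anchor_mu n a : below_xbar mu n -> anchor n a -> 0 < mu a.
Proof.
move=> hb ha; have an := anchor_lt hb ha; case: ha => h1 h2.
rewrite lt_def mu_ge0 andbT; apply/eqP => m0.
by move: h1; rewrite Phi_rec m0 mulr0 add0r leNgt h2.
Qed.

Lemma anchor_lower n a : below_xbar mu n -> anchor n a -> lower n a.
Proof.
move=> hb ha; apply/lowerNE => //; last by case: ha.
exact/ltW/anchor_lt.
Qed.

Lemma anchor_Xset n a : below_xbar mu n -> anchor n a -> Xset mu n a.
Proof.
move=> hb ha; have [b hB] := barrier_exists (ltn0Sn n).
apply/(XsetE _ hb hB); split; first exact: anchor_mu ha.
- exact: anchor_lower.
- exact: anchor_le_barrier ha hB.
- by right; exact/ltW/anchor_lt.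
Qed.

Lemma anchor_min n a z : below_xbar mu n -> anchor n a -> Xset mu n z -> a <= z.
Proof.
move=> hb ha; have [b hB] := barrier_exists (ltn0Sn n).
by move=> /(XsetE _ hb hB)[_ hl _ _]; exact: hl.
Qed.

(** The anchor is the least element of the set, so the enumeration stops there; this identifies
    [xlast] with b_mu(n). *)
Lemma mn_anchor n a : below_xbar mu n -> anchor n a ->
  valid mu n (mn mu n).+1 /\ xnk mu n (mn mu n).+1 = a.
Proof.
move=> hb ha; have aX := anchor_Xset hb ha.
have [k [hv ek]] := Xset_xnk hb aX.
have k0 : (0 < k)%N by case: hv.
have maxk k' : valid mu n k' -> (k' <= k)%N.
  move=> hv'; rewrite leqNgt; apply/negP => /(xnk_antitone hv hv').
  by rewrite ek ltNge (anchor_min hb ha)//; exact: xnk_Xset.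
suff -> : mn mu n = k.-1 by rewrite prednK.
rewrite /mn; case: xgetP => [m _ [[z hz] nz]|/(_ k.-1)].
  have h1 : (m.+1 <= k)%N by apply: maxk; split=> //; exists z.
  have h2 : (k <= m.+1)%N.
    rewrite leqNgt; apply/negP => mk.
    have : valid mu n m.+2 by apply: valid_le hv.
    by case=> _ _.
  by lia.
case; split; rewrite prednK//; first by case: hv.
move=> [z hz]; have : (k.+1 <= k)%N by apply: maxk; split=> //; exists z.
by lia.
Qed.

Lemma valid_mn n a k : below_xbar mu n -> anchor n a -> valid mu n k -> (k <= (mn mu n).+1)%N.
Proof.
move=> hb ha hv; have [hv1 e1] := mn_anchor hb ha.
rewrite leqNgt; apply/negP => /(xnk_antitone hv1 hv).
by rewrite e1 ltNge (anchor_min hb ha)//; exact: xnk_Xset.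
Qed.

(** * The weights g, f and the stopping probabilities rho *)

Lemma Gamma_gam n a : below_xbar mu n -> anchor n a -> Gamma mu n = gam n.
Proof.
move=> hb ha; have [hv1 e1] := mn_anchor hb ha; have an := anchor_lt hb ha.
have M1 : 0 < tailM a.
  by apply: lt_le_trans (tailM_antitone _); [exact/below_xbarE/hb|lia].
have an' : (0 : R) < n%:R - a%:~R by rewrite natr_intr subr_gt0 ltr_int.
rewrite /Gamma /xlast e1 mubar_int psi_int// (gam_anchor hb ha).
by field; rewrite !gt_eqF.
Qed.

Lemma gnk_Lam n a k : below_xbar mu n -> anchor n a -> (0 < k)%N -> valid mu n k.+1 ->
  gnk mu n k.+1 = (Lam n (xnk mu n k.+1) - Lam n (xnk mu n k)) / gam n.
Proof.
move=> hb ha k0 hv; have [hv1 e1] := mn_anchor hb ha; have an := anchor_lt hb ha.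
have hv' : valid mu n k by apply: valid_le hv.
have lt := xnk_antitone hv' hv (ltnSn k).
have [b hB] := barrier_exists (ltn0Sn n).
have xb : xnk mu n k.+1 + 1 <= b.
  have /(XsetE _ hb hB)[_ _ h _] := xnk_Xset hv'; lia.
rewrite -(const_xnkS k0 hv (fun z hz => (Xset_const hb hz).1)).
have [h1 h2 h3 h4] := gam_anchor_bounds hb ha.
have an' : (0 : R) < n%:R - a%:~R by rewrite natr_intr subr_gt0 ltr_int.
rewrite /gnk (Gamma_gam hb ha); case: eqP => [ek|nk].
  have ex : xnk mu n k.+1 = a by rewrite ek.
  rewrite /xlast e1 ex mubar_int.
  have M1 : 0 < tailM a by apply: lt_le_trans h3.
  rewrite psi_int// (Lam_le_anchor hb ha)// (Lam_mid hb hB); last 2 first.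
  - by rewrite -ex.
  - by move=> a' ha'; have := anchor_lower hb ha ha'; lia.
  (* The correction in the last weight is [Hm n a], the mass that lower levels have already put on
     [a]. *)
  have -> : tailM a * (n%:R - (a%:~R + call a / tailM a)) / (n%:R - a%:~R)
      = tailM a - gam n.
    rewrite -h4; field; rewrite !gt_eqF//.
  rewrite mulrAC; congr (_ / _); rewrite /Phi.
  by move: h4; rewrite call_rec intrD -natr1 (tailM_rec a); lra.
have ax : a < xnk mu n k.+1.
  have := anchor_min hb ha (xnk_Xset hv); rewrite le_eqVlt => /predU1P[e|//].
  exfalso; apply: nk; apply/eqP; rewrite eqn_leq (valid_mn hb ha hv)/= leqNgt.
  by apply/negP => /(xnk_antitone hv hv1); rewrite e1 -e ltxx.
have al (a' : int) : anchor n a' -> a' < xnk mu n k.+1.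
  by move=> ha'; have := anchor_lower hb ha ha'; lia.
rewrite (Lam_mid hb hB)//; last by lia.
rewrite (Lam_mid hb hB)//; last by move=> a' /al; lia.
by rewrite Phi_rec -natr1; field; rewrite gt_eqF.
Qed.

(** The common value of [fnk] and [f0inf]: the probability that the first [k] coins of level [n] all
    equal 1. *)
Definition fw (n k : nat) : R := if k == 0%N then 1 else 1 - Lam n (xnk mu n k) / gam n.

Lemma fnk_fw n a k : below_xbar mu n -> anchor n a -> (k <= (mn mu n).+1)%N ->
  fnk mu n k = fw n k.
Proof.
move=> hb ha; have [hv1 e1] := mn_anchor hb ha.
case: (posnP k) => [->//|k0 kn].
have g0 := gam_gt0 hb.
rewrite /fnk /fw (gtn_eqF k0).
(* f is a tail sum, so the induction runs downwards from the last index, where it vanishes. *)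
have -> : k = ((mn mu n).+1 - ((mn mu n).+1 - k))%N by lia.
have : ((mn mu n).+1 - k <= mn mu n)%N by lia.
elim: ((mn mu n).+1 - k)%N => [_|j ih jn].
  rewrite subn0 big_geq// e1 (Lam_le_anchor hb ha)// divff ?subrr// gt_eqF//.
have {}ih := ih (ltnW jn).
set i := ((mn mu n).+1 - j.+1)%N; have ei : ((mn mu n).+1 - j = i.+1)%N by rewrite /i; lia.
have i0 : (0 < i)%N by rewrite /i; lia.
rewrite ei in ih.
have hvi : valid mu n i.+1 by apply: valid_le hv1 => //; rewrite -ei; lia.
rewrite big_ltn; last by rewrite /i; lia.
rewrite ih (gnk_Lam hb ha i0 hvi).
by field; rewrite gt_eqF.
Qed.

(** Before the last barrier f is nonzero, so the quotients that define rho are genuine. *)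
Lemma Lam_lt_gam n k : valid mu n k -> valid mu n k.+1 -> Lam n (xnk mu n k) < gam n.
Proof.
move=> hv hv'; have hb : below_xbar mu n by case: hv.
have g0 := gam_gt0 hb.
have lt := xnk_antitone hv hv' (ltnSn k).
have xn := Xset_le hb (xnk_Xset hv).
have h : Phi n.+1%:R (xnk mu n k) < gam n.
  apply: Phi_lt_gam => // a ha.
  by have := anchor_min hb ha (xnk_Xset hv'); lia.
rewrite /Lam min_l ?gt_max ?h ?g0// ge_max ltW//=; exact: ltW.
Qed.

Lemma xnk_le n k : valid mu n k -> xnk mu n k <= n%:Z + 2 - k%:Z.
Proof.
move=> hv; have [j [-> _ rj]] := xnk_spec hv.
have := count_size (fun i => `[< Xset mu n (n%:Z + 1 - i%:Z) >]) (iota 0 j).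
by rewrite -/(rank n j) rj size_iota; lia.
Qed.

Lemma noanchor : ~ xlow_finite mu -> below_xbar mu 0 -> forall a, ~ anchor 0 a.
Proof.
move=> nx hb a ha; have [w wa mw] := noanchor0 nx a; have a0 := anchor_lt hb ha.
case: ha => + _; rewrite leNgt => /negP; apply.
by apply: Phi0_lt0; [lia|exists w].
Qed.

(** Without an anchor every atom low enough is a barrier, and there are atoms below any given
    barrier. *)
Lemma valid0_all k : ~ xlow_finite mu -> below_xbar mu 0 -> (0 < k)%N -> valid mu 0 k.
Proof.
move=> nx hb; have [b hB] := barrier_exists (ltn0Sn 0).
have ex (z : int) : z <= b -> exists2 k, valid mu 0 k & xnk mu 0 k < z.
  move=> zb; have [w wz mw] := noanchor0 nx z.
  have wX : Xset mu 0 w.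
    apply/(XsetE _ hb hB); split=> //; [|lia|by left].
    by move=> a /(noanchor nx hb).
  by have [l [hl el]] := Xset_xnk hb wX; exists l => //; rewrite el.
elim: k => // k ih _; case: (posnP k) => [->|k0].
  have [l hl _] := ex b (lexx b).
  by apply: (valid_le _ _ hl) => //; case: hl.
have {}ih := ih k0.
have xb : xnk mu 0 k <= b by have /(XsetE _ hb hB)[] := xnk_Xset ih.
have [l hl lk] := ex _ xb.
apply: (valid_le _ _ hl) => //; rewrite ltnNge; apply/negP.
rewrite leq_eqVlt => /predU1P[e|/xnk_antitone]; first by move: lk; rewrite e ltxx.
by move=> /(_ _ hl ih); lia.
Qed.

(** The barriers tend to minus infinity, and there [Phi 1] tends to the expectation of 1 - X, which
    is 1. *)
Lemma Lam0_lim (e : R) : ~ xlow_finite mu -> below_xbar mu 0 -> 0 < e ->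
  exists K, forall k, (K < k)%N -> 1 - e <= Lam 0 (xnk mu 0 k).
Proof.
move=> nx hb e0; have [N hN] := Phi1_tail e0.
exists (N + 2)%N => k kN.
have hv : valid mu 0 k by apply: valid0_all => //; lia.
have := xnk_le hv => xk.
have := hN (xnk mu 0 k); rewrite /Lam /gam /= => /(_ _)/wrap[]; first by lia.
by move=> h; rewrite le_min le_max h/=; lra.
Qed.

Lemma g0inf_Lam k : ~ xlow_finite mu -> below_xbar mu 0 -> (0 < k)%N ->
  g0inf mu k.+1 = Lam 0 (xnk mu 0 k.+1) - Lam 0 (xnk mu 0 k).
Proof.
move=> nx hb k0; have [b hB] := barrier_exists (ltn0Sn 0).
have hv : valid mu 0 k by apply: valid0_all.
have hv' : valid mu 0 k.+1 by apply: valid0_all.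
have lt := xnk_antitone hv hv' (ltnSn k).
have xb : xnk mu 0 k.+1 + 1 <= b.
  have /(XsetE _ hb hB)[_ _ h _] := xnk_Xset hv; lia.
rewrite -(const_xnkS k0 hv' (fun z hz => (Xset_const hb hz).1)).
rewrite !(Lam_mid hb hB)//; last 3 first.
- by move=> a /(noanchor nx hb).
- by lia.
- by move=> a /(noanchor nx hb).
by rewrite /g0inf Phi_rec; ring.
Qed.

(** The tail series telescopes along [Lam 0], whose limit is 1. *)
Lemma f0inf_fw k : ~ xlow_finite mu -> below_xbar mu 0 -> f0inf mu k = fw 0 k.
Proof.
move=> nx hb; rewrite /f0inf /fw; case: (posnP k) => // k0.
rewrite /gam /= divr1.
have g0 i : (0 < i)%N -> 0 <= g0inf mu i.
  move=> i0; have hv : valid mu 0 i by apply: valid0_all.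
  have := Xset_le hb (xnk_Xset hv) => xi.
  by rewrite mulr_ge0// subr_ge0 -[1 : R]/(1%:~R) ler_int; lia.
have := @nneseries_esum R (fun i => (g0inf mu i)%:E) (fun i => (k < i)%N).
move=> <-; last by move=> i ki; rewrite lee_fin g0//; lia.
suff -> : (\sum_(i <oo | (k < i)%N) (g0inf mu i)%:E = (1 - Lam 0 (xnk mu 0 k))%:E)%E by [].
apply/cvg_lim => //.
have part j : (\sum_(0 <= i < j + k.+1 | (k < i)%N) (g0inf mu i)%:E
    = (Lam 0 (xnk mu 0 (k + j)) - Lam 0 (xnk mu 0 k))%:E)%E.
  rewrite sumEFin; congr EFin; elim: j => [|j ih].
    rewrite add0n addn0 subrr big_mkord big1// => i; have := ltn_ord i; lia.
  rewrite addSn big_mkcond big_nat_recr//= -big_mkcond/= ih.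
  have -> : (k < j + k.+1)%N by lia.
  have -> : (j + k.+1 = (k + j).+1)%N by lia.
  by rewrite g0inf_Lam ?addnS//; [ring|lia].
rewrite -(cvg_shiftn k.+1); under eq_fun do rewrite part.
apply: cvg_EFin; first by apply: nearW.
apply/cvgrPdist_le => e e0.
have [K hK] := Lam0_lim nx hb e0.
near=> j; rewrite /=.
have h1 : 1 - e <= Lam 0 (xnk mu 0 (k + j)).
  by apply: hK; rewrite (@leq_trans j)//; [near: j; exact: nbhs_infty_gt|lia].
have h2 : Lam 0 (xnk mu 0 (k + j)) <= 1.
  by rewrite /Lam ge_min /gam /= lexx orbT.
rewrite ler_norml; lra.
Unshelve. all: by end_near. Qed.

(* [rho n k = 1 - f_k / f_{k-1}], multiplied out so that [f_{k-1} = 0] is covered. *)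
Lemma rho_fw n k : valid mu n k -> rho mu n k * fw n k.-1 = fw n k.-1 - fw n k.
Proof.
move=> hv; have hb : below_xbar mu n by case: hv.
have k0 : (0 < k)%N by case: hv.
have nz : fw n k.-1 != 0.
  rewrite /fw; have [_|k1] := eqVneq k.-1 0%N; first exact: oner_neq0.
  have hv' : valid mu n k.-1 by apply: valid_le hv; lia.
  have := @Lam_lt_gam n k.-1 hv'; rewrite prednK// => /(_ hv) h.
  by rewrite subr_eq0 eq_sym lt_eqF// ltr_pdivrMr ?gam_gt0// mul1r.
rewrite /rho; case: ifP => [/andP[/eqP n0 /asboolP nx]|hc].
  by subst n; rewrite !f0inf_fw//; field.
have [a ha] : exists a, anchor n a.
  case: (level_cases hb) => // -[n0 hw]; exfalso; move/negP: hc; apply.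
  rewrite n0 eqxx/=; apply/asboolP => -[L hL].
  by have [w wL mw] := hw L; have := hL _ mw; lia.
have [hv1 e1] := mn_anchor hb ha; have kn := valid_mn hb ha hv.
case: leqP => kn'; first by rewrite !(fnk_fw hb ha)//; [field|lia].
(* At the last index rho is 1 by definition, in agreement with [Lam n a = gam n] at the anchor. *)
have -> : k = (mn mu n).+1 by lia.
rewrite [X in _ = _ - X]/fw /= e1 (Lam_le_anchor hb ha)// divff ?subrr ?mul1r ?subr0//.
by rewrite gt_eqF// gam_gt0.
Qed.

Lemma prod_rho n k : valid mu n k -> \prod_(1 <= j < k) (1 - rho mu n j) = fw n k.-1.
Proof.
case: k => [[]//|k].
elim: k => [|k ih] hv; first by rewrite big_geq.
have hv' : valid mu n k.+1 by apply: valid_le hv.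
rewrite big_nat_recr//= ih//.
by have := rho_fw hv' => /= h; rewrite mulrBr mulr1 [fw n k * _]mulrC h; ring.
Qed.

Lemma fw_diff n k : valid mu n k -> fw n k.-1 - fw n k =
  (Lam n (xnk mu n k) - Lam n (xnk mu n k + 1)) / gam n.
Proof.
move=> hv; have hb : below_xbar mu n by case: hv.
have g0 := gam_gt0 hb.
have hc z (hz : ~ Xset mu n z) := (Xset_const hb hz).1.
case: k hv => [[]//|[|k]] hv.
  rewrite (const_xnk1 (w := n%:Z + 2) hv hc); last by lia.
  rewrite (Lam_eq0 hb (z := n%:Z + 2)); last by lia.
  by rewrite /fw/=; ring.
rewrite (const_xnkS (ltn0Sn k) hv hc) /fw /=.
by field; rewrite gt_eqF.
Qed.

(** The factor in front of [gam mu n] is the probability that [k] is the first index of level [n]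
    with a zero coin. *)
Lemma beta_Lam n k : valid mu n k ->
  (\prod_(1 <= j < k) (1 - rho mu n j) * rho mu n k) * gam n =
  Lam n (xnk mu n k) - Lam n (xnk mu n k + 1).
Proof.
move=> hv; have hb : below_xbar mu n by case: hv.
rewrite prod_rho// mulrC [_ * rho _ _ _]mulrC rho_fw// fw_diff// mulrC divfK//.
by rewrite gt_eqF// gam_gt0.
Qed.

(** The sum telescopes to [Tm n] at the lowest of the barriers involved, because [Tm n] vanishes
    above [n]. *)
Lemma sum_Tm n K : valid mu n K ->
  \sum_(1 <= k < K.+1) (Tm n (xnk mu n k) - Tm n (xnk mu n k + 1)) <= gam n - gam n.+1.
Proof.
move=> hv; have hb : below_xbar mu n by case: hv.
suff -> : \sum_(1 <= k < K.+1) (Tm n (xnk mu n k) - Tm n (xnk mu n k + 1))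
    = Tm n (xnk mu n K) by case/andP: (Tm_bounds (xnk mu n K) hb).
have hc z (hz : ~ Xset mu n z) := (Xset_const hb hz).2.
case: K hv => [[]//|K]; elim: K => [|K ih] hv.
  rewrite big_nat1 (const_xnk1 (w := n%:Z + 2) hv hc); last by lia.
  by rewrite (Tm_eq0 hb (z := n%:Z + 2)) ?subr0//; lia.
rewrite big_nat_recr//= ih; last by apply: valid_le hv.
by rewrite (const_xnkS (ltn0Sn K) hv hc); ring.
Qed.

Lemma sum_beta n K : valid mu n K ->
  \sum_(1 <= k < K.+1) (\prod_(1 <= j < k) (1 - rho mu n j) * rho mu n k) = 1 - fw n K.
Proof.
case: K => [[]//|K]; elim: K => [|K ih] hv.
  by rewrite big_nat1 prod_rho// mulrC rho_fw.
rewrite big_nat_recr//= ih; last by apply: valid_le hv.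
by rewrite prod_rho// mulrC rho_fw//=; ring.
Qed.

(** Level 0 almost surely has a zero coin: at its anchor if there is one, in the limit otherwise. *)
Lemma sum_beta0_lim (e : R) : below_xbar mu 0 -> 0 < e ->
  exists2 K, valid mu 0 K & fw 0 K <= e.
Proof.
move=> hb e0; have [hx|hx] := pselect (xlow_finite mu).
  have [a ha] := anchor0_exists hx hb; have [hv e1] := mn_anchor hb ha.
  exists (mn mu 0).+1 => //; rewrite /fw /= e1 (Lam_le_anchor hb ha)// divff ?subrr ?ltW//.
  by rewrite gt_eqF// gam_gt0.
have [K hK] := Lam0_lim hx hb e0.
exists K.+1; first exact: valid0_all.
by have := hK K.+1 (ltnSn K); rewrite /fw /gam /= divr1; lra.
Qed.

(** The last barrier of level [n] is b_mu(n), whose coin is 0 with probability one; b_mu is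
    nondecreasing, so b_mu(1) is a common lower bound for all levels from 1 on. *)
Lemma last_barrier : exists B : int, forall n, (0 < n)%N -> below_xbar mu n ->
  exists k, [/\ valid mu n k, rho mu n k = 1 & B <= xnk mu n k].
Proof.
have [hb1|hb1] := pselect (below_xbar mu 1); last first.
  exists 0 => n n0 /below_xbarE hb; exfalso; apply: hb1; apply/below_xbarE.
  by apply: lt_le_trans hb _; apply: tailM_antitone; lia.
have [B hB] := anchor_exists hb1 (ltn0Sn 0).
exists B => n n0 hb; have [a ha] := anchor_exists hb n0.
have [hv e1] := mn_anchor hb ha; exists (mn mu n).+1; split=> //.
  by rewrite /rho (gtn_eqF n0) /= ltnn.
rewrite e1 leNgt; apply/negP => aB; have B1 := anchor_lt hb1 hB.
case: ha => _; rewrite ltNge => /negP; apply.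
apply: (@le_trans _ _ (Phi n%:R B)).
  case: hB => h _; rewrite (Phi_shift 1) addr_ge0//.
  by rewrite mulr_ge0 ?tailM_ge0// subr_ge0 ler1n.
apply: Phi_antitone; first by lia.
by rewrite natr_intr -[1 : R]/(1%:~R) -intrD ler_int; lia.
Qed.

Lemma xnk_leS n k : valid mu n k -> xnk mu n k <= n%:Z + 1.
Proof. by move=> hv; apply: Xset_le; [case: hv|exact: xnk_Xset]. Qed.

Lemma ay_bound_call n : (0 < n)%N ->
  exists2 b : int, b < n%:Z & (n%:R - b%:~R) * ay_bound mu n = call b.
Proof.
move=> n0; have eg : ay_bound mu n = gam n by rewrite /gam (gtn_eqF n0).
rewrite eg; have [b [e1 e2 [e3 e4] _ _]] := barrier_exists n0.
move: e3; rewrite le_eqVlt => /predU1P[eb|]; last by exists b.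
(* If b_mu(n) = n the factor n - b would vanish. One unit lower it is 1, and
   [call (n - 1) = tailM n] is still the bound. *)
exists (n%:Z - 1); first by lia.
have t0 := e4.2 eb; rewrite gam_top// call_rec subrK natr_intr intrB.
have -> : call n%:Z = 0 by rewrite call_rec call_eq0 ?t0 ?addr0.
by ring.
Qed.

Lemma gam_ay n : (0 < n)%N -> gam n = ay_bound mu n.
Proof. by rewrite /gam; case: n. Qed.

Lemma ay_bound_ge0 n : (0 < n)%N -> 0 <= ay_bound mu n.
Proof.
move=> n0; have [b bn e] := ay_bound_call n0.
have p : (0 : R) < n%:R - b%:~R by rewrite natr_intr subr_gt0 ltr_int.
by rewrite -(pmulr_rge0 _ p) e call_ge0.
Qed.

Lemma ay_bound_above n : (0 < n)%N -> ~ below_xbar mu n.-1 -> ay_bound mu n = 0.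
Proof.
move=> n0 hb; have t0 : tailM n%:Z = 0.
  apply/eqP; rewrite eq_le tailM_ge0 andbT leNgt; apply/negP => h; apply: hb.
  by apply/below_xbarE; have -> : n.-1%:Z + 1 = n%:Z by lia.
rewrite -gam_ay// gam_top//; apply/eqP; rewrite eq_le tailM_ge0 andbT -t0.
by apply: tailM_antitone; lia.
Qed.

(** Without mass above 0 the call at 0 vanishes, hence by parity so does the put. *)
Lemma delta0 : ~ below_xbar mu 0 -> mu = (fun z : int => if z == 0 then 1 else 0).
Proof.
move=> nb; have t1 : tailM 1 = 0.
  apply/eqP; rewrite eq_le tailM_ge0 andbT leNgt; apply/negP => h; apply: nb.
  exact/below_xbarE.
have c0 : put 0 = 0.
  have := call_put 0; rewrite call_rec call_eq0 ?add0r ?t1//; lra.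
have mz z : z != 0 -> mu z = 0.
  move=> z0; apply/eqP; rewrite eq_le mu_ge0 andbT leNgt; apply/negP => mz.
  have [zn|zp] : z < 0 \/ 0 < z by lia.
    by have : 0 < put 0 by [apply/put_gt0; exists z]; rewrite c0 ltxx.
  by have : 0 < tailM 1 by [apply/tailM_gt0; exists z => //; lia]; rewrite t1 ltxx.
apply/funext => z; case: eqP => [->|/eqP]; last exact: mz.
rewrite -(EX_pred1 0) -[RHS]EX1; apply/eqP; rewrite eq_le; apply/andP; split.
  by apply: le_EX lingrowth1 => w; rewrite ler0n lern1 leq_b1.
have -> : EX (fun=> 1) = EX (fun z => (z == 0)%:R) + EX (fun z => (z != 0)%:R).
  rewrite -EXD; [|exact: (lingrowth_bool _)..].
  by apply: eq_EX => w; case: eqP => _; rewrite ?addr0 ?add0r.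
rewrite [X in _ + X]EX_eq0 ?addr0// => w mw; case: eqP => // /eqP /mz e.
by move: mw; rewrite e ltxx.
Qed.

End Moments.

Lemma sum_EX {R : realType} (mu : int -> R) f (s : seq int) : isM0 mu -> lingrowth f -> uniq s ->
  \sum_(z <- s) f z * mu z = EX mu (fun w => f w * (w \in s)%:R).
Proof.
move=> muM0 lf; elim: s => [_|z s ih /= /andP[zs us]].
  by rewrite big_nil EX_eq0// => w _; rewrite mulr0.
rewrite big_cons ih// -[in f z * _](EX_pred1 muM0 z).
have lb : lingrowth (fun w : int => ((w == z)%:R : R)) := lingrowth_bool _.
have fz := lingrowth_ge0 z lf.
rewrite -EXZ// -EXD//; [|exact: lingrowthZ|exact: (lingrowth_restr (fun w => w \in s))].
apply: eq_EX => w; rewrite in_cons; case: eqP => [->|_] /=.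
  by rewrite (negbTE zs) mulr0 addr0.
by rewrite mulr0 add0r.
Qed.

Lemma sum_le_EX {R : realType} (mu : int -> R) f (s : seq int) : isM0 mu -> lingrowth f -> uniq s ->
  \sum_(z <- s) f z * mu z <= EX mu f.
Proof.
move=> muM0 lf us; rewrite sum_EX//; apply: le_EX => // w.
by have := lingrowth_ge0 w lf; case: (w \in s); rewrite ?mulr1 ?mulr0 => ->; rewrite /= lexx.
Qed.

Lemma call_le_norm {R : realType} (x b : int) :
  Num.max (x - b)%:~R 0 <= `|x|%:~R + `|b|%:~R :> R.
Proof. by rewrite ge_max -intrD ler_int ler0z; apply/andP; split; lia. Qed.

(** * Events and bounded expectations *)

Section SigmaAlgebraEvents.
Context {T : Type}.
Variable F : set (set T).
Hypothesis sF : sigma_algebra setT F.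

Lemma sa_not (Q : T -> Prop) : F [set w | Q w] -> F [set w | ~ Q w].
Proof.
move=> FQ; case: sF => _ hC _; have -> : [set w | ~ Q w] = setT `\` [set w | Q w].
  by rewrite setTD.
exact: hC.
Qed.

Lemma sa_ex (I : countType) (Q : I -> T -> Prop) :
  (forall i, F [set w | Q i w]) -> F [set w | exists i, Q i w].
Proof.
case: sF => h0 _ hU FQ.
have -> : [set w | exists i, Q i w] =
    \bigcup_n (if unpickle n is Some i then [set w | Q i w] else set0).
  apply/seteqP; split=> [w [i hi]|w [n _]].
    by exists (pickle i) => //; rewrite pickleK.
  by case: unpickle => // i; exists i.
by apply: hU => n; case: unpickle.
Qed.

Lemma sa_const (Q : Prop) : F [set w | Q].
Proof.
have hF : F [set w | False].
  have -> : [set w | False] = set0 :> set T by [].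
  by case: sF.
have [q|q] := pselect Q; last first.
  by have -> : [set w | Q] = [set w | False] :> set T by apply/seteqP; split=> w.
have -> : [set w | Q] = [set w | ~ False] :> set T by apply/seteqP; split=> w //= _ [].
exact: sa_not.
Qed.

Lemma sa_ext (A B : set T) : (forall w, A w <-> B w) -> F A -> F B.
Proof. by move=> AB; have -> : A = B by apply/seteqP; split=> w /AB. Qed.

Lemma sa_all (I : countType) (Q : I -> T -> Prop) :
  (forall i, F [set w | Q i w]) -> F [set w | forall i, Q i w].
Proof.
move=> FQ; apply: (@sa_ext [set w | ~ exists i, ~ Q i w]).
  move=> w; split=> /= [h i|h [i]]; last by apply; exact: h.
  by apply: contrapT => hi; apply: h; exists i.
by apply: sa_not; apply: sa_ex => i; exact: sa_not.
Qed.

Lemma sa_or (Q Q' : T -> Prop) :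
  F [set w | Q w] -> F [set w | Q' w] -> F [set w | Q w \/ Q' w].
Proof.
move=> FQ FQ'; apply: (@sa_ext [set w | exists b : bool, if b then Q w else Q' w]).
  move=> w; split=> /= [[[]]|[]]; [by left|by right|by exists true|by exists false].
by apply: sa_ex => -[].
Qed.

Lemma sa_and (Q Q' : T -> Prop) :
  F [set w | Q w] -> F [set w | Q' w] -> F [set w | Q w /\ Q' w].
Proof.
move=> FQ FQ'; apply: (@sa_ext [set w | forall b : bool, if b then Q w else Q' w]).
  move=> w; split=> /= [h|[? ?] []//]; split; [exact: (h true)|exact: (h false)].
by apply: sa_all => -[].
Qed.

(** Bounded quantifiers such as u <= t enter an event as implications with a deterministic
    premise. *)
Lemma sa_imp (Q : Prop) (Q' : T -> Prop) :
  (Q -> F [set w | Q' w]) -> F [set w | Q -> Q' w].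
Proof.
move=> h; have [q|q] := pselect Q.
  by apply: sa_ext (h q) => w; split=> [? _|/(_ q)].
by apply: sa_ext (sa_const True) => w; split=> // _ /q.
Qed.

End SigmaAlgebraEvents.

Lemma measurable_sa (d : measure_display) (T : measurableType d) :
  sigma_algebra setT (@measurable d T).
Proof.
split; [exact: measurable0|by move=> A mA; rewrite setTD; exact: measurableC|].
by move=> A mA; exact: bigcup_measurable.
Qed.

(** * Real-valued probabilities and expectations of bounded functions *)

Section BoundedExpectation.
Context {R : realType} {d : measure_display} {Omega : measurableType d}.
Variable P : probability Omega R.

Definition Pr (A : set Omega) : R := fine (P A).

Lemma PrE A : measurable A -> P A = (Pr A)%:E.
Proof. by move=> mA; rewrite /Pr fineK// fin_num_measure. Qed.

Lemma Pr_ge0 A : 0 <= Pr A. Proof. by apply: fine_ge0. Qed.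

Lemma le_Pr A B : measurable A -> measurable B -> A `<=` B -> Pr A <= Pr B.
Proof. by move=> mA mB AB; rewrite -lee_fin -!PrE// le_measure ?inE. Qed.

Lemma Pr_le1 A : measurable A -> Pr A <= 1.
Proof. by move=> mA; rewrite -lee_fin -PrE// probability_le1. Qed.

Lemma PrU A B : measurable A -> measurable B -> A `&` B = set0 ->
  Pr (A `|` B) = Pr A + Pr B.
Proof.
move=> mA mB AB; apply: EFin_inj; rewrite EFinD -!PrE//; last exact: measurableU.
by rewrite measureU.
Qed.

Lemma PrC A : measurable A -> Pr (~` A) = 1 - Pr A.
Proof.
move=> mA; apply: EFin_inj; rewrite -PrE; last exact: measurableC.
by rewrite probability_setC// PrE.
Qed.

Lemma le_PrU A B : measurable A -> measurable B -> Pr (A `|` B) <= Pr A + Pr B.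
Proof.
move=> mA mB; rewrite -lee_fin EFinD -!PrE//; last exact: measurableU.
exact: measureU2.
Qed.

Lemma Pr_cvg_up (A : nat -> set Omega) : (forall n, measurable (A n)) ->
  (forall m n, (m <= n)%N -> A m `<=` A n) -> Pr \o A @ \oo --> Pr (\bigcup_n A n).
Proof.
move=> mA ndA; have mU : measurable (\bigcup_n A n) by exact: bigcup_measurable.
have : P \o A @ \oo --> P (\bigcup_n A n).
  apply: nondecreasing_cvg_mu => //; apply/nondecreasing_seqP => n.
  by apply/subsetPset; exact: ndA.
by rewrite PrE// => /fine_cvgP[].
Qed.

Lemma Pr_cvg_down (A : nat -> set Omega) : (forall n, measurable (A n)) ->
  (forall m n, (m <= n)%N -> A n `<=` A m) -> Pr \o A @ \oo --> Pr (\bigcap_n A n).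
Proof.
move=> mA niA; have mI : measurable (\bigcap_n A n) by exact: bigcap_measurable.
have h : Pr \o (fun n => ~` A n) @ \oo --> Pr (\bigcup_n ~` A n).
  apply: Pr_cvg_up => [n|m n mn]; first exact: measurableC.
  by apply: subsetC; exact: niA.
have -> : Pr (\bigcap_n A n) = 1 - Pr (\bigcup_n ~` A n).
  by rewrite -setC_bigcap PrC//; ring.
have -> : Pr \o A = (fun n => 1 - Pr (~` A n)) by apply/funext => n /=; rewrite PrC//; ring.
by apply: cvgB => //; exact: cvg_cst.
Qed.

(** All optional stopping is done up to a fixed time with integrands that are bounded everywhere, so
    linearity comes without integrability conditions. *)
Definition bm (f : Omega -> R) : Prop :=
  measurable_fun setT f /\ exists K, forall w, `|f w| <= K.

Definition Ex (f : Omega -> R) : R := (\int[P]_w f w)%R.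

Lemma bm_integrable f : bm f -> P.-integrable setT (EFin \o f).
Proof.
move=> [mf [K hK]]; apply: measurable_bounded_integrable => //.
  by rewrite (le_lt_trans (probability_le1 _ _))// ltry.
exists K; split; first by rewrite num_real.
by move=> x Kx w _ /=; rewrite (le_trans (hK w))// ltW.
Qed.

Lemma bm_cst (c : R) : bm (fun=> c).
Proof. by split; [exact: measurable_cst|exists `|c|]. Qed.

Lemma bm_indic A : measurable A -> bm (\1_A).
Proof.
move=> mA; split; first exact: measurable_indic.
by exists 1 => w; rewrite indicE; case: (w \in A); rewrite ?normr1 ?normr0.
Qed.

Lemma bmD f g : bm f -> bm g -> bm (fun w => f w + g w).
Proof.
move=> [mf [K hK]] [mg [L hL]]; split; first exact: measurable_funD.
by exists (K + L) => w; rewrite (le_trans (ler_normD _ _))// lerD.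
Qed.

Lemma bmM f g : bm f -> bm g -> bm (fun w => f w * g w).
Proof.
move=> [mf [K hK]] [mg [L hL]]; split; first exact: measurable_funM.
by exists (K * L) => w; rewrite normrM ler_pM.
Qed.

Lemma bmN f : bm f -> bm (fun w => - f w).
Proof.
move=> bf; have := bmM (bm_cst (-1)) bf.
by under [X in bm X]eq_fun do rewrite mulN1r.
Qed.

Lemma bmB f g : bm f -> bm g -> bm (fun w => f w - g w).
Proof. by move=> bf bg; apply: bmD => //; exact: bmN. Qed.

Lemma bm_sum (I : Type) (r : seq I) (f : I -> Omega -> R) :
  (forall i, bm (f i)) -> bm (fun w => \sum_(i <- r) f i w).
Proof.
move=> bf; elim: r => [|i r ih].
  by under [X in bm X]eq_fun do rewrite big_nil; exact: bm_cst.
by under [X in bm X]eq_fun do rewrite big_cons; exact: bmD.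
Qed.

Lemma ExD f g : bm f -> bm g -> Ex (fun w => f w + g w) = Ex f + Ex g.
Proof. by move=> bf bg; rewrite /Ex RintegralD//; exact: bm_integrable. Qed.

Lemma ExZ k f : bm f -> Ex (fun w => k * f w) = k * Ex f.
Proof. by move=> bf; rewrite /Ex RintegralZl//; exact: bm_integrable. Qed.

Lemma ExB f g : bm f -> bm g -> Ex (fun w => f w - g w) = Ex f - Ex g.
Proof. by move=> bf bg; rewrite /Ex RintegralB//; exact: bm_integrable. Qed.

Lemma Ex_cst c : Ex (fun=> c) = c.
Proof.
have h : Pr setT = 1 by rewrite /Pr probability_setT.
by rewrite /Ex Rintegral_cst//; rewrite /Pr in h; rewrite [X in c * X]h mulr1.
Qed.

Lemma Ex_sum (I : Type) (r : seq I) (f : I -> Omega -> R) :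
  (forall i, bm (f i)) -> Ex (fun w => \sum_(i <- r) f i w) = \sum_(i <- r) Ex (f i).
Proof.
move=> bf; elim: r => [|i r ih].
  rewrite big_nil (_ : (fun w => _) = fun=> 0) ?Ex_cst//.
  by apply/funext => w; rewrite big_nil.
rewrite big_cons -ih -ExD//; last exact: bm_sum.
by congr Ex; apply/funext => w; rewrite big_cons.
Qed.

Lemma Ex_indic A : measurable A -> Ex (\1_A) = Pr A.
Proof. by move=> mA; rewrite /Ex /Rintegral integral_indic// setIT. Qed.

Lemma Ex_ge0 f : (forall w, 0 <= f w) -> 0 <= Ex f.
Proof. by move=> f0; apply: Rintegral_ge0. Qed.

Lemma le_Ex G f g : measurable G -> P G = 1%E -> bm f -> bm g ->
  (forall w, G w -> f w <= g w) -> Ex f <= Ex g.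
Proof.
move=> mG PG bf bg fg; have [_ [K hK]] := bf; have [_ [L hL]] := bg.
have mC : measurable (~` G) by exact: measurableC.
have b1 : bm (fun w => (K + L) * \1_(~` G) w).
  by apply: bmM; [exact: bm_cst|exact: bm_indic].
have PC : Pr (~` G) = 0 by rewrite PrC// /Pr PG subrr.
(* Off [G] the difference [g - f] is at least [- (K + L)]; the added term has expectation zero and
   restores the sign. *)
have : 0 <= Ex (fun w => (g w - f w) + (K + L) * \1_(~` G) w).
  apply: Ex_ge0 => w; rewrite indicE; case: (pselect (G w)) => Gw.
    rewrite memNset ?mulr0 ?addr0 ?subr_ge0; [exact: fg|by move=> /(_ Gw)].
  rewrite mem_set// mulr1; have := hK w; have := hL w; rewrite !ler_norml.
  by move=> /andP[? ?] /andP[? ?]; lra.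
rewrite ExD//; last exact: bmB.
by rewrite ExZ ?Ex_indic ?PC ?mulr0 ?addr0 ?ExB ?subr_ge0//; exact: bm_indic.
Qed.

Lemma eq_Ex G f g : measurable G -> P G = 1%E -> bm f -> bm g ->
  (forall w, G w -> f w = g w) -> Ex f = Ex g.
Proof.
move=> mG PG bf bg fg; apply/eqP; rewrite eq_le.
by apply/andP; split; apply: (le_Ex mG PG) => // w /fg ->.
Qed.

Lemma le_Pr_ae G A B : measurable G -> P G = 1%E -> measurable A -> measurable B ->
  (forall w, G w -> A w -> B w) -> Pr A <= Pr B.
Proof.
move=> mG PG mA mB AB; rewrite -!Ex_indic//; apply: (le_Ex mG PG); try exact: bm_indic.
move=> w Gw; rewrite !indicE ler_nat; case: (pselect (A w)) => Aw.
  by rewrite (mem_set (AB _ Gw Aw)) leq_b1.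
by rewrite memNset.
Qed.

End BoundedExpectation.
Section Indicator.
Context {R : realType} {T : Type}.

Lemma indic1 (A : set T) w : A w -> \1_A w = 1 :> R.
Proof. by move=> Aw; rewrite indicE mem_set. Qed.

Lemma indic0 (A : set T) w : ~ A w -> \1_A w = 0 :> R.
Proof. by move=> Aw; rewrite indicE memNset. Qed.

Lemma indic_ge0 (A : set T) w : 0 <= \1_A w :> R.
Proof. by rewrite indicE ler0n. Qed.

End Indicator.

(** * The running maximum *)

Section RunningMax.
Context {d : measure_display} {T : measurableType d}.
Variable S : nat -> T -> int.

Lemma leSmax (m : int) t w : (m <= Smax S t w) <-> exists2 u, (u <= t)%N & m <= S u w.
Proof.
rewrite /Smax; split=> [/bigmax_geP[h|[u _ h]]|[u ut h]].
- by exists 0%N.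
- by exists u => //; rewrite -ltnS.
- by apply/bigmax_geP; right; exists (Ordinal (ut : (u < t.+1)%N)).
Qed.

Lemma S_le_Smax u t w : (u <= t)%N -> S u w <= Smax S t w.
Proof. by move=> ut; apply/leSmax; exists u. Qed.

Lemma Smax_mono u t w : (u <= t)%N -> Smax S u w <= Smax S t w.
Proof.
move=> ut; apply/leSmax; have /leSmax[v vu h] := lexx (Smax S u w).
by exists v => //; lia.
Qed.

Lemma Smax_0 w : Smax S 0 w = S 0%N w.
Proof.
apply/eqP; rewrite eq_le S_le_Smax// andbT.
by have /leSmax[u] := lexx (Smax S 0 w); rewrite leqn0 => /eqP ->.
Qed.

Lemma Smax_S t w : Smax S t.+1 w = Num.max (Smax S t w) (S t.+1 w).
Proof.
apply/eqP; rewrite eq_le ge_max S_le_Smax// Smax_mono// !andbT le_max.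
have /leSmax[u] := lexx (Smax S t.+1 w).
rewrite leq_eqVlt => /predU1P[->->|ut h]; first by rewrite orbT.
by apply/orP; left; apply/leSmax; exists u.
Qed.

End RunningMax.

(** * Simple random walks and the maximal inequality *)

Section Walk.
Context {R : realType} {d : measure_display} {Omega : measurableType d}.
Variables (P : probability Omega R) (F : nat -> set (set Omega)) (S : nat -> Omega -> int).
Hypothesis hS : is_srw_wrt P F S.

Lemma F_sa t : sigma_algebra setT (F t).
Proof. by case: hS => /(_ t)[]. Qed.

Lemma F_meas t A : F t A -> measurable A.
Proof. by case: hS => /(_ t)[_ h _] _ _ _; exact: h. Qed.

Lemma F_mono s t A : (s <= t)%N -> F s A -> F t A.
Proof.
move=> st; rewrite -(subnKC st); elim: (t - s)%N => [|j ih]; first by rewrite addn0.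
by move=> /ih; rewrite addnS; case: hS => /(_ (s + j)%N)[_ _ h] _ _ _; exact: h.
Qed.

Lemma S0 w : S 0%N w = 0. Proof. by case: hS. Qed.

Lemma F_S u t (B : int -> Prop) : (u <= t)%N -> F t [set w | B (S u w)].
Proof.
move=> ut; apply: (sa_ext (A := [set w | exists z, B z /\ S u w = z])).
  by move=> w; split=> /= [[z [Bz ->]]|Bw]; [|exists (S u w)].
apply: sa_ex => [|z]; first exact: F_sa.
apply: sa_and; [exact: F_sa|apply: sa_const; exact: F_sa|].
by apply: F_mono ut _; case: hS.
Qed.

Lemma F_Smax u t (B : int -> Prop) : (u <= t)%N -> F t [set w | B (Smax S u w)].
Proof.
move=> ut; have ge z : F t [set w | z <= Smax S u w].
  apply: (sa_ext (A := [set w | exists v, (v <= u)%N /\ z <= S v w])).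
    by move=> w; split=> /= [[v [vu h]]|/leSmax[v vu h]]; [apply/leSmax|]; exists v.
  apply: sa_ex => [|v]; first exact: F_sa.
  have [vu|vu] := leqP v u; last first.
    by apply: sa_ext (sa_const (F_sa t) False) => w; split=> // -[].
  by apply: sa_ext (F_S (fun x => z <= x) (leq_trans vu ut)) => w; split=> [|[]].
apply: (sa_ext (A := [set w | exists z, B z /\ (z <= Smax S u w /\ ~ z + 1 <= Smax S u w)])).
  move=> w; split=> /= [[z [Bz [h1 h2]]]|Bw].
    by have -> : Smax S u w = z by lia.
  by exists (Smax S u w); split=> //; split=> //; lia.
apply: sa_ex => [|z]; first exact: F_sa.
apply: sa_and; [exact: F_sa|apply: sa_const; exact: F_sa|].
by apply: sa_and; [exact: F_sa|exact: ge|apply: sa_not; [exact: F_sa|exact: ge]].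
Qed.

(** Steps are plus or minus one only almost surely, so pathwise arguments are confined to this
    event. *)
Definition good : set Omega :=
  [set w | forall t, S t.+1 w - S t w = 1 \/ S t.+1 w - S t w = -1].

Definition stepup t : set Omega := [set w | S t.+1 w - S t w = 1].
Definition stepdown t : set Omega := [set w | S t.+1 w - S t w = -1].

Lemma F_inc t (B : int -> Prop) : F t.+1 [set w | B (S t.+1 w - S t w)].
Proof.
apply: (sa_ext (A := [set w | exists z, S t w = z /\ B (S t.+1 w - z)])).
  by move=> w; split=> /= [[z [-> //]]|Bw]; exists (S t w).
apply: sa_ex => [|z]; first exact: F_sa.
by apply: sa_and; [exact: F_sa|exact: (F_S (fun x => x = z) (leqnSn t))|exact: (F_S (fun x => B (x - z)))].
Qed.

Lemma up_meas t : measurable (stepup t). Proof. exact: F_meas (F_inc t (fun x => x = 1)). Qed.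

Lemma down_meas t : measurable (stepdown t). Proof. exact: F_meas (F_inc t (fun x => x = -1)). Qed.
Hint Resolve up_meas down_meas : core.

Lemma good_meas : measurable good.
Proof.
apply: (sa_all (measurable_sa Omega)) => t.
by apply: (sa_or (measurable_sa Omega)); [exact: up_meas|exact: down_meas].
Qed.
Hint Resolve good_meas : core.

Lemma Pr_up t A : F t A -> Pr P (A `&` stepup t) = Pr P A / 2.
Proof.
move=> FA; have mA := F_meas FA; case: hS => _ _ _ /(_ t)[h1 _ h3].
have := h3 A (fun x => x = 1) FA; rewrite -/(stepup t) h1 => h.
by apply: EFin_inj; rewrite -PrE ?h ?PrE//; [rewrite -EFinM; congr EFin; lra|exact: measurableI].
Qed.

Lemma Pr_down t A : F t A -> Pr P (A `&` stepdown t) = Pr P A / 2.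
Proof.
move=> FA; have mA := F_meas FA; case: hS => _ _ _ /(_ t)[_ h1 h3].
have := h3 A (fun x => x = -1) FA; rewrite -/(stepdown t) h1 => h.
by apply: EFin_inj; rewrite -PrE ?h ?PrE//; [rewrite -EFinM; congr EFin; lra|exact: measurableI].
Qed.

Lemma P_good : P good = 1%E.
Proof.
have -> : good = ~` (\bigcup_t ~` (stepup t `|` stepdown t)).
  by rewrite setC_bigcup; apply/seteqP; split=> [w gw t _|w gw t]; rewrite ?setCK;
    [exact: gw|have := gw t Logic.I; rewrite setCK].
have mC t : measurable (~` (stepup t `|` stepdown t)) by apply: measurableC; exact: measurableU.
rewrite probability_setC; last exact: bigcup_measurable.
have -> : P (\bigcup_t ~` (stepup t `|` stepdown t)) = 0%E; last by rewrite sube0.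
apply/negligibleP; first exact: bigcup_measurable.
apply: negligible_bigcup => t; apply/negligibleP => //.
have FT : F t setT by apply: sa_ext (sa_const (F_sa t) True) => w; split.
transitivity (Pr P (~` (stepup t `|` stepdown t)))%:E; first exact: PrE.
rewrite PrC; last exact: measurableU.
rewrite PrU//; last by apply/seteqP; split=> w //=; rewrite /stepup /stepdown /= => -[->].
rewrite -(setTI (stepup t)) -(setTI (stepdown t)) Pr_up// Pr_down// /Pr probability_setT.
by congr EFin; rewrite /=; lra.
Qed.

(** The increment on [good], but bounded on the whole space, so that transforms are bounded too. *)
Definition dS t w : R := \1_(stepup t) w - \1_(stepdown t) w.

Lemma dS_good t w : good w -> dS t w = (S t.+1 w - S t w)%:~R.
Proof.
move=> /(_ t)[] e; rewrite /dS e.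
  by rewrite indic1// indic0 ?subr0// /stepdown /= e.
by rewrite indic0 ?indic1 ?sub0r// /stepup /= e.
Qed.

Lemma bm_dS t : bm (dS t).
Proof. by apply: bmB; exact: bm_indic. Qed.

Definition transform (a : nat -> set Omega) T w : R := \sum_(0 <= t < T) \1_(a t) w * dS t w.

Lemma transform0 a w : transform a 0 w = 0.
Proof. by rewrite /transform big_geq. Qed.

Lemma transformS a T w : good w ->
  transform a T.+1 w = transform a T w + \1_(a T) w * (S T.+1 w - S T w)%:~R.
Proof. by move=> gw; rewrite /transform big_nat_recr//= dS_good. Qed.

Section Adapted.
Variable a : nat -> set Omega.
Hypothesis Fa : forall t, F t (a t).

Lemma bm_transform T : bm (transform a T).
Proof.
apply: bm_sum => t; apply: bmM; last exact: bm_dS.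
exact/bm_indic/(F_meas (Fa t)).
Qed.

(** Given the past, an up step and a down step are equally likely, so each summand has mean zero. *)
Lemma Ex_transform T : Ex P (transform a T) = 0.
Proof.
have bt t : bm (fun w => \1_(a t) w * dS t w).
  by apply: bmM; [exact/bm_indic/(F_meas (Fa t))|exact: bm_dS].
rewrite /transform Ex_sum// big1_seq// => t _.
have mA := F_meas (Fa t).
have -> : (fun w => \1_(a t) w * dS t w) = (fun w => \1_(a t `&` stepup t) w - \1_(a t `&` stepdown t) w).
  by apply/funext => w; rewrite /dS mulrBr !indicI.
rewrite ExB; [|exact/bm_indic/measurableI..].
by rewrite !Ex_indic ?Pr_up ?Pr_down ?subrr//; exact: measurableI.
Qed.

End Adapted.

Lemma S_bound t w : good w -> `|S t w| <= t%:Z.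
Proof.
move=> gw; elim: t => [|t ih]; first by rewrite S0.
by have := gw t; lia.
Qed.

(** Unit steps cannot jump over a level, so a new maximum is attained exactly. *)
Lemma first_max (n t : nat) w : good w -> n%:Z <= Smax S t w ->
  (forall u, (u < t)%N -> Smax S u w < n%:Z) -> S t w = n%:Z /\ Smax S t w = n%:Z.
Proof.
move=> gw; case: t => [|t] h hl.
  by move: h; rewrite Smax_0 S0 => h; lia.
have h1 := hl t (ltnSn t); have h2 := S_le_Smax S w (leqnn t).
by have := gw t; move: h; rewrite Smax_S; lia.
Qed.

Lemma Smax_ge0 t w : 0 <= Smax S t w.
Proof. by rewrite -(S0 w) S_le_Smax. Qed.

(** * The running maximum exceeds every level *)

Section Recurrence.
Variables N n : nat.

Definition inside t : set Omega :=
  [set w | forall u, (u <= t)%N -> - N%:Z < S u w < n%:Z].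

Lemma F_inside t : F t (inside t).
Proof.
apply: sa_all => [|u]; first exact: F_sa.
apply: sa_imp => [|ut]; first exact: F_sa.
exact: (F_S (fun x => - N%:Z < x < n%:Z) ut).
Qed.

(** A run of N + n up steps leads out of (-N, n) from any point inside, and its conditional
    probability is 2^-(N + n). *)
Lemma Pr_inside_block t : Pr P (inside (t + (N + n))) <= (1 - 2^-1 ^+ (N + n)) * Pr P (inside t).
Proof.
pose E j := inside t `&` [set w | forall i, (i < j)%N -> stepup (t + i) w].
have FE j : F (t + j) (E j).
  apply: (sa_and (F_sa _)); first by apply: F_mono (F_inside t); lia.
  apply: sa_all => [|i]; first exact: F_sa.
  apply: sa_imp => [|ij]; first exact: F_sa.
  by apply: F_mono (F_inc (t + i) (fun x => x = 1)); lia.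
have PE j : Pr P (E j) = 2^-1 ^+ j * Pr P (inside t).
  elim: j => [|j ih].
    by rewrite expr0 mul1r; congr Pr; apply/seteqP; split=> [w []//|w ?]; split.
  have -> : E j.+1 = E j `&` stepup (t + j).
    apply/seteqP; split=> [w [h1 h2]|w [[h1 h2] h3]].
      by split; [split=> // i ij; apply: h2; lia|apply: h2].
    split=> // i; rewrite ltnS leq_eqVlt => /predU1P[->//|]; exact: h2.
  by rewrite Pr_up// ih exprS; ring.
have m1 := F_meas (F_inside t); have m2 := F_meas (F_inside (t + (N + n))).
have m3 := F_meas (FE (N + n)%N).
rewrite mulrBl mul1r -PE lerBrDr -PrU//.
  apply: le_Pr => //; first exact: measurableU.
  by move=> w [h u ut|[]//]; apply: h; lia.
apply/seteqP; split=> // w [h1 [h2 h3]] /=.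
have hj j : (j <= N + n)%N -> S (t + j) w = S t w + j%:Z.
  elim: j => [|j ih] jn; first by rewrite addn0 addr0.
  by have := h3 j jn; rewrite /stepup /= addnS ih; lia.
have := h1 (t + (N + n))%N (leqnn _); rewrite hj//.
by have := h2 t (leqnn t); lia.
Qed.

Lemma Pr_inside_cvg (e : R) : 0 < e -> exists t, Pr P (inside t) <= e.
Proof.
move=> e0; set q : R := 1 - 2^-1 ^+ (N + n).
have q01 : 0 <= q < 1.
  have h0 : (0 : R) < 2^-1 ^+ (N + n) by apply: exprn_gt0; lra.
  have h1 : 2^-1 ^+ (N + n) <= (1 : R) by apply: exprn_ile1; lra.
  by rewrite /q; lra.
have hj j : Pr P (inside (j * (N + n))) <= q ^+ j.
  elim: j => [|j ih].
    by rewrite mul0n expr0; apply: Pr_le1; exact: F_meas (F_inside 0).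
  rewrite mulSn addnC (le_trans (Pr_inside_block _))// exprS ler_wpM2l//.
  by case/andP: q01.
have : (fun j => q ^+ j) @ \oo --> (0 : R).
  by apply: cvg_expr; rewrite ger0_norm; case/andP: q01.
move=> /cvgrPdist_le/(_ _ e0)[j _ /(_ j (leqnn j))/=].
rewrite sub0r normrN ger0_norm; last by rewrite exprn_ge0//; case/andP: q01.
by move=> h; exists (j * (N + n))%N; exact: le_trans (hj j) h.
Qed.

Definition fell T : set Omega :=
  [set w | Smax S T w < n%:Z /\ exists u, (u <= T)%N /\ S u w <= - N%:Z].

Lemma F_fell T : F T (fell T).
Proof.
apply: sa_and; [exact: F_sa|exact: (F_Smax (fun x => x < n%:Z) (leqnn T))|].
apply: sa_ex => [|u]; first exact: F_sa.
have [uT|uT] := leqP u T; last first.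
  by apply: sa_ext (sa_const (F_sa T) False) => w; split=> // -[].
by apply: sa_ext (F_S (fun x => x <= - N%:Z) uT) => w; split=> [|[]].
Qed.

Hypotheses (N0 : (0 < N)%N) (n0 : (0 < n)%N).

(** The transform is the walk frozen at its exit from (-N, n). *)
Lemma transform_inside T w : good w ->
  [/\ inside T w -> transform inside T w = (S T w)%:~R,
      fell T w -> transform inside T w = - N%:R &
      transform inside T w <= n%:R].
Proof.
move=> gw; elim: T => [|T [h1 h2 h3]].
  rewrite transform0 S0; split=> // -[_ [u []]].
  by rewrite leqn0 => /eqP ->; rewrite S0; lia.
rewrite transformS//; have [i|i] := pselect (inside T w).
  have -> : transform inside T w + \1_(inside T) w * (S T.+1 w - S T w)%:~R = (S T.+1 w)%:~R.
    by rewrite indic1// h1// mul1r intrB; ring.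
  have := gw T; have := i T (leqnn T) => i1 g1; split=> //.
    move=> [m [u [uT su]]]; have := S_le_Smax S w (leqnn T.+1) => sm.
    have uT' : u = T.+1.
      by apply/eqP; rewrite eqn_leq uT/= ltnNge; apply/negP => /i; lia.
    have -> : S T.+1 w = - N%:Z by move: su; rewrite uT'; lia.
    by rewrite intrN.
  by rewrite natr_intr ler_int; lia.
rewrite indic0// mul0r addr0; split=> // [i'|[m [u [uT su]]]].
  by exfalso; apply: i => u ut; apply: i'; lia.
apply: h2; split; first exact: le_lt_trans (Smax_mono _ _ (leqnSn T)) m.
apply: contrapT => hn; apply: i => v vT; apply/andP; split; last first.
  by apply: le_lt_trans m; apply: S_le_Smax; lia.
by rewrite ltNge; apply/negP => h; apply: hn; exists v.
Qed.

Lemma Pr_fell T : Pr P (fell T) <= n%:R / (N + n)%:R.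
Proof.
have NN : (0 : R) < (N + n)%:R by rewrite ltr0n; lia.
rewrite ler_pdivlMr// mulrC -subr_ge0.
have m1 := F_meas (F_fell T).
have b1 : bm (fun w => (N + n)%:R * (\1_(fell T) w : R)).
  by apply: bmM; [exact: bm_cst|exact: bm_indic].
have := le_Ex (f := transform inside T) (g := fun w => n%:R - (N + n)%:R * \1_(fell T) w)
  good_meas P_good (bm_transform F_inside T).
rewrite Ex_transform; last exact: F_inside.
rewrite ExB ?Ex_cst ?ExZ ?Ex_indic//; [|exact: bm_indic|exact: bm_cst].
apply; first by apply: bmB => //; exact: bm_cst.
move=> w gw; have [_ h2 h3] := transform_inside T gw.
have [f|f] := pselect (fell T w); last by rewrite indic0// mulr0 subr0.
by rewrite h2// indic1// mulr1 natrD; lra.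
Qed.

End Recurrence.

Lemma Smax_unbounded (n : nat) (e : R) : 0 < e ->
  exists T0, forall T, (T0 <= T)%N -> Pr P [set w | Smax S T w < n%:Z] <= e.
Proof.
move=> e0; wlog n0 : n / (0 < n)%N.
  move=> hw; have [T0 hT] := hw n.+1 isT; exists T0 => T /hT; apply: le_trans.
  apply: le_Pr; [exact: F_meas (F_Smax (fun x => x < n%:Z) (leqnn T))|
    exact: F_meas (F_Smax (fun x => x < n.+1%:Z) (leqnn T))|].
  by move=> w /=; lia.
have mU T : measurable [set w | Smax S T w < n%:Z].
  exact: F_meas (F_Smax (fun x => x < n%:Z) (leqnn T)).
(* This makes N at least 2n/e, so the ruin bound n/(N + n) is at most e/2; the extra 1 keeps N
   positive. *)
pose N := (`|Num.ceil (n%:R / (e / 2))| + 1)%N.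
have e2 : 0 < e / 2 by lra.
have [T0 hT0] := @Pr_inside_cvg N n _ e2.
exists T0 => T TT; apply: (@le_trans _ _ (Pr P [set w | Smax S T0 w < n%:Z])).
  by apply: le_Pr => // w /=; exact: le_lt_trans (Smax_mono _ _ TT).
apply: (@le_trans _ _ (Pr P (inside N n T0 `|` fell N n T0))).
  apply: le_Pr => //.
    by apply: measurableU; [exact: F_meas (F_inside _ _ _)|exact: F_meas (F_fell _ _ _)].
  move=> w /= h; have [f|f] := pselect (exists u, (u <= T0)%N /\ S u w <= - N%:Z).
    by right.
  left=> u uT; apply/andP; split; last by apply: le_lt_trans h; exact: S_le_Smax.
  by rewrite ltNge; apply/negP => su; apply: f; exists u.
apply: le_trans (le_PrU _ _ _) _; [exact: F_meas (F_inside _ _ _)|exact: F_meas (F_fell _ _ _)|].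
have N0 : (0 < N)%N by rewrite /N; lia.
have h := Pr_fell N0 n0 T0.
have : n%:R / (N + n)%:R <= e / 2.
  have nn : (0 : R) < (N + n)%:R by rewrite ltr0n; lia.
  rewrite ler_pdivrMr// mulrC -ler_pdivrMr//.
  apply: le_trans (ceil_ge _) _; rewrite [leRHS]natr_intr ler_int /N.
  move: (Num.ceil _) => c; lia.
lra.
Qed.

Lemma Smax_reaches (n : nat) : P [set w | exists t, n%:Z <= Smax S t w] = 1%E.
Proof.
have mU t : measurable [set w | n%:Z <= Smax S t w].
  exact: F_meas (F_Smax (fun x => n%:Z <= x) (leqnn t)).
have mE : measurable [set w | exists t, n%:Z <= Smax S t w].
  exact: (sa_ex (measurable_sa Omega)).
rewrite PrE//; congr EFin; apply/eqP; rewrite eq_le Pr_le1//=.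
rewrite leNgt; apply/negP => h1.
have e0 : 0 < (1 - Pr P [set w | exists t, n%:Z <= Smax S t w]) / 2 by lra.
have [T0 /(_ T0 (leqnn _))] := @Smax_unbounded n _ e0.
have -> : [set w | Smax S T0 w < n%:Z] = ~` [set w | n%:Z <= Smax S T0 w].
  by apply/seteqP; split=> w /=; rewrite ltNge => /negP.
rewrite PrC//.
have : Pr P [set w | n%:Z <= Smax S T0 w] <= Pr P [set w | exists t, n%:Z <= Smax S t w].
  by apply: le_Pr => // w /= h; exists T0.
lra.
Qed.

(** * Functions of integer variables as finite sums *)

Lemma measurable_int_comp (X : Omega -> int) (h : int -> R) :
  (forall z, measurable [set w | X w = z]) -> measurable_fun setT (fun w => h (X w)).
Proof.
move=> mX _ B mB; rewrite setTI.
apply: (sa_ext (F := measurable) (A := [set w | exists z, B (h z) /\ X w = z])).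
  by move=> w; split=> /= [[z [Bz ->]]|Bw]; [|exists (X w)].
apply: (sa_ex (measurable_sa Omega)) => z.
by apply: (sa_and (measurable_sa Omega)) => //; exact: (sa_const (measurable_sa Omega)).
Qed.

Definition rng (T : nat) : seq int := [seq i%:Z - T%:Z | i <- iota 0 (T + T).+1].

Lemma rng_uniq T : uniq (rng T).
Proof. by rewrite map_inj_uniq ?iota_uniq// => x y; lia. Qed.

Lemma mem_rng T z : (z \in rng T) = (`|z| <= T%:Z).
Proof.
apply/mapP/idP => [[i + ->]|zT]; first by rewrite mem_iota; lia.
by exists `|(z + T%:Z)%R|%N; [rewrite mem_iota; lia|lia].
Qed.

(* A bounded version of [h (X w) * \1_A w], exact as soon as [`|X w| <= T]. *)
Definition trunc (X : Omega -> int) (T : nat) (h : int -> R) (A : set Omega) w : R :=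
  \sum_(z <- rng T) h z * \1_([set w | X w = z] `&` A) w.

Lemma truncE X T h A w : `|X w| <= T%:Z -> trunc X T h A w = h (X w) * \1_A w.
Proof.
rewrite -mem_rng => XT; rewrite /trunc (bigD1_seq (X w)) ?rng_uniq//=.
rewrite big1 => [|z zX]; last first.
  by rewrite indic0 ?mulr0// => -[/= e _]; rewrite e eqxx in zX.
by rewrite addr0 indicI /= indic1 ?mul1r.
Qed.

Lemma bm_trunc X T h A : (forall z, measurable ([set w | X w = z] `&` A)) -> bm (trunc X T h A).
Proof. by move=> mX; apply: bm_sum => z; apply: bmM; [exact: bm_cst|exact: bm_indic]. Qed.

Lemma Ex_trunc X T h A : (forall z, measurable ([set w | X w = z] `&` A)) ->
  Ex P (trunc X T h A) = \sum_(z <- rng T) h z * Pr P ([set w | X w = z] `&` A).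
Proof.
move=> mX; rewrite /trunc Ex_sum; last first.
  by move=> z; apply: bmM; [exact: bm_cst|exact: bm_indic].
by apply: eq_bigr => z _; rewrite ExZ ?Ex_indic//; exact: bm_indic.
Qed.

(** The definition of uniform integrability speaks of a Lebesgue integral over a tail event; since
    |X| <= T almost surely, it is a finite sum in disguise. *)
Lemma tail_integralE (X : Omega -> int) T (K : R) : (forall z, measurable [set w | X w = z]) ->
  (forall w, good w -> `|X w| <= T%:Z) ->
  (\int[P]_(w in [set w | (K < `|(X w)%:~R : R|)%R]) (`|(X w)%:~R : R|)%:E)%E =
  (Ex P (trunc X T (fun z => `|z%:~R| * (K < `|z%:~R : R|)%R%:R) setT))%:E.
Proof.
move=> mX bX; set h := fun z : int => `|z%:~R : R| * (K < `|z%:~R : R|)%R%:R.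
have bt : bm (trunc X T h setT) by apply: bm_trunc => z; rewrite setIT.
have -> : (Ex P (trunc X T h setT))%:E = (\int[P]_w (trunc X T h setT w)%:E)%E.
  rewrite /Ex /Rintegral fineK//; apply: integrable_fin_num => //; exact: bm_integrable.
rewrite integral_mkcond.
have -> : ((fun w => (`|(X w)%:~R : R|)%:E) \_ [set w | (K < `|(X w)%:~R : R|)%R])
    = (fun w => (h (X w))%:E).
  apply/funext => w; rewrite patchE /h; case: ifPn => [|].
    by rewrite inE /= => ->; rewrite mulr1.
  by rewrite notin_setE /= => /negP/negbTE ->; rewrite mulr0.
apply: ae_eq_integral => //.
- by apply/measurable_EFinP; exact: measurable_int_comp.
- by apply/measurable_EFinP; case: bt.
exists (~` good); split; first exact: measurableC.
  transitivity (Pr P (~` good))%:E; first by apply: PrE; exact: measurableC.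
  by rewrite PrC// /Pr P_good subrr.
move=> w /= h1 gw; apply: h1 => _; rewrite truncE ?indicT ?mulr1//; exact: bX.
Qed.

(** * Stopped walks *)

Section Stopping.
Variable sigma : Omega -> option nat.
Hypothesis st : stopping_time F sigma.

Definition alive t : set Omega := [set w | ~ exists u, (u <= t)%N /\ sigma w = Some u].

Lemma F_alive t : F t (alive t).
Proof. by apply: sa_not; [exact: F_sa|exact: st]. Qed.

Lemma F_stop t : F t [set w | sigma w = Some t].
Proof.
case: t => [|t].
  apply: sa_ext (st 0) => w; split=> /= [[u [+ ->]]|->]; last by exists 0%N.
  by rewrite leqn0 => /eqP ->.
have Fa : F t.+1 (alive t) by apply: F_mono (F_alive t).
apply: sa_ext (sa_and (F_sa _) (st t.+1) Fa) => w; split=> /= [[[u [ut e]] h]|e].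
  rewrite e; congr Some; apply/eqP; rewrite eqn_leq ut /= ltnNge; apply/negP => ut'.
  by apply: h; exists u.
by split=> [|[u [ut]]]; [exists t.+1|rewrite e => -[]; lia].
Qed.

Definition tmin T w : nat := if sigma w is Some u then minn T u else T.

Lemma tmin_alive T w : alive T w -> tmin T w = T.
Proof.
rewrite /tmin /alive /=; case: (sigma w) => // u h.
have [uT|/ltnW/minn_idPl//] := leqP u T; by exfalso; apply: h; exists u.
Qed.

Lemma tmin_aliveS T w : alive T w -> tmin T.+1 w = T.+1.
Proof.
rewrite /tmin /alive /=; case: (sigma w) => // u h.
have [uT|uT] := leqP u T; first by exfalso; apply: h; exists u.
exact/minn_idPl.
Qed.

Lemma tmin_stopped T w u : (u <= T)%N -> sigma w = Some u -> tmin T w = u.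
Proof. by move=> uT e; rewrite /tmin e; exact/minn_idPr. Qed.

Lemma alive_or T w : alive T w \/ exists2 u, (u <= T)%N & sigma w = Some u.
Proof. by have [[u [? ?]]|] := pselect (exists u, (u <= T)%N /\ sigma w = Some u); [right; exists u|left]. Qed.

(** The index is [T] while the clock still runs and the stopping time afterwards; which case holds
    is known at time [T]. *)
Lemma F_tmin T (Q : nat -> Omega -> Prop) : (forall u, (u <= T)%N -> F T [set w | Q u w]) ->
  F T [set w | Q (tmin T w) w].
Proof.
move=> FQ.
apply: (sa_ext (A := [set w | (alive T w /\ Q T w) \/
    exists u, (u <= T)%N /\ (sigma w = Some u /\ Q u w)])).
  move=> w; split=> /= [[[h q]|[u [uT [e q]]]]|q].
  - by rewrite tmin_alive.
  - by rewrite (tmin_stopped uT e).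
  - case: (alive_or T w) => [h|[u uT e]]; first by left; rewrite tmin_alive in q.
    by right; exists u; split=> //; split=> //; rewrite (tmin_stopped uT e) in q.
apply: sa_or; first exact: F_sa.
  by apply: sa_and; [exact: F_sa|exact: F_alive|exact: FQ].
apply: sa_ex => [|u]; first exact: F_sa.
have [uT|uT] := leqP u T; last first.
  by apply: sa_ext (sa_const (F_sa T) False) => w; split=> // -[]; lia.
apply: (sa_ext (A := [set w | sigma w = Some u /\ Q u w])) => [w|].
  by split=> [|[]].
apply: sa_and; [exact: F_sa|exact: F_mono (F_stop u)|exact: FQ].
Qed.

Lemma F_stopped T z : F T [set w | stopped S sigma T w = z].
Proof. by apply: (F_tmin (Q := fun u w => S u w = z)) => u uT; exact: (F_S (fun x => x = z)). Qed.

Lemma stopped_meas T z : measurable [set w | stopped S sigma T w = z].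
Proof. exact: F_meas (F_stopped T z). Qed.

Lemma stopped_bound T w : good w -> `|stopped S sigma T w| <= T%:Z.
Proof.
move=> gw; have := S_bound (tmin T w) gw; rewrite /stopped -/(tmin T w) => h.
suff : (tmin T w <= T)%N by lia.
by rewrite /tmin; case: (sigma w) => // u; exact: geq_minl.
Qed.

Definition reached (n T : nat) : set Omega := [set w | n%:Z <= Smax S (tmin T w) w].

Lemma F_reached n T : F T (reached n T).
Proof.
by apply: (F_tmin (Q := fun u w => n%:Z <= Smax S u w)) => u uT;
  exact: (F_Smax (fun x => n%:Z <= x)).
Qed.

(** By [first_max] the walk stands exactly at [n] when the transform is switched on, so the gain
    since then is the present position minus [n]. *)
Lemma transform_reached (n T : nat) w : (0 < n)%N -> good w ->
  transform (fun t => [set w | n%:Z <= Smax S t w] `&` alive t) T w =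
  \1_(reached n T) w * (stopped S sigma T w - n%:Z)%:~R.
Proof.
move=> n0 gw; elim: T => [|T ih].
  rewrite transform0 indic0 ?mul0r// /reached /=.
  have -> : tmin 0 w = 0%N by rewrite /tmin; case: (sigma w) => // u; rewrite min0n.
  by rewrite Smax_0 S0; lia.
rewrite transformS// ih indicI /= /stopped -!/(tmin _ _).
case: (alive_or T w) => [h|[u uT e]]; last first.
  have na : ~ alive T w by apply; exists u.
  rewrite (indic0 na) mulr0 mul0r addr0.
  have e1 := tmin_stopped uT e; have e2 := tmin_stopped (leqW uT) e.
  rewrite e1 e2; congr (_ * _).
  by have [r|r] := pselect (n%:Z <= Smax S u w); [rewrite !indic1|rewrite !indic0];
    rewrite // /reached /= ?e1 ?e2.
have e1 := tmin_alive h; have e2 := tmin_aliveS h.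
rewrite (indic1 h) mulr1 e1 e2.
have [r|r] := pselect (n%:Z <= Smax S T w).
  have r' : n%:Z <= Smax S T.+1 w by exact: le_trans (Smax_mono _ _ (leqnSn T)).
  rewrite !indic1 /reached /= ?e1 ?e2// !mul1r -intrD; congr intmul; ring.
rewrite [\1_(reached n T) w]indic0 /reached /= ?e1//.
rewrite [\1_[set w | n%:Z <= Smax S T w] w]indic0// !mul0r add0r.
have [r'|r'] := pselect (n%:Z <= Smax S T.+1 w); last by rewrite indic0 ?mul0r//= e2.
rewrite indic1/= ?e2//.
have hl u : (u < T.+1)%N -> Smax S u w < n%:Z.
  move=> uT; apply: le_lt_trans (Smax_mono _ _ (uT : (u <= T)%N)) _.
  by rewrite ltNge; apply/negP.
by have [-> _] := first_max gw r' hl; rewrite subrr mulr0.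
Qed.

Lemma alive_anti s t : (s <= t)%N -> alive t `<=` alive s.
Proof. by move=> le_st w h [u [us e]]; apply: h; exists u; split=> //; lia. Qed.

Hypothesis fin : P [set w | sigma w <> None] = 1%E.

Lemma Pr_alive_cvg (e : R) : 0 < e -> exists T0, forall T, (T0 <= T)%N -> Pr P (alive T) <= e.
Proof.
move=> e0; have mA t : measurable (alive t) := F_meas (F_alive t).
have := Pr_cvg_down (P := P) mA alive_anti.
have -> : Pr P (\bigcap_n alive n) = 0.
  have -> : \bigcap_n alive n = ~` [set w | sigma w <> None].
    apply/seteqP; split=> [w h /=|w /= h t _ [u [_ eu]]]; last by apply: h; rewrite eu.
    case eu : (sigma w) => [u|]; last by apply.
    by exfalso; apply: (h u Logic.I); exists u.
  rewrite PrC ?/Pr ?fin ?subrr//.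
  have -> : [set w | sigma w <> None] = [set w | exists t, sigma w = Some t].
    apply/seteqP; split=> w /=; last by case=> t ->.
    by case: (sigma w) => // t _; exists t.
  by apply: (sa_ex (measurable_sa Omega)) => t; exact: F_meas (F_stop t).
move=> /cvgrPdist_le/(_ _ e0)[T0 _ h]; exists T0 => T /h /=.
by rewrite sub0r normrN ger0_norm// Pr_ge0.
Qed.

Variable mu : int -> R.
Hypothesis muM0 : isM0 mu.
Hypothesis law : forall z, P [set w | exists t, sigma w = Some t /\ S t w = z] = (mu z)%:E.

Lemma law_meas z : measurable [set w | exists t, sigma w = Some t /\ S t w = z].
Proof.
apply: (sa_ex (measurable_sa Omega)) => t; apply: (sa_and (measurable_sa Omega)).
  exact: F_meas (F_stop t).
exact: F_meas (F_S (fun x => x = z) (leqnn t)).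
Qed.

Lemma meas_stopped_dead T z : measurable ([set w | stopped S sigma T w = z] `&` ~` alive T).
Proof.
by apply: measurableI; [exact: stopped_meas|apply: measurableC; exact: F_meas (F_alive T)].
Qed.

Lemma Pr_stopped_dead T z : Pr P ([set w | stopped S sigma T w = z] `&` ~` alive T) <= mu z.
Proof.
have -> : mu z = Pr P [set w | exists t, sigma w = Some t /\ S t w = z] by rewrite /Pr law.
apply: le_Pr; [exact: meas_stopped_dead|exact: law_meas|].
move=> w [/= e na]; case: (alive_or T w) => [//|[u uT eu]]; exists u; split=> //.
by rewrite -e /stopped -/(tmin T w) (tmin_stopped uT eu).
Qed.

(** Paths stopped by time [T] carry at most the mass [mu z] at each [z], and [h] is nonnegative. *)
Lemma Ex_stopped_dead T h : lingrowth h ->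
  Ex P (trunc (stopped S sigma T) T h (~` alive T)) <= EX mu h.
Proof.
move=> lh; rewrite Ex_trunc; last exact: meas_stopped_dead.
apply: le_trans (sum_le_EX muM0 lh (rng_uniq T)).
by apply: ler_sum => z _; rewrite ler_wpM2l ?(lingrowth_ge0 z lh)// Pr_stopped_dead.
Qed.

Hypothesis UI : unif_integrable P (stopped S sigma).

(* Doob's maximal inequality with the payoff [max (S - b) 0] in place of [S]. *)
Lemma max_upper_bound (n : nat) (b : int) : (0 < n)%N -> b < n%:Z ->
  (n%:R - b%:~R) * Pr P [set w | exists t, sigma w = Some t /\ n%:Z <= Smax S t w]
    <= call mu b.
Proof.
move=> n0 bn; set A := [set w | exists t, _].
have nb : (0 : R) < n%:R - b%:~R by rewrite natr_intr subr_gt0 ltr_int.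
have mA : measurable A.
  apply: (sa_ex (measurable_sa Omega)) => t; apply: (sa_and (measurable_sa Omega)).
    exact: F_meas (F_stop t).
  exact: F_meas (F_Smax (fun x => n%:Z <= x) (leqnn t)).
apply/ler_addgt0Pr => e e0; have e2 : 0 < e / 2 by lra.
have [K0 hK0] := UI e2; pose K := Num.max K0 0.
(* [C] collects all coefficients of P(alive): [|b| + K] bounds the payoff of a live path with |S| <=
   K, and [n - b] pays for replacing the event at sigma by [reached n T]. *)
pose C := `|b|%:~R + K + (n%:R - b%:~R) : R.
have K_ge0 : 0 <= K by rewrite /K le_max lexx orbT.
have C0 : 0 < C by rewrite /C ltr_wpDl// addr_ge0// ler0z.
have eC : 0 < e / 2 / C by rewrite divr_gt0.
have [T0 /(_ T0 (leqnn _)) hT0] := Pr_alive_cvg eC.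
pose T := T0; rewrite -/T in hT0.
have mal : measurable (alive T) := F_meas (F_alive T).
have mre : measurable (reached n T) := F_meas (F_reached n T).
have h1 : Pr P A <= Pr P (reached n T) + Pr P (alive T).
  apply: le_trans (le_PrU _ mre mal); apply: le_Pr => //; first exact: measurableU.
  move=> w [t [e1 ht]]; case: (alive_or T w) => [|[u uT eu]]; [by right|left].
  by rewrite /reached /= (tmin_stopped uT eu); move: e1; rewrite eu => -[->].
pose a t := [set w | n%:Z <= Smax S t w] `&` alive t.
have Fa t : F t (a t).
  apply: (sa_and (F_sa t)); last exact: F_alive.
  exact: (F_Smax (fun x => n%:Z <= x) (leqnn t)).
pose hb (z : int) : R := Num.max (z - b)%:~R 0.
pose hK (z : int) : R := `|z%:~R| * (K0 < `|z%:~R : R|)%R%:R.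
have mdead z := meas_stopped_dead T z.
have mfull z : measurable ([set w | stopped S sigma T w = z] `&` setT).
  by rewrite setIT; exact: stopped_meas.
have bL : bm (fun w => (n%:R - b%:~R) * \1_(reached n T) w + transform a T w).
  apply: bmD; last exact: bm_transform.
  by apply: bmM; [exact: bm_cst|exact: bm_indic].
have b1 := bm_trunc T hb mdead; have b3 := bm_trunc T hK mfull.
have b2 : bm (fun w => (`|b|%:~R + K) * \1_(alive T) w).
  by apply: bmM; [exact: bm_cst|exact: bm_indic].
have b12 := bmD b1 b2.
have : Ex P (fun w => (n%:R - b%:~R) * \1_(reached n T) w + transform a T w) <=
    Ex P (fun w => trunc (stopped S sigma T) T hb (~` alive T) w
      + (`|b|%:~R + K) * \1_(alive T) w + trunc (stopped S sigma T) T hK setT w).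
  apply: (le_Ex good_meas P_good) => //; first exact: bmD.
  move=> w gw; have bX := stopped_bound T gw.
  rewrite transform_reached// !truncE// indicT mulr1.
  set x := stopped S sigma T w.
  (* On [reached] the two terms add up to x - b, and elsewhere to 0; either way the positive part
     dominates. *)
  have hbx : (n%:R - b%:~R) * \1_(reached n T) w + \1_(reached n T) w * (x - n%:Z)%:~R <= hb x.
    have [r|r] := pselect (reached n T w).
      by rewrite indic1// mulr1 mul1r /hb intrB -natr_intr le_max intrB; apply/orP; left; lra.
    by rewrite indic0// mulr0 mul0r addr0 /hb le_max lexx orbT.
  apply: le_trans hbx _.
  have hK_ge0 : 0 <= hK x by rewrite /hK mulr_ge0// ler0n.
  have [al|nal] := pselect (alive T w); last first.
    by rewrite (indic0 nal) mulr0 addr0 indic1 ?mulr1//; lra.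
  (* Live paths have no law yet: their payoff is split at |x| = K0, where uniform integrability
     controls the upper part. *)
  rewrite (indic1 al) mulr1 [\1_(~` _) w]indic0 ?mulr0 ?add0r//.
  have hx : hb x <= `|x|%:~R + `|b|%:~R.
    exact: call_le_norm.
  apply: le_trans hx _; rewrite /hK -intr_norm.
  have [kx|kx] := ltP K0 (`|x|%:~R : R); first by rewrite mulr1; lra.
  by rewrite mulr0 addr0 addrC lerD2l /K le_max kx.
have bR : bm (fun w => (n%:R - b%:~R) * (\1_(reached n T) w : R)).
  by apply: bmM; [exact: bm_cst|exact: bm_indic].
rewrite (ExD P bR (bm_transform Fa T)) (ExD P b12 b3) (ExD P b1 b2) Ex_transform// addr0.
rewrite (ExZ P _ (bm_indic mre)) (ExZ P _ (bm_indic mal)) !Ex_indic//.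
have i1 : Ex P (trunc (stopped S sigma T) T hb (~` alive T)) <= call mu b.
  exact/Ex_stopped_dead/lingrowth_call.
have i3 : Ex P (trunc (stopped S sigma T) T hK setT) <= e / 2.
  rewrite -lee_fin -(tail_integralE _ (stopped_meas T) (stopped_bound T)).
  exact: hK0.
move=> h2.
have h3 : C * Pr P (alive T) <= e / 2 by rewrite mulrC -ler_pdivlMr.
have h4 : (n%:R - b%:~R) * Pr P A <= (n%:R - b%:~R) * (Pr P (reached n T) + Pr P (alive T)).
  by rewrite ler_wpM2l// ltW.
move: h3; rewrite /C; lra.
Qed.

End Stopping.

End Walk.
(** * The Azema-Yor stopping time *)

Section PiLambda.
Context {R : realType} {d : measure_display} {Omega : measurableType d}.
Variable P : probability Omega R.

Lemma PrD (A C : set Omega) : measurable A -> measurable C -> C `<=` A ->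
  Pr P (A `\` C) = Pr P A - Pr P C.
Proof.
move=> mA mC CA; have mD : measurable (A `\` C) by exact: measurableD.
suff -> : Pr P A = Pr P (A `\` C) + Pr P C by ring.
rewrite -PrU//; first by congr Pr; rewrite setUC setDUK.
by apply/seteqP; split=> // w [[]].
Qed.

(** The events independent of [B] form a lambda system, monotone unions being handled by continuity
    from below. *)
Lemma indep_pi_lambda (G : set (set Omega)) (B : set Omega) :
  setI_closed G -> G `<=` measurable -> measurable B ->
  (forall A, G A -> Pr P (A `&` B) = Pr P A * Pr P B) ->
  forall A, smallest (sigma_algebra setT) G A ->
    measurable A /\ Pr P (A `&` B) = Pr P A * Pr P B.
Proof.
move=> GI Gm mB GB.
pose H := [set A | measurable A /\ Pr P (A `&` B) = Pr P A * Pr P B].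
suff lH : lambda_system setT H.
  have := @lambda_system_subset _ G GI setT H lH; apply=> //.
  by move=> A GA; split; [exact: Gm|exact: GB].
split=> //.
- split=> //; rewrite setTI; have -> : Pr P setT = 1 by rewrite /Pr probability_setT.
  by rewrite mul1r.
- move=> A C CA [mA eA] [mC eC]; split; first exact: measurableD.
  have -> : (A `\` C) `&` B = (A `&` B) `\` (C `&` B).
    apply/seteqP; split=> [w [[Aw Cw] Bw]|w [[Aw Bw] h]].
      by split=> // -[].
    by split=> //; split=> // Cw; apply: h.
  rewrite !PrD//; [by rewrite eA eC; ring|exact: measurableI|exact: measurableI|].
  by move=> w [? ?]; split=> //; exact: CA.
- move=> A ndA HA; have mA n : measurable (A n) by case: (HA n).
  have mU : measurable (\bigcup_n A n) by exact: bigcup_measurable.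
  split=> //; have ndA' m n : (m <= n)%N -> A m `<=` A n.
    by move=> mn; have /subsetPset := ndA _ _ mn.
  have h1 := Pr_cvg_up (P := P) mA ndA'.
  have h2 : Pr P \o (fun n => A n `&` B) @ \oo --> Pr P (\bigcup_n (A n `&` B)).
    apply: Pr_cvg_up => [n|m n mn w [? ?]]; first exact: measurableI.
    by split=> //; exact: (ndA' _ _ mn).
  rewrite setI_bigcupl.
  have h3 : Pr P \o (fun n => A n `&` B) @ \oo --> Pr P (\bigcup_n A n) * Pr P B.
    have -> : Pr P \o (fun n => A n `&` B) = (fun n => Pr P (A n) * Pr P B).
      by apply/funext => n /=; case: (HA n).
    by apply: cvgM => //; exact: cvg_cst.
  exact: (cvg_unique _ h2 h3).
Qed.

End PiLambda.

(** * Independence of the walk and the coins *)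

Section AzemaYor.
Context {R : realType} {d : measure_display} {Omega : measurableType d}.
Variables (mu : int -> R) (P : probability Omega R).
Variables (S : nat -> Omega -> int) (eta : nat -> nat -> Omega -> bool).
Hypothesis muM0 : isM0 mu.
Hypothesis hS : is_srw_wrt P (natF S) S.
Hypothesis meta : forall n k b, measurable [set w | eta n k w = b].
Hypothesis Peta : forall n k, valid mu n k -> P [set w | eta n k w = false] = (rho mu n k)%:E.
Hypothesis indep :
  forall (T : nat) (s : nat -> int) (J : seq (nat * nat)) (bv : nat -> nat -> bool),
     uniq J -> (forall j, j \in J -> valid mu j.1 j.2) ->
     P ([set w | forall u, (u <= T)%N -> S u w = s u] `&`
        [set w | forall j, j \in J -> eta j.1 j.2 w = bv j.1 j.2]) =
     (P [set w | forall u, (u <= T)%N -> S u w = s u] *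
      \prod_(j <- J) P [set w | eta j.1 j.2 w = bv j.1 j.2])%E.

Definition pathc (T : nat) (s : nat -> int) : set Omega :=
  [set w | forall u, (u <= T)%N -> S u w = s u].
Definition etac (J : seq (nat * nat)) (bv : nat -> nat -> bool) : set Omega :=
  [set w | forall j, j \in J -> eta j.1 j.2 w = bv j.1 j.2].

(** A whole path up to [T] together with finitely many coins selected by [pr]; the empty set is
    added so that incompatible prescriptions do not spoil closure under intersection. *)
Definition cylinder (pr : nat * nat -> Prop) (T : nat) : set (set Omega) :=
  [set A | A = set0 \/ exists s J bv,
    [/\ uniq J, forall j, j \in J -> valid mu j.1 j.2 /\ pr j & A = pathc T s `&` etac J bv]].

(* The coins selected by [pr] are revealed from time 0 on: this keeps [S] a random
   walk, and it shows that events which use only coins of levels below [n] are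
   independent of the coins of level [n]. *)
Definition GG (pr : nat * nat -> Prop) (T : nat) : set (set Omega) :=
  smallest (sigma_algebra setT) (cylinder pr T).

Lemma GG_sa pr T : sigma_algebra setT (GG pr T).
Proof. exact: smallest_sigma_algebra. Qed.

Lemma natF_pathc T s : natF S T (pathc T s).
Proof.
apply: sa_all => [|u]; first exact: (F_sa hS T).
apply: sa_imp => [|uT]; first exact: (F_sa hS T).
exact: (F_S hS (fun x => x = s u)).
Qed.

Lemma pathc_meas T s : measurable (pathc T s).
Proof. exact: (F_meas hS (@natF_pathc T s)). Qed.

Lemma etac_meas J bv : measurable (etac J bv).
Proof.
apply: (sa_all (measurable_sa Omega)) => j.
by apply: (sa_imp (measurable_sa Omega)) => _; exact: meta.
Qed.

Lemma cylinder_meas pr T : cylinder pr T `<=` measurable.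
Proof.
move=> A [->//|[s [J [bv [_ _ ->]]]]].
by apply: measurableI; [exact: pathc_meas|exact: etac_meas].
Qed.

Lemma cylinder_setI pr T : setI_closed (cylinder pr T).
Proof.
move=> A B [->|[s [J [bv [uJ vJ ->]]]]]; first by rewrite set0I; left.
move=> [->|[s' [J' [bv' [uJ' vJ' ->]]]]]; first by rewrite setI0; left.
have [hs|hs] := pselect (forall u, (u <= T)%N -> s u = s' u); last first.
  left; apply/seteqP; split=> // w [[h1 _] [h2 _]]; apply: hs => u uT.
  by rewrite -h1// -h2.
have [hb|hb] := pselect (forall j, j \in J -> j \in J' -> bv j.1 j.2 = bv' j.1 j.2); last first.
  left; apply/seteqP; split=> // w [[_ h1] [_ h2]]; apply: hb => j jJ jJ'.
  by rewrite -h1// -h2.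
(* Compatible prescriptions merge: the first decides on [J], the second on the rest. *)
right; exists s, (undup (J ++ J')), (fun n k => if (n, k) \in J then bv n k else bv' n k).
split; first exact: undup_uniq.
  by move=> j; rewrite mem_undup mem_cat => /orP[/vJ|/vJ'].
apply/seteqP; split=> [w [[h1 h2] [_ h4]]|w [h1 h2]].
  split=> // -[n k]; rewrite mem_undup mem_cat /=.
  by case: ifPn => [hJ _|_ /= hJ]; [exact: (h2 (n, k))|exact: (h4 (n, k))].
split; split=> //.
- by move=> [n k] hJ; have := h2 (n, k); rewrite mem_undup mem_cat hJ /=; apply.
- by move=> u uT; rewrite h1// hs.
- move=> [n k] hJ'; have := h2 (n, k); rewrite mem_undup mem_cat hJ' orbT /= => -> //.
  by case: ifPn => // hJ; exact: (hb (n, k)).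
Qed.

Lemma GG_meas pr T A : GG pr T A -> measurable A.
Proof.
by apply: smallest_sub; [exact: measurable_sa|exact: cylinder_meas].
Qed.

Lemma GG_S pr T u z : (u <= T)%N -> GG pr T [set w | S u w = z].
Proof.
(* Paths are coded by finite lists of integers, a countable type, so the event is a countable union
   of cylinders. *)
move=> uT; apply: (sa_ext (F := GG pr T) (A := [set w | exists l : seq int,
    nth 0 l u = z /\ pathc T (nth 0 l) w])).
  move=> w; split=> /= [[l [<- ->//]]|e].
  exists (mkseq (fun v => S v w) T.+1); split; first by rewrite nth_mkseq.
  by move=> v vT; rewrite nth_mkseq.
apply: (sa_ex (GG_sa _ _)) => l.
apply: (sa_and (GG_sa _ _)); first exact: (sa_const (GG_sa _ _)).
apply: sub_sigma_algebra; right; exists (nth 0 l), [::], (fun _ _ => true).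
by split=> //; apply/seteqP; split=> [w h|w []//]; split.
Qed.

Lemma GG_eta pr T n k b : valid mu n k -> pr (n, k) -> GG pr T [set w | eta n k w = b].
Proof.
move=> hv hp; apply: (sa_ext (F := GG pr T) (A := [set w | exists l : seq int,
    pathc T (nth 0 l) w /\ etac [:: (n, k)] (fun _ _ => b) w])).
  move=> w; split=> /= [[l [_ /(_ (n, k))]]|e].
    by rewrite inE eqxx; apply.
  exists (mkseq (fun v => S v w) T.+1); split.
    by move=> v vT; rewrite nth_mkseq.
  by move=> j; rewrite inE => /eqP ->.
apply: (sa_ex (GG_sa _ _)) => l.
apply: sub_sigma_algebra; right; exists (nth 0 l), [:: (n, k)], (fun _ _ => b).
by split=> // j; rewrite inE => /eqP ->.
Qed.

Lemma GG_sub pr pr' T T' A : (forall j, pr j -> pr' j) -> (T <= T')%N ->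
  GG pr T A -> GG pr' T' A.
Proof.
move=> hp TT; apply: smallest_sub; first exact: GG_sa.
move=> B [->|[s [J [bv [_ vJ ->]]]]]; first by case: (GG_sa pr' T').
apply: (sa_and (GG_sa _ _)).
  apply: (sa_all (GG_sa _ _)) => u.
  apply: (sa_imp (GG_sa _ _)) => uT.
  by apply: GG_S; lia.
apply: (sa_all (GG_sa _ _)) => -[n k].
apply: (sa_imp (GG_sa _ _)) => hJ.
by have [? ?] := vJ _ hJ; apply: GG_eta => //; exact: hp.
Qed.

Lemma Pr_cyl T s J bv : uniq J -> (forall j, j \in J -> valid mu j.1 j.2) ->
  Pr P (pathc T s `&` etac J bv) =
  Pr P (pathc T s) * \prod_(j <- J) Pr P [set w | eta j.1 j.2 w = bv j.1 j.2].
Proof.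
move=> uJ vJ; apply: EFin_inj; rewrite -PrE; last first.
  by apply: measurableI; [exact: pathc_meas|exact: etac_meas].
rewrite indep// EFinM -prodEFin -PrE; last exact: pathc_meas.
by congr (_ * _)%E; apply: eq_bigr => j _; rewrite -PrE.
Qed.

Lemma Pr_etac J bv : uniq J -> (forall j, j \in J -> valid mu j.1 j.2) ->
  Pr P (etac J bv) = \prod_(j <- J) Pr P [set w | eta j.1 j.2 w = bv j.1 j.2].
Proof.
move=> uJ vJ.
have eT : pathc 0 (fun=> 0) = setT.
  by apply/seteqP; split=> // w _ u; rewrite leqn0 => /eqP ->; exact: (S0 hS).
have := @Pr_cyl 0 (fun=> 0) J bv uJ vJ; rewrite eT setTI.
have -> : Pr P setT = 1 by rewrite /Pr probability_setT.
by rewrite mul1r.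
Qed.

(** A cylinder over [pr] and a pattern of coins outside [pr] involve disjoint index sets, so
    together they form one cylinder to which the product formula applies. *)
Lemma GG_indep_eta pr T A J bv : GG pr T A -> uniq J ->
  (forall j, j \in J -> valid mu j.1 j.2) -> (forall j, j \in J -> ~ pr j) ->
  Pr P (A `&` etac J bv) = Pr P A * Pr P (etac J bv).
Proof.
move=> GA uJ vJ nJ.
suff [_ ->//] : measurable A /\ Pr P (A `&` etac J bv) = Pr P A * Pr P (etac J bv).
apply: (indep_pi_lambda (cylinder_setI (pr := pr) (T := T))
  (cylinder_meas (pr := pr) (T := T)) (etac_meas J bv) _ GA).
move=> B [->|[s [J' [bv' [uJ' vJ' ->]]]]]; first by rewrite set0I /Pr measure0 mul0r.
have disj j : j \in J -> j \notin J'.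
  by move=> /nJ hj; apply/negP => /vJ'[].
pose bw n k := if (n, k) \in J' then bv' n k else bv n k.
have -> : pathc T s `&` etac J' bv' `&` etac J bv = pathc T s `&` etac (J' ++ J) bw.
  apply/seteqP; split=> [w [[h1 h2] h3]|w [h1 h2]].
    split=> // -[n k]; rewrite mem_cat /bw /=; case: ifPn => [h _|h /= hJ].
      exact: (h2 (n, k)).
    exact: (h3 (n, k)).
  split; first split=> //.
    by move=> [n k] h; have := h2 (n, k); rewrite mem_cat h /bw /= h; apply.
  move=> [n k] h; have := h2 (n, k); rewrite mem_cat h orbT /bw /= (negbTE (disj _ h)).
  by apply.
rewrite Pr_cyl; first last.
- by move=> j; rewrite mem_cat => /orP[/vJ'[]|/vJ].
- rewrite cat_uniq uJ' uJ andbT /=; apply/hasPn => j /disj //.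
rewrite Pr_cyl//; last by move=> j /vJ'[].
rewrite Pr_etac// big_cat /= mulrA; congr (_ * _ * _).
  by apply: eq_big_seq => -[n k] h; rewrite /bw /= h.
by apply: eq_big_seq => -[n k] h; rewrite /bw /= (negbTE (disj _ h)).
Qed.

Lemma Pr_pathc_step T s c : c = 1 \/ c = -1 ->
  Pr P (pathc T s `&` [set w | S T.+1 w - S T w = c]) = Pr P (pathc T s) / 2.
Proof.
by case=> ->; [exact: (Pr_up hS (@natF_pathc T s))|exact: (Pr_down hS (@natF_pathc T s))].
Qed.

(** Prescribing one more step turns a path cylinder up to [T] into one up to [T + 1], so the product
    formula separates the coins before and after the step is added. *)
Lemma GG_step pr T A c : GG pr T A -> c = 1 \/ c = -1 ->
  Pr P (A `&` [set w | S T.+1 w - S T w = c]) = Pr P A / 2.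
Proof.
move=> GA hc; set B := [set w | _].
have mB : measurable B by exact: (F_meas hS (F_inc hS T (fun x => x = c))).
have PB : Pr P B = 1 / 2.
  have nT : natF S T setT by apply: sa_ext (sa_const (F_sa hS T) True) => w; split.
  have : Pr P (setT `&` B) = Pr P setT / 2.
    by case: hc => e; rewrite /B e; [exact: (Pr_up hS nT)|exact: (Pr_down hS nT)].
  by rewrite setTI => ->; rewrite /Pr probability_setT.
suff [_ ->] : measurable A /\ Pr P (A `&` B) = Pr P A * Pr P B by rewrite PB; lra.
apply: (indep_pi_lambda (cylinder_setI (pr := pr) (T := T)) (cylinder_meas (pr := pr) (T := T)) mB _ GA).
move=> C [->|[s [J [bv [uJ vJ ->]]]]]; first by rewrite set0I /Pr measure0 mul0r.
have vJ' j : j \in J -> valid mu j.1 j.2 by move=> /vJ[].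
pose s' u := if (u <= T)%N then s u else s T + c.
have e : pathc T s `&` B = pathc T.+1 s'.
  apply/seteqP; split=> [w [h1 h2] u|w h].
    rewrite leq_eqVlt /s' => /predU1P[->|uT].
      by rewrite ltnn -(h1 T)// -h2; ring.
    by rewrite -ltnS uT h1.
  split=> [u uT|]; first by rewrite h ?/s' ?uT//; exact: leqW.
  by rewrite /B /= (h T.+1)// (h T)// /s' ltnn leqnn; ring.
rewrite setIAC e Pr_cyl// -e Pr_pathc_step// Pr_cyl// PB; ring.
Qed.

Definition allj : nat * nat -> Prop := fun=> True.

Lemma GG_srw : is_srw_wrt P (GG allj) S.
Proof.
have [_ _ S00 hinc] := hS; split=> //.
- move=> t; split; first exact: GG_sa.
    by move=> A; exact: GG_meas.
  by move=> A; apply: GG_sub.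
- by move=> t z; exact: GG_S.
- move=> t; have [h1 h2 _] := hinc t; split=> // A B GA.
  have mA := GG_meas GA.
  have mB : measurable [set w | B (S t.+1 w - S t w)].
    exact: (F_meas hS (F_inc hS t B)).
  (* An arbitrary condition on the increment reduces, almost surely, to its truth values at 1 and
     -1. *)
  have key C : measurable C -> Pr P (C `&` [set w | B (S t.+1 w - S t w)]) =
      `[< B 1 >]%:R * Pr P (C `&` stepup S t) + `[< B (-1) >]%:R * Pr P (C `&` stepdown S t).
    move=> mC.
    have mu1 : measurable (C `&` stepup S t) by apply: measurableI => //; exact: (up_meas hS).
    have md1 : measurable (C `&` stepdown S t) by apply: measurableI => //; exact: (down_meas hS).
    have mCB : measurable (C `&` [set w | B (S t.+1 w - S t w)]) by exact: measurableI.
    rewrite -!Ex_indic// -!ExZ; [|exact: bm_indic..].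
    rewrite -ExD; [|apply: bmM; [exact: bm_cst|exact: bm_indic]..].
    apply: (eq_Ex (good_meas hS) (P_good hS)); first exact: bm_indic.
      by apply: bmD; apply: bmM; [exact: bm_cst|exact: bm_indic|exact: bm_cst|exact: bm_indic].
    move=> w gw; rewrite !indicI /=.
    have [Cw|Cw] := pselect (C w); last by rewrite (indic0 Cw) !mul0r !mulr0 addr0.
    rewrite (indic1 Cw) !mul1r; case: (gw t) => e.
      rewrite [\1_(stepup S t) w]indic1// [\1_(stepdown S t) w]indic0 ?/stepdown /= ?e// mulr1 mulr0 addr0.
      by case: asboolP => hB; [rewrite indic1|rewrite indic0]; rewrite //= e.
    rewrite [\1_(stepdown S t) w]indic1// [\1_(stepup S t) w]indic0 ?/stepup /= ?e// mulr1 mulr0 add0r.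
    by case: asboolP => hB; [rewrite indic1|rewrite indic0]; rewrite //= e.
  rewrite !PrE//; last exact: measurableI.
  rewrite -EFinM; congr EFin; rewrite key//.
  have := key setT (@measurableT _ _); rewrite !setTI => ->.
  rewrite (GG_step GA (or_introl erefl)) (GG_step GA (or_intror erefl)).
  have -> : Pr P (stepup S t) = 1 / 2 by rewrite /Pr h1.
  have -> : Pr P (stepdown S t) = 1 / 2 by rewrite /Pr h2.
  ring.
Qed.

(** * The stopping rule *)

(** Both clauses in one predicate: tau, a minimum of two first times, becomes the first time of a
    single condition. *)
Definition stopnow (t : nat) (w : Omega) : Prop :=
  (exists k, let n := `|Smax S t w|%N in
     [/\ valid mu n k, S t w <= xnk mu n k & eta n k w = false]) \/
  (0 < mu (S t w) /\ forall z, 0 < mu z -> z <= S t w).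

Lemma first_timeP (Q : nat -> Prop) :
  match first_time Q with
  | Some t => Q t /\ forall u, (u < t)%N -> ~ Q u
  | None => forall t, ~ Q t
  end.
Proof.
have [[t Qt]|nQ] := pselect (exists t, Q t); last first.
  have h : forall t, ~ Q t by move=> t Qt; apply: nQ; exists t.
  by rewrite /first_time; case: xgetP => [[t|] _ ?//|/(_ None)].
have hex : exists t, `[< Q t >] by exists t; exact/asboolP.
case: (ex_minnP hex) => m /asboolP Qm mmin.
have hm : Q m /\ forall u, (u < m)%N -> ~ Q u.
  by split=> // u um Qu; have := mmin u (asboolT Qu); lia.
by rewrite /first_time; case: xgetP => [[?|] _ ?//|/(_ (Some m))].
Qed.

Hypothesis xbar_pos : below_xbar mu 0.

Lemma mu_not_delta : mu <> (fun z : int => if z == 0 then 1 else 0).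
Proof. by case: xbar_pos => z [z0]; move=> /[swap] ->; case: eqP z0 => [->|_ _]; rewrite ltxx. Qed.

Notation tau := (tauAY mu S eta).

Lemma tau_spec w :
  match tau w with
  | Some t => stopnow t w /\ forall u, (u < t)%N -> ~ stopnow u w
  | None => forall t, ~ stopnow t w
  end.
Proof.
rewrite /tauAY asboolF; last exact: mu_not_delta.
set Q1 := (X in first_time X); set Q2 := (X in omin _ (first_time X)).
have := first_timeP Q1; have := first_timeP Q2.
case: (first_time Q1) => [t1|]; case: (first_time Q2) => [t2|] /=.
- move=> [q2 h2] [q1 h1]; case: (leqP t1 t2) => t12.
    split; first by left.
    by move=> u ut [q|q]; [exact: (h1 u)|apply: (h2 u) => //; lia].
  split; first by right.
  by move=> u ut [q|q]; [apply: (h1 u) => //; lia|exact: (h2 u)].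
- move=> h2 [q1 h1]; split; first by left.
  by move=> u ut [q|q]; [exact: (h1 u)|exact: (h2 u)].
- move=> [q2 h2] h1; split; first by right.
  by move=> u ut [q|q]; [exact: (h1 u)|exact: (h2 u)].
- by move=> h2 h1 u [q|q]; [exact: (h1 u)|exact: (h2 u)].
Qed.

Lemma tau_SomeP t w : tau w = Some t <-> stopnow t w /\ forall u, (u < t)%N -> ~ stopnow u w.
Proof.
have := tau_spec w; case: (tau w) => [t'|] h; split=> //.
- by move=> [<-].
- move=> [q hq]; case: h => q' hq'; congr Some; case: (ltngtP t t') => // tt.
    by exfalso; exact: (hq' t).
  by exfalso; exact: (hq t').
- by move=> [/h].
Qed.

Lemma tau_leP t w : (exists u, (u <= t)%N /\ tau w = Some u) <-> exists u, (u <= t)%N /\ stopnow u w.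
Proof.
split=> [[u [ut /tau_SomeP[q _]]]|[u [ut q]]]; first by exists u.
have := tau_spec w; case e : (tau w) => [v|]; last by move=> /(_ u).
move=> [_ hv]; exists v; split=> //; rewrite leqNgt; apply/negP => tv.
by apply: (hv u) => //; lia.
Qed.

Lemma abszSmax t w : (`|Smax S t w|%N)%:Z = Smax S t w.
Proof. by have := Smax_ge0 hS t w; lia. Qed.

(** The random level is replaced by a quantified [n] equal to the maximum, which splits the event
    into countably many pieces with deterministic coin indices. *)
Lemma stopnowE t w : stopnow t w <->
  (exists n, exists k, valid mu n k /\
     (S t w <= xnk mu n k /\ (Smax S t w = n%:Z /\ eta n k w = false))) \/
  (0 < mu (S t w) /\ forall z, 0 < mu z -> z <= S t w).
Proof.
split=> [[[k [v s e]]|h]|[[n [k [v [s [m e]]]]]|h]]; try by right.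
  by left; exists `|Smax S t w|%N, k; rewrite abszSmax.
by left; exists k; have -> : `|Smax S t w|%N = n by lia.
Qed.

(** One argument serves two filtrations: the natural one of the theorem, and the one with all coins
    revealed, in which optional stopping at tau is carried out. *)
Lemma tau_stopping (F : nat -> set (set Omega)) : (forall t, sigma_algebra setT (F t)) ->
  (forall t u z, (u <= t)%N -> F t [set w | S u w = z]) ->
  (forall t u n k b, (u <= t)%N -> valid mu n k ->
     F t [set w | Smax S u w = n%:Z /\ eta n k w = b]) ->
  stopping_time F tau.
Proof.
move=> sF FS Fe t; apply: (sa_ext (A := [set w | exists u, (u <= t)%N /\ stopnow u w])).
  by move=> w; split=> /tau_leP.
apply: (sa_ex (sF t)) => u; have [ut|ut] := leqP u t; last first.
  by apply: sa_ext (sa_const (sF t) False) => w; split=> // -[].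
have FSB (B : int -> Prop) : F t [set w | B (S u w)].
  apply: (sa_ext (A := [set w | exists z, B z /\ S u w = z])).
    by move=> w; split=> /= [[z [Bz ->]]|Bw]; [|exists (S u w)].
  apply: (sa_ex (sF t)) => z; apply: (sa_and (sF t)); first exact: (sa_const (sF t)).
  exact: FS.
apply: (sa_ext (A := [set w |
  (exists n, exists k, valid mu n k /\
     (S u w <= xnk mu n k /\ (Smax S u w = n%:Z /\ eta n k w = false))) \/
  (0 < mu (S u w) /\ forall z, 0 < mu z -> z <= S u w)])).
  by move=> w; split=> /= [/stopnowE|[_ /stopnowE]].
apply: (sa_or (sF t)); last exact: (FSB (fun x => 0 < mu x /\ forall z, 0 < mu z -> z <= x)).
apply: (sa_ex (sF t)) => n; apply: (sa_ex (sF t)) => k.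
have [v|v] := pselect (valid mu n k); last first.
  by apply: sa_ext (sa_const (sF t) False) => w; split=> // -[].
apply: (sa_ext (A := [set w | S u w <= xnk mu n k /\ (Smax S u w = n%:Z /\ eta n k w = false)])).
  by move=> w; split=> [|[]].
apply: (sa_and (sF t)); first exact: (FSB (fun x => x <= xnk mu n k)).
exact: Fe.
Qed.

Lemma natF_GG pr T A : natF S T A -> GG pr T A.
Proof.
apply: smallest_sub; first exact: GG_sa.
by move=> B [u [z [uT ->]]]; exact: GG_S.
Qed.

Lemma GG_Smax pr T u (B : int -> Prop) : (u <= T)%N -> GG pr T [set w | B (Smax S u w)].
Proof. by move=> uT; apply: natF_GG; exact: (F_Smax hS). Qed.

Lemma GG_SB pr T u (B : int -> Prop) : (u <= T)%N -> GG pr T [set w | B (S u w)].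
Proof. by move=> uT; apply: natF_GG; exact: (F_S hS). Qed.

Lemma tau_stopping_GG : stopping_time (GG allj) tau.
Proof.
apply: tau_stopping => [t|t u z ut|t u n k b ut v]; [exact: GG_sa|exact: GG_S|].
apply: (sa_and (GG_sa _ _)); last exact: GG_eta.
exact: (GG_Smax (fun x => x = n%:Z)).
Qed.

Lemma tau_stopping_natF : stopping_time (natF_eta mu S eta) tau.
Proof.
apply: tau_stopping => [t|t u z ut|t u n k b ut v].
- exact: smallest_sigma_algebra.
- by apply: sub_sigma_algebra; left; exists u, z.
- by apply: sub_sigma_algebra; right; exists u, n, k, b.
Qed.

(* [arrive n T]: the running maximum reaches [n] by time [T], before [tau] stops. *)
Definition arrive (n T : nat) : set Omega :=
  [set w | exists t, (t <= T)%N /\ (n%:Z <= Smax S t w /\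
    forall u, (u < t)%N -> Smax S u w < n%:Z /\ ~ stopnow u w)].

Definition dip (n : nat) (x : int) (T : nat) : set Omega :=
  [set w | exists u, (u <= T)%N /\ (Smax S u w = n%:Z /\ S u w <= x)].

Definition ltlev (n : nat) : nat * nat -> Prop := fun j => (j.1 < n)%N.

(** Whether the walk was stopped before its maximum reached [n] depends on coins of lower levels
    only; this makes the coins of level [n] fresh on arrival. *)
Lemma GG_arrive n T : GG (ltlev n) T (arrive n T).
Proof.
have sG := GG_sa (ltlev n) T.
apply: (sa_ex sG) => t; have [tT|tT] := leqP t T; last first.
  by apply: sa_ext (sa_const sG False) => w; split=> // -[].
apply: (sa_and sG); first exact: (sa_const sG).
apply: (sa_and sG); first exact: (GG_Smax (fun x => n%:Z <= x)).
apply: (sa_all sG) => u; apply: (sa_imp sG) => ut.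
have uT : (u <= T)%N by lia.
(* Repeating the bound on the maximum inside the negation restricts the coins that occur to levels
   below [n]. *)
apply: (sa_ext (F := GG (ltlev n) T) (A := [set w | Smax S u w < n%:Z /\ ~ (Smax S u w < n%:Z /\ stopnow u w)])).
  move=> w; split=> /= [[h1 h2]|[h1 h2]]; split=> //.
    by move=> q; apply: h2.
  by case.
have Fs : GG (ltlev n) T [set w | Smax S u w < n%:Z].
  exact: (GG_Smax (fun x => x < n%:Z)).
apply: (sa_and sG) => //; apply: (sa_not sG).
apply: (sa_ext (F := GG (ltlev n) T) (A := [set w |
  (exists m, exists k, (m < n)%N /\ (valid mu m k /\
     (S u w <= xnk mu m k /\ (Smax S u w = m%:Z /\ eta m k w = false)))) \/
  (Smax S u w < n%:Z /\ (0 < mu (S u w) /\ forall z, 0 < mu z -> z <= S u w))])).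
  move=> w; split=> /= [[[m [k [mn h]]]|[h1 h2]]|[h1 /stopnowE[[m [k h]]|h]]].
  - split; last by apply/stopnowE; left; exists m, k.
    by case: h => _ [_ [-> _]].
  - by split=> //; apply/stopnowE; right.
  - left; exists m, k; split=> //.
    by case: h => _ [_ [e _]]; move: h1; rewrite e.
  - by right.
apply: (sa_or sG); last first.
  apply: (sa_and sG) => //.
  exact: (GG_SB (fun x => 0 < mu x /\ forall z, 0 < mu z -> z <= x)).
apply: (sa_ex sG) => m; apply: (sa_ex sG) => k.
have [mn|mn] := ltnP m n; last first.
  by apply: sa_ext (sa_const sG False) => w; split=> // -[].
apply: (sa_and sG); first exact: (sa_const sG).
have [v|v] := pselect (valid mu m k); last first.
  by apply: sa_ext (sa_const sG False) => w; split=> // -[].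
apply: (sa_and sG); first exact: (sa_const sG).
apply: (sa_and sG); first exact: (GG_SB (fun x => x <= xnk mu m k)).
apply: (sa_and sG); first exact: (GG_Smax (fun x => x = m%:Z)).
exact: GG_eta.
Qed.

Lemma natF_dip n x T : natF S T (dip n x T).
Proof.
have sG := F_sa hS T.
apply: (sa_ex sG) => u; have [uT|uT] := leqP u T; last first.
  by apply: sa_ext (sa_const sG False) => w; split=> // -[].
apply: (sa_and sG); first exact: (sa_const sG).
apply: (sa_and sG); first exact: (F_Smax hS (fun x => x = n%:Z)).
exact: (F_S hS (fun y => y <= x)).
Qed.

Lemma arrive_le n s t : (s <= t)%N -> arrive n s `<=` arrive n t.
Proof. by move=> st w [u [us h]]; exists u; split=> //; lia. Qed.

Lemma dip_le n x s t : (s <= t)%N -> dip n x s `<=` dip n x t.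
Proof. by move=> st w [u [us h]]; exists u; split=> //; lia. Qed.

Lemma arrive_max n T w : arrive n T w -> n%:Z <= Smax S T w.
Proof. by move=> [t [tT [h _]]]; exact: le_trans h (Smax_mono _ _ tT). Qed.

Lemma arriveS n T w : good S w -> arrive n T.+1 w -> arrive n T w \/
  [/\ S T.+1 w = n%:Z, Smax S T.+1 w = n%:Z & forall u, (u <= T)%N -> Smax S u w < n%:Z].
Proof.
move=> gw [t [tT [h1 h2]]]; move: tT; rewrite leq_eqVlt => /predU1P[e|tT]; last first.
  by left; exists t.
right; move: h1 h2; rewrite e => h1 h2.
have hl u : (u < T.+1)%N -> Smax S u w < n%:Z by move=> /h2[].
by have [? ?] := first_max hS gw h1 hl.
Qed.

Definition between (n : nat) (x : int) (T : nat) : set Omega :=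
  arrive n T `&` ([set w | Smax S T w < n%:Z + 1] `&` ~` dip n x T).

Lemma GG_between n x T : GG allj T (between n x T).
Proof.
have sG := GG_sa allj T.
apply: (sa_and sG); first exact: (@GG_sub (ltlev n) allj T T _ (fun _ _ => Logic.I) (leqnn T) (@GG_arrive n T)).
apply: (sa_and sG); first exact: (GG_Smax (fun y => y < n%:Z + 1)).
by apply: (sa_not sG); apply: natF_GG; exact: natF_dip.
Qed.

(** The process n + 1 - S starts from 1 on arrival at [n] and is frozen at n + 1 - x when S reaches
    [x], or at 0 when S reaches n + 1. The three indicators read off its value minus the initial
    1. *)
Lemma transform_between (n : nat) (x : int) T w : x <= n%:Z -> good S w ->
  (n%:Z + 1 - x)%:~R * \1_(arrive n T `&` dip n x T) w
  + (n%:Z + 1 - S T w)%:~R * \1_(between n x T) w - \1_(arrive n T) w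
  = - transform S (between n x) T w :> R.
Proof.
move=> xn gw.
have neg A B : (~ A w \/ ~ B w) -> \1_(A `&` B) w = 0 :> R.
  by move=> h; rewrite indic0// => -[? ?]; case: h.
elim: T => [|T ih].
  rewrite transform0 oppr0.
  case: (posnP n) => n0; last first.
    have na : ~ arrive n 0 w by move=> /arrive_max; rewrite Smax_0 (S0 hS); lia.
    by rewrite /between !neg ?(indic0 na) ?mulr0 ?addr0 ?subr0//; left.
  subst n; have a0 : arrive 0 0 w by exists 0%N; rewrite Smax_0 (S0 hS).
  have m0 : Smax S 0 w = 0 by rewrite Smax_0 (S0 hS).
  rewrite (indic1 a0) (S0 hS).
  have [x0|x0] : x = 0 \/ x < 0 by lia.
    have d0 : dip 0 x 0 w by exists 0%N; rewrite m0 (S0 hS) x0.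
    rewrite [\1_(_ `&` _) w]indic1// [\1_(between _ _ _) w]indic0; last by move=> [_ [_]].
    by rewrite x0 mulr0 addr0 mulr1 subr0 subrr.
  have d0 : ~ dip 0 x 0 w.
    by move=> [u []]; rewrite leqn0 => /eqP -> [_]; rewrite (S0 hS); lia.
  rewrite neg; last by right.
  rewrite indic1; last by split=> //; split=> //=; rewrite m0.
  by rewrite mulr0 add0r mulr1 subr0 subrr.
rewrite transformS// opprD -ih; clear ih.
have gT := gw T; have mT := S_le_Smax S w (leqnn T); have mS := Smax_S S T w.
have [a0|na] := pselect (arrive n T w); last first.
  have nb : ~ between n x T w by move=> [].
  rewrite [\1_(arrive n T `&` _) w]neg; last by left.
  rewrite (indic0 nb) (indic0 na) mul0r !mulr0 !addr0 subr0 oppr0.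
  have [a1|na1] := pselect (arrive n T.+1 w); last first.
    by rewrite /between !neg ?(indic0 na1) ?mulr0 ?addr0 ?subr0//; left.
  have [//|[e1 e2 e3]] := arriveS gw a1.
  rewrite (indic1 a1) e1.
  have [xn'|xn'] : x = n%:Z \/ x < n%:Z by lia.
    have d0 : dip n x T.+1 w by exists T.+1; rewrite e1 e2 xn'.
    rewrite [\1_(_ `&` _) w]indic1// [\1_(between _ _ _) w]indic0; last by move=> [_ [_]].
    by rewrite xn'; ring.
  have d0 : ~ dip n x T.+1 w.
    move=> [u []]; rewrite leq_eqVlt => /predU1P[->|/e3 h] [h1 h2]; first by lia.
    by move: h; rewrite h1 ltxx.
  rewrite neg; last by right.
  rewrite indic1; last by split=> //; split=> //=; rewrite e2; lia.
  by ring.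
have a1 := arrive_le (leqnSn T) a0; have mn := arrive_max a0.
rewrite (indic1 a0) (indic1 a1).
have [d0|nd] := pselect (dip n x T w).
  have d1 := dip_le (leqnSn T) d0.
  have c0 : (arrive n T `&` dip n x T) w by [].
  have c1 : (arrive n T.+1 `&` dip n x T.+1) w by [].
  have nb0 : ~ between n x T w by move=> [_ [_]].
  have nb1 : ~ between n x T.+1 w by move=> [_ [_]].
  by rewrite (indic1 c0) (indic1 c1) (indic0 nb0) (indic0 nb1); ring.
rewrite [\1_(arrive n T `&` _) w]neg; last by right.
have [mT1|mT1] : Smax S T w = n%:Z \/ n%:Z + 1 <= Smax S T w by lia.
  have b0 : between n x T w by split=> //; split=> //=; rewrite mT1; lia.
  have xS : x < S T w.
    by rewrite ltNge; apply/negP => h; apply: nd; exists T.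
  rewrite (indic1 b0) mul1r mulr1 mulr0 add0r.
  have [m1|m1] : Smax S T.+1 w = n%:Z \/ Smax S T.+1 w = n%:Z + 1 by lia.
    have [sx|sx] : S T.+1 w <= x \/ x < S T.+1 w by lia.
      have d1 : dip n x T.+1 w by exists T.+1.
      rewrite [\1_(_ `&` _) w]indic1// [\1_(between _ _ _) w]indic0; last by move=> [_ [_]].
      have -> : x = S T.+1 w by lia.
      by rewrite mulr1 mulr0 addr0 !intrB; ring.
    have d1 : ~ dip n x T.+1 w.
      move=> [u []]; rewrite leq_eqVlt => /predU1P[->|uT] [h1 h2]; first by lia.
      by apply: nd; exists u.
    rewrite neg; last by right.
    rewrite indic1; last by split=> //; split=> //=; rewrite m1; lia.
    by rewrite mulr0 add0r mulr1 !intrB; ring.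
  have d1 : ~ dip n x T.+1 w.
    move=> [u []]; rewrite leq_eqVlt => /predU1P[->|uT] [h1 h2]; first by lia.
    by apply: nd; exists u.
  rewrite neg; last by right.
  rewrite indic0; last by move=> [_ [/= h _]]; lia.
  have [-> ->] : S T.+1 w = n%:Z + 1 /\ S T w = n%:Z by lia.
  by rewrite !mulr0 addr0 !intrB !intrD; ring.
have nb0 : ~ between n x T w by move=> [_ [/= h _]]; lia.
have nb1 : ~ between n x T.+1 w by move=> [_ [/= h _]]; lia.
have d1 : ~ dip n x T.+1 w.
  move=> [u []]; rewrite leq_eqVlt => /predU1P[->|uT] [h1 h2]; first by lia.
  by apply: nd; exists u.
rewrite neg; last by right.
by rewrite (indic0 nb0) (indic0 nb1) !mulr0 mul0r oppr0 !addr0.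
Qed.

(** * Stopping on a given level *)

Definition arrival (n : nat) : set Omega := \bigcup_T arrive n T.
Definition dipped (n : nat) (x : int) : set Omega := \bigcup_T dip n x T.

Notation hG := GG_srw.

Lemma arrive_meas n T : measurable (arrive n T).
Proof. exact: GG_meas (@GG_arrive n T). Qed.

Lemma dip_meas n x T : measurable (dip n x T).
Proof. exact: (F_meas hS (@natF_dip n x T)). Qed.

Lemma arrive_dip_meas n x T : measurable (arrive n T `&` dip n x T).
Proof. by apply: measurableI; [exact: arrive_meas|exact: dip_meas]. Qed.

Lemma arrive_dip_le n x s t : (s <= t)%N ->
  arrive n s `&` dip n x s `<=` arrive n t `&` dip n x t.
Proof. by move=> st w [a b]; split; [exact: arrive_le a|exact: dip_le b]. Qed.

Lemma arrival_dipped n x : arrival n `&` dipped n x = \bigcup_T (arrive n T `&` dip n x T).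
Proof.
apply/seteqP; split=> [w [[s _ a] [t _ b]]|w [t _ [a b]]]; last by split; exists t.
exists (maxn s t) => //; split.
  exact: (arrive_le (leq_maxl s t)) a.
exact: (dip_le (leq_maxr s t)) b.
Qed.

Lemma arrival_meas n : measurable (arrival n).
Proof. by apply: bigcup_measurable => t _; exact: arrive_meas. Qed.

Lemma dipped_meas n x : measurable (dipped n x).
Proof. by apply: bigcup_measurable => t _; exact: dip_meas. Qed.

(* Gambler's ruin: from the first visit to [n], the walk reaches [x] before [n + 1]
   with probability [1 / (n + 1 - x)]. *)
Lemma Pr_arrival_dipped (n : nat) (x : int) : x <= n%:Z ->
  (n%:Z + 1 - x)%:~R * Pr P (arrival n `&` dipped n x) = Pr P (arrival n).
Proof.
move=> xn; set c : R := (n%:Z + 1 - x)%:~R.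
have c0 : 0 < c by rewrite /c ltr0z; lia.
rewrite arrival_dipped.
have h1 := Pr_cvg_up (P := P) (arrive_dip_meas n x) (@arrive_dip_le n x).
have h2 := Pr_cvg_up (P := P) (arrive_meas n) (@arrive_le n).
have h3 : (fun T => c * Pr P (arrive n T `&` dip n x T) - Pr P (arrive n T)) @ \oo -->
    c * Pr P (\bigcup_T (arrive n T `&` dip n x T)) - Pr P (arrival n).
  by apply: cvgB => //; apply: cvgM => //; exact: cvg_cst.
have h4 : (fun T => c * Pr P (arrive n T `&` dip n x T) - Pr P (arrive n T)) @ \oo --> (0 : R).
  apply/cvgrPdist_le => e e0; have ec : 0 < e / c by rewrite divr_gt0.
  have [T0 hT0] := Smax_unbounded hS n.+1 ec.
  exists T0 => // T /= TT; have {}hT0 := hT0 T TT.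
  rewrite sub0r normrN.
  have mb : measurable (between n x T) := GG_meas (@GG_between n x T).
  have mbz z : measurable ([set w | S T w = z] `&` between n x T).
    by apply: measurableI => //; exact: (F_meas hS (F_S hS (fun y => y = z) (leqnn T))).
  have mm : measurable [set w | Smax S T w < n.+1%:Z].
    exact: (F_meas hS (F_Smax hS (fun y => y < n.+1%:Z) (leqnn T))).
  have b1 := bm_indic (R := R) (arrive_dip_meas n x T).
  have b2 := bm_indic (R := R) (arrive_meas n T).
  pose f z : R := (n%:Z + 1 - z)%:~R.
  have b3 := bm_trunc T f mbz.
  have bc1 : bm (fun w => c * \1_(arrive n T `&` dip n x T) w) by apply: bmM => //; exact: bm_cst.
  have e1 : Ex P (fun w => c * \1_(arrive n T `&` dip n x T) w
      + trunc (S T) T f (between n x T) w - \1_(arrive n T) w) = 0.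
    rewrite -oppr0 -(Ex_transform hG (@GG_between n x) T) -mulN1r -ExZ; last first.
      exact: (bm_transform hG (@GG_between n x)).
    apply: (eq_Ex (good_meas hS) (P_good hS)).
    - by apply: bmB => //; exact: bmD.
    - by apply: bmM; [exact: bm_cst|exact: (bm_transform hG (@GG_between n x))].
    - move=> w gw; rewrite truncE; last exact: (S_bound hS).
      by rewrite mulN1r -transform_between.
  rewrite ExB// in e1; last exact: bmD.
  rewrite ExD// ExZ// !Ex_indic// in e1; [|exact: arrive_meas|exact: arrive_dip_meas].
  have g0 : 0 <= Ex P (trunc (S T) T f (between n x T)).
    rewrite -(Ex_cst P 0); apply: (le_Ex (good_meas hS) (P_good hS)) => //; first exact: bm_cst.
    move=> w gw; rewrite truncE; last exact: (S_bound hS).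
    have [bt|bt] := pselect (between n x T w); last by rewrite indic0// mulr0.
    rewrite indic1// mulr1 /f ler0z; case: bt => _ [/= h _].
    by have := S_le_Smax S w (leqnn T); lia.
  (* Undecided excursions stay above [x], so n + 1 - S is at most [c], and they need a maximum still
     below n + 1. *)
  have g1 : Ex P (trunc (S T) T f (between n x T)) <= c * Pr P [set w | Smax S T w < n.+1%:Z].
    rewrite -Ex_indic// -ExZ; last exact: bm_indic.
    apply: (le_Ex (good_meas hS) (P_good hS)) => //.
      by apply: bmM; [exact: bm_cst|exact: bm_indic].
    move=> w gw; rewrite truncE; last exact: (S_bound hS).
    have [bt|bt] := pselect (between n x T w); last first.
      by rewrite (indic0 bt) mulr0; apply: mulr_ge0; [exact: ltW|exact: indic_ge0].
    rewrite indic1// mulr1; have [a [/= m nd]] := bt.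
    rewrite indic1 /=; last by lia.
    rewrite mulr1 /f /c ler_int.
    have am := arrive_max a.
    suff : x < S T w by lia.
    by rewrite ltNge; apply/negP => sx; apply: nd; exists T; split=> //; split=> //; lia.
  have g2 : c * Pr P [set w | Smax S T w < n.+1%:Z] <= e.
    by rewrite mulrC -ler_pdivlMr.
  rewrite ler_norml; apply/andP; split; lra.
by apply/eqP; rewrite -subr_eq0; apply/eqP; exact: (cvg_unique _ h3 h4).
Qed.

Definition Jk (n k : nat) : seq (nat * nat) := [seq (n, j) | j <- iota 1 k].
(** The pattern in which, among the first [k] coins, only the [k]-th is zero. *)
Definition bk (k : nat) : nat -> nat -> bool := fun _ j => j != k.

Lemma Pr_eta n k b : valid mu n k ->
  Pr P [set w | eta n k w = b] = if b then 1 - rho mu n k else rho mu n k.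
Proof.
move=> v; have e : Pr P [set w | eta n k w = false] = rho mu n k by rewrite /Pr Peta.
case: b => //; rewrite -e -PrC; last exact: meta.
by congr Pr; apply/seteqP; split=> w /=; case: (eta n k w) => // /(_ erefl).
Qed.

Lemma Jk_valid n k : valid mu n k -> forall j, j \in Jk n k -> valid mu j.1 j.2.
Proof.
move=> v j /mapP[i]; rewrite mem_iota => /andP[i1 ik] -> /=.
by apply: (valid_le muM0 _ _ v); lia.
Qed.

Lemma Jk_uniq n k : uniq (Jk n k).
Proof. by rewrite map_inj_uniq ?iota_uniq// => x y []. Qed.

Lemma Pr_stopbits n k : valid mu n k -> Pr P (etac (Jk n k) (bk k)) =
  \prod_(1 <= j < k) (1 - rho mu n j) * rho mu n k.
Proof.
move=> v; rewrite Pr_etac; [|exact: Jk_uniq|exact: Jk_valid].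
have k0 : (0 < k)%N by case: v.
have -> : Jk n k = [seq (n, j) | j <- index_iota 1 k.+1] by rewrite /Jk /index_iota subn1.
rewrite big_map big_nat_recr//=; congr (_ * _); last by rewrite Pr_eta// /bk eqxx.
rewrite !big_nat; apply: eq_bigr => j /andP[j1 jk].
rewrite Pr_eta ?/bk; first by rewrite neq_ltn jk.
by apply: (valid_le muM0 _ _ v); lia.
Qed.

Definition halt (n k : nat) : set Omega :=
  arrival n `&` dipped n (xnk mu n k) `&` etac (Jk n k) (bk k).

Lemma halt_meas n k : measurable (halt n k).
Proof.
apply: measurableI; last exact: etac_meas.
by apply: measurableI; [exact: arrival_meas|exact: dipped_meas].
Qed.

(** Up to each finite [T], arrival and dip use the walk and coins below level [n] only; the limit in
    [T] keeps the product. *)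
Lemma Pr_halt_indep n k : valid mu n k ->
  Pr P (halt n k) = Pr P (arrival n `&` dipped n (xnk mu n k)) * Pr P (etac (Jk n k) (bk k)).
Proof.
move=> v; set B := etac _ _; set x := xnk mu n k.
rewrite /halt arrival_dipped -/B -/x.
have mB : measurable B by exact: etac_meas.
have h1 := Pr_cvg_up (P := P) (arrive_dip_meas n x) (@arrive_dip_le n x).
have h2 : Pr P \o (fun T => arrive n T `&` dip n x T `&` B) @ \oo -->
    Pr P (\bigcup_T (arrive n T `&` dip n x T `&` B)).
  apply: Pr_cvg_up => [T|s t st w [/(arrive_dip_le st) ? ?]]; last by split.
  by apply: measurableI => //; exact: arrive_dip_meas.
have h3 : Pr P \o (fun T => arrive n T `&` dip n x T `&` B) @ \oo -->
    Pr P (\bigcup_T (arrive n T `&` dip n x T)) * Pr P B.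
  have -> : Pr P \o (fun T => arrive n T `&` dip n x T `&` B)
      = (fun T => Pr P (arrive n T `&` dip n x T) * Pr P B).
    apply/funext => T /=; apply: (@GG_indep_eta (ltlev n) T).
    - apply: (sa_and (GG_sa _ _)); first exact: GG_arrive.
      by apply: natF_GG; exact: natF_dip.
    - exact: Jk_uniq.
    - exact: Jk_valid.
    - by move=> j /mapP[i _ ->]; rewrite /ltlev /= ltnn.
  by apply: cvgM => //; exact: cvg_cst.
by rewrite setI_bigcupl; exact: (cvg_unique _ h2 h3).
Qed.

(** Independence, gambler's ruin and [beta_Lam] give an increment of [Lam] over [n + 1 - x], which
    [Tm_Lam] turns into one of [Tm]. The factors cannot cancel yet, P(arrival) being only bounded
    below by [gam n]. *)
Lemma Pr_halt n k : valid mu n k -> Pr P (halt n k) * gam mu n =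
  Pr P (arrival n) * (Tm mu n (xnk mu n k) - Tm mu n (xnk mu n k + 1)).
Proof.
move=> v; have hb : below_xbar mu n by case: v.
have xn := xnk_leS muM0 v; set x := xnk mu n k in xn *.
rewrite Pr_halt_indep// Pr_stopbits// -mulrA beta_Lam// -/x.
have [xn'|xn'] : x <= n%:Z \/ x = n%:Z + 1 by lia.
  rewrite -(Tm_Lam muM0 hb xn) -(Pr_arrival_dipped xn').
  by rewrite natr_intr -[1 : R]/(1%:~R) -intrD -intrB; ring.
(* The barrier 1 of level 0, present when 1 is the top of the support: its coin pattern has
   probability zero. *)
rewrite xn' !(Lam_eq0 muM0 hb) ?(Tm_eq0 muM0 hb) ?subrr ?mulr0//; lia.
Qed.

Lemma stopnow_below n t w : below_xbar mu n -> Smax S t w = n%:Z -> stopnow t w ->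
  exists k, [/\ valid mu n k, S t w <= xnk mu n k & eta n k w = false].
Proof.
move=> [z [nz mz]] mt /stopnowE[[m [k [v [s [e et]]]]]|[_ h]].
  have em : m = n by lia.
  by subst m; exists k.
by have := h z mz; have := S_le_Smax S w (leqnn t); lia.
Qed.

Lemma arrival_cases n w : below_xbar mu n -> good S w -> (exists t, n.+1%:Z <= Smax S t w) ->
  arrival n w -> arrival n.+1 w \/ exists2 k, valid mu n k & halt n k w.
Proof.
move=> hb gw hex aw; have [T _ [t0 [_ [h1 h2]]]] := aw.
case: (ex_minnP hex) => t1 m1 min1.
have [[u [ut q]]|hn] := pselect (exists u, (u < t1)%N /\ stopnow u w); last first.
  left; exists t1 => //; exists t1; split=> //; split=> // u ut; split.
    by rewrite ltNge; apply/negP => /min1; lia.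
  by move=> q; apply: hn; exists u.
right.
have t0u : (t0 <= u)%N by rewrite leqNgt; apply/negP => /h2[].
have mu1 : Smax S u w < n.+1%:Z by rewrite ltNge; apply/negP => /min1; lia.
have mu0 : n%:Z <= Smax S u w by exact: le_trans h1 (Smax_mono _ _ t0u).
have mun : Smax S u w = n%:Z by lia.
have [k hk] := stopnow_below hb mun q.
(* The least index that triggers the stop is the right one: a smaller index has a higher barrier,
   also at or above the walk, so its coin must be 1. *)
have hex' : exists k, `[< [/\ valid mu n k, S u w <= xnk mu n k & eta n k w = false] >].
  by exists k; apply/asboolP.
case: (ex_minnP hex') => l /asboolP[v s e] lmin.
exists l => //; split; first by split=> //; exists u => //; exists u.
move=> j /mapP[i]; rewrite mem_iota => /andP[i1 il] -> /=; rewrite /bk.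
case: eqP => [->|/eqP il'] /=; first exact: e.
apply/negPn/negP => /negbTE ei.
have vi : valid mu n i by apply: (valid_le muM0 _ _ v); lia.
have : (l <= i)%N; last by lia.
apply: lmin; apply/asboolP; split=> //.
have il2 : (i < l)%N by lia.
by apply: le_trans s _; exact/ltW/(xnk_antitone muM0 vi v il2).
Qed.

(** The stop occurs at the first time the walk is at or below [x_k] on level [n]. An earlier stop on
    this level would be at a higher barrier, whose coin is 1 in the pattern; stops before the level
    are excluded by arrival. *)
Lemma halt_stop n k w : valid mu n k -> xnk mu n k <= n%:Z -> good S w -> halt n k w ->
  exists t, [/\ tau w = Some t, S t w = xnk mu n k & Smax S t w = n%:Z].
Proof.
move=> v xn gw [[[T _ [t0 [_ [h1 h2]]]] [T' _ [u0 [_ hu0]]]] hbits].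
have hb : below_xbar mu n by case: v.
have hex : exists u, `[< Smax S u w = n%:Z /\ S u w <= xnk mu n k >].
  by exists u0; apply/asboolP.
case: (ex_minnP hex) => u /asboolP[mun su] umin; clear u0 hu0 hex.
have umin' y : (y < u)%N -> Smax S y w = n%:Z -> xnk mu n k < S y w.
  move=> yu my; rewrite ltNge; apply/negP => sy.
  by have := umin y (asboolT (conj my sy)); lia.
have k1 : (0 < k)%N by case: v.
have etak : eta n k w = false.
  have := hbits (n, k); rewrite /= /bk eqxx => -> //.
  by apply/mapP; exists k => //; rewrite mem_iota; lia.
exists u; split=> //.
  apply/tau_SomeP; split.
    by apply/stopnowE; left; exists n, k.
  move=> y yu q; have t0y : (t0 <= y)%N by rewrite leqNgt; apply/negP => /h2[].
  have my : Smax S y w = n%:Z.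
    apply/eqP; rewrite eq_le -{1}mun (Smax_mono _ _ (ltnW yu)).
    exact: le_trans h1 (Smax_mono _ _ t0y).
  have xy := umin' _ yu my.
  have [k' [v' s' e']] := stopnow_below hb my q.
  have kk : (k' < k)%N.
    rewrite ltnNge leq_eqVlt; apply/negP => /predU1P[ek|kk].
      by subst k'; lia.
    by have := xnk_antitone muM0 v v' kk; lia.
  have := hbits (n, k'); rewrite /= /bk e' => /(_ _)/wrap[].
    apply/mapP; exists k' => //; rewrite mem_iota.
    by case: v' => _ k0 _; lia.
  by rewrite neq_ltn kk.
(* Unit steps: the level starts at [n], at or above [x_k], and the walk cannot get below [x_k]
   without visiting it. *)
case: u mun su umin umin' => [|y] mun su umin umin'.
  by move: mun su; rewrite Smax_0 (S0 hS); lia.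
have [my|my] : Smax S y w = n%:Z \/ Smax S y w < n%:Z.
  by have := Smax_mono S w (leqnSn y); lia.
  by have := umin' y (ltnSn y) my; have := gw y; lia.
have hl i : (i < y.+1)%N -> Smax S i w < n%:Z.
  by move=> iy; exact: le_lt_trans (Smax_mono _ _ (iy : (i <= y)%N)) my.
have [e1 _] := first_max hS gw (eq_ind_r (fun z => n%:Z <= z) (lexx _) mun) hl.
by lia.
Qed.

Definition halted (n K : nat) : set Omega :=
  [set w | exists k, [/\ (k <= K)%N, valid mu n k & halt n k w]].

Lemma halted_meas n K : measurable (halted n K).
Proof.
apply: (sa_ex (measurable_sa Omega)) => k.
have [h|h] := pselect ((k <= K)%N /\ valid mu n k); last first.
  by apply: sa_ext (sa_const (measurable_sa Omega) False) => w; split=> // -[? ? _]; exact: h.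
by apply: sa_ext (halt_meas n k) => w; split=> [?|[]//]; case: h.
Qed.

Lemma Pr_halted_sum n K : valid mu n K ->
  Pr P (halted n K) <= \sum_(1 <= k < K.+1) Pr P (halt n k).
Proof.
case: K => [[]//|K]; elim: K => [|K ih] v.
  rewrite big_nat1; apply: le_Pr; [exact: halted_meas|exact: halt_meas|].
  move=> w [k [k1 vk]]; have k0 : (0 < k)%N by case: vk.
  by have -> : k = 1%N by lia.
rewrite big_nat_recr//=.
have {}ih := ih (valid_le muM0 (ltn0Sn K) (leqnSn _) v).
apply: (@le_trans _ _ (Pr P (halted n K.+1) + Pr P (halt n K.+2))); last by rewrite lerD2r.
apply: le_trans (le_PrU _ (halted_meas _ _) (halt_meas _ _)).
apply: le_Pr; [exact: halted_meas|exact: measurableU (halted_meas _ _) (halt_meas _ _)|].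
move=> w [k [kK vk hk]]; move: kK; rewrite leq_eqVlt => /predU1P[<-|kK]; first by right.
by left; exists k.
Qed.

(** A union bound suffices, since the sum of the increments of [Tm] over the barriers telescopes. *)
Lemma Pr_halted n K : below_xbar mu n ->
  Pr P (halted n K) * gam mu n <= Pr P (arrival n) * (gam mu n - gam mu n.+1).
Proof.
move=> hb; have g0 := gam_gt0 muM0 hb; have gS := gamS muM0 hb.
elim: K => [|K ih].
  have -> : halted n 0 = set0.
    apply/seteqP; split=> // w [k [k0 v _]]; have : (0 < k)%N by case: v.
    by lia.
  by rewrite /Pr measure0 mul0r mulr_ge0 ?Pr_ge0// subr_ge0.
have [v|v] := pselect (valid mu n K.+1).
  apply: (@le_trans _ _ ((\sum_(1 <= k < K.+2) Pr P (halt n k)) * gam mu n)).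
    by rewrite ler_wpM2r ?(ltW g0)// Pr_halted_sum.
  apply: le_trans (ler_wpM2l (Pr_ge0 P _) (sum_Tm muM0 v)).
  rewrite mulr_suml mulr_sumr !big_nat; apply: ler_sum => k /andP[k1 kK].
  by rewrite Pr_halt//; apply: (valid_le muM0 _ _ v).
suff -> : halted n K.+1 = halted n K by [].
apply/seteqP; split=> w [k [kK vk hk]]; exists k; split=> //; last exact: leqW.
by move: kK; rewrite leq_eqVlt => /predU1P[e|//]; subst k.
Qed.

Lemma reach_meas (n : nat) : measurable [set w | exists t, n%:Z <= Smax S t w].
Proof.
apply: (sa_ex (measurable_sa Omega)) => t.
exact: (F_meas hS (F_Smax hS (fun x => n%:Z <= x) (leqnn t))).
Qed.

Lemma P_setI1 A B : measurable A -> measurable B -> P A = 1%E -> P B = 1%E -> P (A `&` B) = 1%E.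
Proof.
move=> mA mB PA PB; have mI : measurable (A `&` B) by exact: measurableI.
rewrite PrE//; congr EFin; apply/eqP; rewrite eq_le Pr_le1//=.
have := le_PrU P (measurableC mA) (measurableC mB).
rewrite -setCI !PrC//; have -> : Pr P A = 1 by rewrite /Pr PA.
have -> : Pr P B = 1 by rewrite /Pr PB.
lra.
Qed.

(** The maximum almost surely goes on to n + 1 unless tau stops on level [n], which has conditional
    probability at most 1 - gam (n + 1) / gam n. The survival ratios multiply to [gam]. *)
Lemma Pr_arrival_ge n : (forall m, (m < n)%N -> below_xbar mu m) -> gam mu n <= Pr P (arrival n).
Proof.
elim: n => [_|n ih hbn].
  have -> : arrival 0 = setT.
    apply/seteqP; split=> // w _; exists 0%N => //; exists 0%N; split=> //.
    by rewrite Smax_0 (S0 hS).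
  by rewrite /Pr probability_setT.
have hb := hbn n (ltnSn n); have {}ih := ih (fun m mn => hbn m (leqW mn)).
have g0 := gam_gt0 muM0 hb.
have mH := bigcup_measurable (fun K (_ : setT K) => halted_meas n K).
have hU : Pr P (\bigcup_K halted n K) * gam mu n <= Pr P (arrival n) * (gam mu n - gam mu n.+1).
  have := Pr_cvg_up (P := P) (halted_meas n) _ => /(_ _)/wrap[].
    by move=> s t st w [k [? ? ?]]; exists k; split=> //; lia.
  move=> h; rewrite -ler_pdivlMr//; apply: (ler_cvg_to h (cvg_cst _)).
  by apply: nearW => K /=; rewrite ler_pdivlMr//; exact: Pr_halted.
have mR : measurable (good S `&` [set w | exists t, n.+1%:Z <= Smax S t w]).
  apply: measurableI; first exact: (good_meas hS).
  exact: reach_meas.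
have PR : P (good S `&` [set w | exists t, n.+1%:Z <= Smax S t w]) = 1%E.
  exact: (P_setI1 (good_meas hS) (reach_meas n.+1) (P_good hS) (Smax_reaches hS n.+1)).
have : Pr P (arrival n) <= Pr P (arrival n.+1) + Pr P (\bigcup_K halted n K).
  apply: le_trans (le_PrU _ (arrival_meas _) mH).
  apply: (le_Pr_ae mR PR); [exact: arrival_meas|exact: measurableU (arrival_meas _) mH|].
  move=> w [gw hw] aw; have [?|[k vk hk]] := arrival_cases hb gw hw aw; first by left.
  by right; exists k => //; exists k.
move=> h1.
have h2 : (Pr P (arrival n) - Pr P (arrival n.+1)) * gam mu n <=
    Pr P (arrival n) * (gam mu n - gam mu n.+1).
  by apply: le_trans hU; rewrite ler_pM2r//; lra.
have h3 : Pr P (arrival n) * gam mu n.+1 <= Pr P (arrival n.+1) * gam mu n by lra.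
have gS0 : 0 <= gam mu n.+1 by rewrite gam_ay// ay_bound_ge0.
by rewrite -(ler_pM2r g0) (le_trans _ h3)// mulrC ler_wpM2r.
Qed.

(** * Law and finiteness of tau *)

Definition landed (z : int) : set Omega := [set w | exists t, tau w = Some t /\ S t w = z].
Definition landed_below (z : int) (N : nat) : set Omega :=
  [set w | exists t, tau w = Some t /\ (S t w = z /\ Smax S t w < N%:Z)].

Lemma tau_meas t : measurable [set w | tau w = Some t].
Proof. exact: (F_meas hG (F_stop hG tau_stopping_GG t)). Qed.

Lemma S_meas t (B : int -> Prop) : measurable [set w | B (S t w)].
Proof. exact: (F_meas hS (F_S hS B (leqnn t))). Qed.

Lemma Smax_meas t (B : int -> Prop) : measurable [set w | B (Smax S t w)].
Proof. exact: (F_meas hS (F_Smax hS B (leqnn t))). Qed.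

Lemma landed_meas z : measurable (landed z).
Proof. exact: (law_meas hG tau_stopping_GG). Qed.

Lemma landed_below_meas z N : measurable (landed_below z N).
Proof.
apply: (sa_ex (measurable_sa Omega)) => t.
apply: (sa_and (measurable_sa Omega)); first exact: tau_meas.
by apply: (sa_and (measurable_sa Omega)); [exact: (S_meas t (fun x => x = z))|
  exact: (Smax_meas t (fun x => x < N%:Z))].
Qed.

(** [Hm N] is the sum of [Tm m] over m < N, and level [m] contributes at least the increment of
    [Tm m] because P(arrival m) >= gam m. *)
Lemma Pr_landed_below z N : (forall m, (m < N)%N -> below_xbar mu m) ->
  Hm mu N z - Hm mu N (z + 1) <= Pr P (landed_below z N).
Proof.
elim: N => [_|N ih hbN]; first by rewrite !Hm0// subrr Pr_ge0.
have hb := hbN N (ltnSn N); have {}ih := ih (fun m mn => hbN m (leqW mn)).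
have g0 := gam_gt0 muM0 hb.
have qg := Pr_arrival_ge (fun m mn => hbN m (leqW mn)).
have mono : Pr P (landed_below z N) <= Pr P (landed_below z N.+1).
  apply: le_Pr; [exact: landed_below_meas..|].
  by move=> w [t [e1 [e2 e3]]]; exists t; split=> //; split=> //; lia.
suff : Tm mu N z - Tm mu N (z + 1) + Pr P (landed_below z N) <= Pr P (landed_below z N.+1).
  by rewrite /Tm; lra.
have [zX|zX] := pselect (Xset mu N z); last first.
  by have [_ ->] := Xset_const muM0 hb zX; rewrite subrr add0r.
have [zN|zN] : N%:Z < z \/ z <= N%:Z by lia.
  by rewrite !(Tm_eq0 muM0 hb) ?subrr ?add0r//; lia.
have [k [v ek]] := Xset_xnk muM0 hb zX.
have := Pr_halt v; rewrite ek => eh.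
have q0 : 0 < Pr P (arrival N) by exact: lt_le_trans qg.
have d0 : 0 <= Tm mu N z - Tm mu N (z + 1).
  by rewrite -(pmulr_rge0 _ q0) -eh mulr_ge0 ?Pr_ge0// ltW.
have h1 : Tm mu N z - Tm mu N (z + 1) <= Pr P (halt N k).
  by rewrite -(ler_pM2r g0) eh mulrC ler_wpM2r.
apply: (@le_trans _ _ (Pr P (halt N k `&` good S) + Pr P (landed_below z N))).
  rewrite lerD2r; apply: le_trans h1 _.
  apply: (le_Pr_ae (good_meas hS) (P_good hS)); [exact: halt_meas| |by move=> w].
  by apply: measurableI; [exact: halt_meas|exact: (good_meas hS)].
have mh : measurable (halt N k `&` good S).
  by apply: measurableI; [exact: halt_meas|exact: (good_meas hS)].
rewrite -PrU//; last 2 first.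
- exact: landed_below_meas.
- apply/seteqP; split=> // w [[hw gw] [t [e1 [e2 e3]]]].
  have xN : xnk mu N k <= N%:Z by rewrite ek.
  have [t' [e1' _ e3']] := halt_stop v xN gw hw.
  by move: e1; rewrite e1' => -[et]; move: e3; rewrite -et e3' ltxx.
apply: le_Pr; [exact: measurableU mh (landed_below_meas z N)|exact: landed_below_meas|].
move=> w [[hw gw]|[t [e1 [e2 e3]]]].
  have xN : xnk mu N k <= N%:Z by rewrite ek.
  have [t' [e1' e2' e3']] := halt_stop v xN gw hw.
  by exists t'; split=> //; rewrite e2' ek e3'; split=> //; lia.
by exists t; split=> //; split=> //; lia.
Qed.

Lemma Pr_landed_ge z : mu z <= Pr P (landed z).
Proof.
have [tz|tz] := ltP 0 (tailM mu (z + 1)).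
  have [N [hN <-]] := full_mass muM0 tz xbar_pos.
  apply: le_trans (Pr_landed_below z hN) _.
  apply: le_Pr; [exact: landed_below_meas|exact: landed_meas|].
  by move=> w [t [e1 [e2 _]]]; exists t.
(* At the top of the support no level beyond [z] is available; there mere arrival at level [z]
   triggers the second stopping clause, and [gam] equals the atom. *)
have t0 : tailM mu (z + 1) = 0.
  by apply/eqP; rewrite eq_le tz tailM_ge0.
have := mu_ge0 muM0 z; rewrite le_eqVlt => /predU1P[<-|mz]; first exact: Pr_ge0.
have top w : 0 < mu w -> w <= z.
  move=> mw; rewrite leNgt; apply/negP => zw.
  have : 0 < tailM mu (z + 1) by apply/(tailM_gt0 muM0); exists w => //; lia.
  by rewrite t0 ltxx.
have zp : 0 < z by case: xbar_pos => y [y0 /top]; lia.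
pose N := `|z|%N; have eN : N%:Z = z by rewrite /N; lia.
have hN m : (m < N)%N -> below_xbar mu m by move=> mN; exists z; split=> //; lia.
have N0 : (0 < N)%N by rewrite /N; lia.
have : gam mu N <= Pr P (arrival N) := Pr_arrival_ge hN.
rewrite (gam_top muM0 N0) eN ?t0// tailM_rec// t0 addr0 => h.
apply: le_trans h _.
apply: (le_Pr_ae (good_meas hS) (P_good hS)); [exact: arrival_meas|exact: landed_meas|].
move=> w gw [T _ [t [_ [h1 h2]]]].
have hl u : (u < t)%N -> Smax S u w < N%:Z by move=> /h2[].
have [e1 e2] := first_max hS gw h1 hl.
exists t; rewrite e1 eN; split=> //; apply/tau_SomeP; split.
  by right; rewrite e1 eN; split.
by move=> u /h2[].
Qed.

Lemma Pr_landed_seq (s : seq int) : uniq s ->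
  Pr P [set w | exists z, z \in s /\ landed z w] = \sum_(z <- s) Pr P (landed z).
Proof.
have mE (r : seq int) : measurable [set w | exists z, z \in r /\ landed z w].
  apply: (sa_ex (measurable_sa Omega)) => z; apply: (sa_and (measurable_sa Omega)).
    exact: (sa_const (measurable_sa Omega)).
  exact: landed_meas.
elim: s => [_|z s ih /= /andP[zs us]].
  rewrite big_nil; have -> : [set w | exists z, z \in [::] /\ landed z w] = set0.
    by apply/seteqP; split=> // w [z []].
  by rewrite /Pr measure0.
rewrite big_cons -ih// -PrU//; first last.
- apply/seteqP; split=> // w [[t [e1 e2]] [y [ys [t' [e1' e2']]]]].
  move: e1'; rewrite e1 => -[e]; move: ys; rewrite -e2' -e e2.
  by rewrite (negbTE zs).
- exact: landed_meas.
congr Pr; apply/seteqP; split=> [w [y []]|w [lz|[y [ys ly]]]].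
- by rewrite inE => /predU1P[->|ys] ly; [left|right; exists y].
- by exists z; rewrite inE eqxx.
- by exists y; rewrite inE ys orbT.
Qed.

Lemma sum_mu_rng (e : R) : 0 < e -> exists N, forall M, (N <= M)%N ->
  1 - e <= \sum_(z <- rng M) mu z.
Proof.
move=> e0; have [N hN] := EX_tail muM0 lingrowth1 e0; exists N => M NM.
have -> : \sum_(z <- rng M) mu z = \sum_(z <- rng M) 1 * mu z.
  by apply: eq_bigr => z _; rewrite mul1r.
rewrite (sum_EX muM0 lingrowth1 (rng_uniq M)).
have h1 : EX mu (fun w => 1 * (w \in rng M)%:R) + EX mu (fun z => 1 * (N%:Z < `|z|)%R%:R) >= 1.
  rewrite -[leLHS](EX1 muM0) -EXD//; [|exact: (lingrowth_restr _ lingrowth1)..].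
  apply: le_EX => //; last first.
    by apply: lingrowthD; exact: (lingrowth_restr _ lingrowth1).
  move=> w; rewrite ler01 !mul1r mem_rng /=.
  have [wN|wN] := leP `|w| N%:Z; last by rewrite lerDr ler0n.
  have -> : (`|w| <= M%:Z) by lia.
  by rewrite addr0.
lra.
Qed.

Lemma tau_law z : Pr P (landed z) = mu z.
Proof.
apply/eqP; rewrite eq_le Pr_landed_ge andbT.
apply/ler_addgt0Pr => e e0; have [N hN] := sum_mu_rng e0.
pose M := maxn N `|z|%N.
have {}hN := hN M (leq_maxl _ _).
have zM : z \in rng M by rewrite mem_rng /M; lia.
have : \sum_(y <- rng M) Pr P (landed y) <= 1.
  rewrite -Pr_landed_seq ?rng_uniq//; apply: Pr_le1.
  apply: (sa_ex (measurable_sa Omega)) => y; apply: (sa_and (measurable_sa Omega)).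
    exact: (sa_const (measurable_sa Omega)).
  exact: landed_meas.
rewrite (bigD1_seq z) ?rng_uniq//=; move: hN; rewrite (bigD1_seq z) ?rng_uniq//= => hN h.
have : \sum_(i <- rng M | i != z) mu i <= \sum_(i <- rng M | i != z) Pr P (landed i).
  by apply: ler_sum => y _; exact: Pr_landed_ge.
lra.
Qed.

Lemma tau_finite : P [set w | tau w <> None] = 1%E.
Proof.
have mf : measurable [set w | tau w <> None].
  apply: (sa_ext (F := measurable) (A := [set w | exists t, tau w = Some t])).
    move=> w; split=> /= [[t ->]//|]; by case: (tau w) => // t _; exists t.
  by apply: (sa_ex (measurable_sa Omega)) => t; exact: tau_meas.
rewrite PrE//; congr EFin; apply/eqP; rewrite eq_le Pr_le1//=.
apply/ler_addgt0Pr => e e0; have [N /(_ N (leqnn N)) hN] := sum_mu_rng e0.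
have : Pr P [set w | exists z, z \in rng N /\ landed z w] <= Pr P [set w | tau w <> None].
  apply: le_Pr => //; last by move=> w [z [_ [t [e1 _]]]] /=; rewrite e1.
  apply: (sa_ex (measurable_sa Omega)) => y; apply: (sa_and (measurable_sa Omega)).
    exact: (sa_const (measurable_sa Omega)).
  exact: landed_meas.
rewrite Pr_landed_seq ?rng_uniq//.
under eq_bigr do rewrite tau_law.
lra.
Qed.

Lemma tau_law_P z : P (landed z) = (mu z)%:E.
Proof. by rewrite PrE ?tau_law//; exact: landed_meas. Qed.

(** * Uniform integrability of the stopped walk *)

Notation live := (alive tau).

Lemma live_meas T : measurable (live T).
Proof. exact: (F_meas hG (F_alive hG tau_stopping_GG T)). Qed.

Lemma X_meas T z : measurable [set w | stopped S tau T w = z].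
Proof. exact: (stopped_meas hG tau_stopping_GG). Qed.

Lemma X_live T w : live T w -> stopped S tau T w = S T w.
Proof. by move=> h; rewrite /stopped -/(tmin tau T w) tmin_alive. Qed.

Lemma sum_uniq_sub (f : int -> R) (s s' : seq int) : uniq s -> uniq s' -> {subset s <= s'} ->
  (forall z, z \in s' -> 0 <= f z) -> \sum_(z <- s) f z <= \sum_(z <- s') f z.
Proof.
move=> us us' ss f0.
have pe : perm_eq s [seq z <- s' | z \in s].
  apply: uniq_perm => //; first exact: filter_uniq.
  by move=> z; rewrite mem_filter; case zs : (z \in s) => //=; rewrite ss.
rewrite (perm_big _ pe) big_filter [leRHS](bigID (fun z => z \in s)) /= lerDl.
by rewrite big_seq_cond sumr_ge0// => z /andP[/f0].
Qed.

Lemma Pr_dead_ge T z : mu z - Pr P (live T) <=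
  Pr P ([set w | stopped S tau T w = z] `&` ~` live T).
Proof.
have md := meas_stopped_dead hG tau_stopping_GG T z.
rewrite -tau_law lerBlDr; apply: le_trans (le_PrU _ md (live_meas T)).
apply: le_Pr; [exact: landed_meas|exact: measurableU md (live_meas T)|].
move=> w [t [e1 e2]]; have [l|nl] := pselect (live T w); first by right.
left; split=> //=; have [//|[u uT eu]] := alive_or tau T w.
rewrite /stopped -/(tmin tau T w) (tmin_stopped uT eu).
by move: e1; rewrite eu => -[->].
Qed.

(** Only finitely many values of [z] matter up to e/2, and for each the mass still missing at time
    [T] is at most P(live T). The 1 in [C + 1] guards the division. *)
Lemma Ex_dead_ge h (e : R) : lingrowth h -> 0 < e -> exists T0, forall T, (T0 <= T)%N ->
  EX mu h - e <= Ex P (trunc (stopped S tau T) T h (~` live T)).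
Proof.
move=> lh e0; have e2 : 0 < e / 2 by lra.
have [N hN] := EX_tail muM0 lh e2.
pose C := \sum_(z <- rng N) h z.
have C0 : 0 <= C by apply: sumr_ge0 => z _; exact: lingrowth_ge0.
have eC : 0 < e / 2 / (C + 1) by rewrite divr_gt0//; lra.
have [T1 hT1] := Pr_alive_cvg hG tau_stopping_GG tau_finite eC.
exists (maxn N T1) => T TT.
have md := meas_stopped_dead hG tau_stopping_GG T.
rewrite Ex_trunc//.
apply: (@le_trans _ _ (\sum_(z <- rng N) h z * Pr P ([set w | stopped S tau T w = z] `&` ~` live T))); last first.
  apply: sum_uniq_sub; [exact: rng_uniq..| |].
    by move=> z; rewrite !mem_rng; lia.
  by move=> z _; rewrite mulr_ge0 ?Pr_ge0// lingrowth_ge0.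
apply: (@le_trans _ _ (\sum_(z <- rng N) h z * (mu z - Pr P (live T)))); last first.
  by apply: ler_sum => z _; rewrite ler_wpM2l ?Pr_dead_ge// lingrowth_ge0.
under [leRHS]eq_bigr do rewrite mulrBr.
rewrite sumrB -mulr_suml -/C (sum_EX muM0 lh (rng_uniq N)).
have hs : EX mu h = EX mu (fun w => h w * (w \in rng N)%:R) + EX mu (fun z => h z * (N%:Z < `|z|)%R%:R).
  rewrite -EXD//; [|exact: (lingrowth_restr _ lh)..].
  by apply: eq_EX => z; rewrite -mulrDr mem_rng ltNge; case: (_ <= _); rewrite /= ?addr0 ?add0r mulr1.
have : C * Pr P (live T) <= e / 2.
  have h1 : Pr P (live T) <= e / 2 / (C + 1) by apply: hT1; lia.
  have C1 : 0 < C + 1 by lra.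
  move: h1; rewrite ler_pdivlMr// => h1.
  by apply: le_trans h1; rewrite mulrC ler_wpM2l ?Pr_ge0//; lra.
lra.
Qed.

Lemma meas_X_live T z : measurable ([set w | stopped S tau T w = z] `&` live T).
Proof. by apply: measurableI; [exact: X_meas|exact: live_meas]. Qed.

Lemma transform_live T w : good S w -> transform S live T w = (stopped S tau T w)%:~R :> R.
Proof.
move=> gw; elim: T => [|T ih].
  rewrite transform0 /stopped; have -> : (if tau w is Some u then minn 0 u else 0%N) = 0%N.
    by case: (tau w) => // u; rewrite min0n.
  by rewrite (S0 hS).
rewrite transformS// ih; have [l|[u uT eu]] := alive_or tau T w.
  rewrite (indic1 l) mul1r X_live// /stopped -/(tmin tau _ w) tmin_aliveS//.
  by rewrite -intrD; congr intmul; ring.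
have nl : ~ live T w by apply; exists u.
rewrite (indic0 nl) mul0r addr0 /stopped -!/(tmin tau _ w).
by rewrite (tmin_stopped uT eu) (tmin_stopped (leqW uT) eu).
Qed.

(** The stopped walk has mean zero, so its live part is the negative part minus the positive part
    over stopped paths. The former is at most, the latter almost, its value under [mu], and these
    values agree. *)
Lemma Ex_live_small (e : R) : 0 < e -> exists T0, forall T, (T0 <= T)%N ->
  Ex P (trunc (stopped S tau T) T (fun z => z%:~R) (live T)) <= e.
Proof.
move=> e0; have [T0 hT0] := Ex_dead_ge lingrowth_pos e0.
exists T0 => T TT; have {}hT0 := hT0 T TT.
have md := meas_stopped_dead hG tau_stopping_GG T.
have ml := meas_X_live T.
pose X := stopped S tau T.
have b1 := bm_trunc T (fun z => z%:~R : R) ml.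
have b2 := bm_trunc T (fun z : int => Num.max z%:~R 0 : R) md.
have b3 := bm_trunc T (fun z : int => Num.max (- z%:~R) 0 : R) md.
have e1 : Ex P (fun w => trunc X T (fun z => z%:~R) (live T) w
    + (trunc X T (fun z => Num.max z%:~R 0) (~` live T) w
    - trunc X T (fun z => Num.max (- z%:~R) 0) (~` live T) w)) = 0.
  rewrite -[RHS](Ex_transform hG (F_alive hG tau_stopping_GG) T).
  apply: (eq_Ex (good_meas hS) (P_good hS)).
  - by apply: bmD => //; exact: bmB.
  - exact: (bm_transform hG (F_alive hG tau_stopping_GG)).
  move=> w gw; have bX := stopped_bound hS tau T gw.
  rewrite transform_live// !truncE//.
  have [l|nl] := pselect (live T w).
    rewrite (indic1 l) indic0; last by apply.
    by rewrite !mulr0 subrr addr0 mulr1.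
  rewrite (indic0 nl) indic1// !mulr1 mulr0 add0r.
  rewrite -[stopped S tau T w]/(X w); move: (X w)%:~R => r.
  by case: (leP r 0) => h1; case: (leP (- r) 0) => h2; lra.
rewrite ExD// in e1; last exact: bmB.
rewrite ExB// in e1.
have h3 := Ex_stopped_dead hG tau_stopping_GG muM0 tau_law_P T lingrowth_neg.
have := mean0 muM0; rewrite -/X in hT0 h3 *.
lra.
Qed.

Definition ground t : set Omega := live t `&` [set w | Smax S t w < 1].

Lemma GG_ground t : GG allj t (ground t).
Proof.
apply: (sa_and (GG_sa _ _)); first exact: (F_alive hG tau_stopping_GG).
exact: (GG_Smax (fun x => x < 1)).
Qed.

Definition grounded T : set Omega := ~` live T `&` [set w | Smax S (tmin tau T w) w < 1].

Lemma GG_grounded T : GG allj T (grounded T).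
Proof.
apply: (sa_and (GG_sa _ _)).
  by apply: (sa_not (GG_sa _ _)); exact: (F_alive hG tau_stopping_GG).
apply: (F_tmin hG tau_stopping_GG (Q := fun u w => Smax S u w < 1)) => u uT.
exact: (GG_Smax (fun x => x < 1)).
Qed.

(** The transform is the walk frozen at tau or at its first visit to 1, hence never above 1. *)
Lemma transform_ground T w : good S w ->
  [/\ ground T w -> transform S ground T w = (S T w)%:~R :> R,
      grounded T w -> transform S ground T w = (stopped S tau T w)%:~R :> R &
      transform S ground T w <= 1 :> R].
Proof.
move=> gw; elim: T => [|T [h1 h2 h3]].
  have e : tmin tau 0 w = 0%N by rewrite /tmin; case: (tau w) => // u; rewrite min0n.
  by rewrite transform0 /stopped -/(tmin tau _ w) e (S0 hS); split.
rewrite transformS//; have [g|ng] := pselect (ground T w).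
  have -> : transform S ground T w + \1_(ground T) w * (S T.+1 w - S T w)%:~R = (S T.+1 w)%:~R :> R.
    by rewrite (indic1 g) h1// mul1r -intrD; congr intmul; ring.
  have [l m] := g; split=> //.
    by move=> _; rewrite /stopped -/(tmin tau _ w) tmin_aliveS.
  rewrite -[1 : R]/(1%:~R) ler_int; have := gw T.
  by have := S_le_Smax S w (leqnn T); move: m => /=; lia.
rewrite (indic0 ng) mul0r addr0; split=> //.
  move=> [l m]; exfalso; apply: ng; split.
    exact: alive_anti l.
  by apply: le_lt_trans m; exact: Smax_mono.
move=> [nl m]; have [l|[u uT eu]] := alive_or tau T w.
  exfalso; apply: ng; split=> //=.
  by move: m; rewrite /= tmin_aliveS//; apply: le_lt_trans; exact: Smax_mono.
have e1 := tmin_stopped uT eu; have e2 := tmin_stopped (leqW uT) eu.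
rewrite h2; first by rewrite /stopped -!/(tmin tau _ w) e1 e2.
split; first by apply; exists u.
by move: m; rewrite /= e1 e2.
Qed.

(** A halt on level 0 is a stop with maximum 0; by time [T] it has taken place unless the path is
    live. *)
Lemma Pr_grounded_ge T k : valid mu 0 k -> xnk mu 0 k <= 0 ->
  Pr P (halt 0 k) - Pr P (live T) <=
  Pr P ([set w | stopped S tau T w = xnk mu 0 k] `&` grounded T).
Proof.
move=> v x0; have mg : measurable (grounded T) := GG_meas (@GG_grounded T).
have md : measurable ([set w | stopped S tau T w = xnk mu 0 k] `&` grounded T).
  by apply: measurableI => //; exact: X_meas.
rewrite lerBlDr; apply: le_trans (le_PrU _ md (live_meas T)).
apply: (le_Pr_ae (good_meas hS) (P_good hS)); [exact: halt_meas|exact: measurableU md (live_meas T)|].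
move=> w gw hw; have [t [e1 e2 e3]] := halt_stop v x0 gw hw.
have [l|[u uT eu]] := alive_or tau T w; [by right|left].
have et := tmin_stopped uT eu; move: e1; rewrite eu => -[eu']; subst t.
split; first by rewrite /= /stopped -/(tmin tau _ w) et.
by split=> /=; [apply; exists u|rewrite et e3].
Qed.

Lemma halt0 k : valid mu 0 k -> (1 - (xnk mu 0 k)%:~R) * Pr P (halt 0 k) =
  \prod_(1 <= j < k) (1 - rho mu 0 j) * rho mu 0 k.
Proof.
move=> v; have := Pr_halt v; have := beta_Lam muM0 v; rewrite /gam /= !mulr1 => -> ->.
have -> : arrival 0 = setT.
  apply/seteqP; split=> // w _; exists 0%N => //; exists 0%N; split=> //.
  by rewrite Smax_0 (S0 hS).
have -> : Pr P setT = 1 by rewrite /Pr probability_setT.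
by rewrite mul1r -(Tm_Lam muM0 xbar_pos) ?add0r//; have := xnk_leS muM0 v; lia.
Qed.

Lemma meas_X_ground T z : measurable ([set w | stopped S tau T w = z] `&` ground T).
Proof. by apply: measurableI; [exact: X_meas|exact: GG_meas (@GG_ground T)]. Qed.

Lemma meas_X_grounded T z : measurable ([set w | stopped S tau T w = z] `&` grounded T).
Proof. by apply: measurableI; [exact: X_meas|exact: GG_meas (@GG_grounded T)]. Qed.

(* On level 0, optional stopping for [1 - S] leaves exactly the mass not yet
   absorbed by the barriers [x^0_k]. *)
Lemma Ex_ground_small (e : R) : 0 < e -> exists T0, forall T, (T0 <= T)%N ->
  Ex P (trunc (stopped S tau T) T (fun z => 1 - z%:~R) (ground T)) <= e.
Proof.
move=> e0; have e2 : 0 < e / 2 by lra.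
have [K vK hK] := sum_beta0_lim muM0 xbar_pos e2.
(* A possible barrier at 1 is dropped: its term has weight 1 - x = 0. *)
pose s := [seq xnk mu 0 k | k <- [seq k <- index_iota 1 K.+1 | (xnk mu 0 k <= 0)%R]].
have vk k : (k \in index_iota 1 K.+1) -> valid mu 0 k.
  by rewrite mem_index_iota => /andP[k1 kK]; apply: (valid_le muM0 _ _ vK).
have us : uniq s.
  rewrite map_inj_in_uniq ?filter_uniq ?iota_uniq//.
  move=> i j; rewrite !mem_filter => /andP[_ /vk vi] /andP[_ /vk vj] eij.
  case: (ltngtP i j) => // ij.
    by have := xnk_antitone muM0 vi vj ij; rewrite eij ltxx.
  by have := xnk_antitone muM0 vj vi ij; rewrite eij ltxx.
pose C := \sum_(z <- s) (1 - z%:~R) : R.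
have s0 z : z \in s -> z <= 0.
  by move=> /mapP[k]; rewrite mem_filter => /andP[? _] ->.
have w0 z : z \in s -> 0 <= 1 - z%:~R :> R.
  by move=> /s0 zs; rewrite subr_ge0 -[1 : R]/(1%:~R) ler_int; lia.
have C0 : 0 <= C by rewrite /C big_seq sumr_ge0.
have eC : 0 < e / 2 / (C + 1) by rewrite divr_gt0//; lra.
have [T1 hT1] := Pr_alive_cvg hG tau_stopping_GG tau_finite eC.
pose N := \max_(z <- s) `|z|%N.
exists (maxn N T1) => T TT.
have sub : {subset s <= rng T}.
  move=> z zs; rewrite mem_rng; have := leq_bigmax_seq (F := fun z : int => `|z|%N) z zs isT.
  by rewrite -/N; lia.
pose X := stopped S tau T; pose f (z : int) : R := 1 - z%:~R.
pose f' (z : int) : R := Num.max (1 - z%:~R) 0.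
have b1 := bm_trunc T f (meas_X_ground T).
have b2 := bm_trunc T f' (meas_X_grounded T).
have : Ex P (fun w => trunc X T f (ground T) w + trunc X T f' (grounded T) w) <=
    Ex P (fun w => 1 - transform S ground T w).
  apply: (le_Ex (good_meas hS) (P_good hS)); first exact: bmD.
    by apply: bmB; [exact: bm_cst|exact: (bm_transform hG GG_ground)].
  move=> w gw; have bX := stopped_bound hS tau T gw; have [h1 h2 h3] := transform_ground T gw.
  rewrite !truncE//; have [g|ng] := pselect (ground T w).
    have [l _] := g; rewrite (indic1 g) (indic0 (A := grounded T)); last by move=> [].
    by rewrite h1// mulr1 mulr0 addr0 /f /X X_live.
  rewrite (indic0 ng) mulr0 add0r; have [g'|ng'] := pselect (grounded T w); last first.
    by rewrite (indic0 ng') mulr0 subr_ge0.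
  have [_ /= m] := g'; rewrite (indic1 g') mulr1 h2// /f' max_l// subr_ge0.
  rewrite -[1 : R]/(1%:~R) ler_int /X /stopped -/(tmin tau T w).
  by apply: le_trans (ltW m); exact: S_le_Smax.
rewrite ExD// ExB; [|exact: bm_cst|exact: (bm_transform hG GG_ground)].
rewrite Ex_cst (Ex_transform hG GG_ground) subr0.
(* Live and stopped contributions of 1 - S together are at most 1, so it remains to show that the
   stopped part nearly exhausts it. *)
have : 1 - e <= Ex P (trunc X T f' (grounded T)); last by lra.
rewrite Ex_trunc; last exact: meas_X_grounded.
apply: (@le_trans _ _ (\sum_(z <- s) f' z * Pr P ([set w | X w = z] `&` grounded T))); last first.
  apply: sum_uniq_sub => //; first exact: rng_uniq.
  by move=> z _; rewrite mulr_ge0 ?Pr_ge0// /f' le_max lexx orbT.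
apply: (@le_trans _ _ (\sum_(k <- index_iota 1 K.+1) (1 - (xnk mu 0 k)%:~R) * Pr P (halt 0 k)
    - C * Pr P (live T))).
  rewrite big_seq (eq_bigr (fun k => \prod_(1 <= j < k) (1 - rho mu 0 j) * rho mu 0 k)); last first.
    by move=> k /vk /halt0.
  rewrite -big_seq sum_beta//.
  have : C * Pr P (live T) <= e / 2.
    have h1 : Pr P (live T) <= e / 2 / (C + 1) by apply: hT1; lia.
    have C1 : 0 < C + 1 by lra.
    move: h1; rewrite ler_pdivlMr// => h1.
    by apply: le_trans h1; rewrite mulrC ler_wpM2l ?Pr_ge0//; lra.
  lra.
apply: (@le_trans _ _ (\sum_(k <- [seq k <- index_iota 1 K.+1 | (xnk mu 0 k <= 0)%R])
    (1 - (xnk mu 0 k)%:~R) * (Pr P (halt 0 k) - Pr P (live T)))).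
  under [leRHS]eq_bigr do rewrite mulrBr.
  rewrite sumrB -mulr_suml /C /s big_map lerD2r [leLHS](bigID (fun k => xnk mu 0 k <= 0)) /=.
  rewrite big_filter gerDl big_seq_cond sumr_le0// => k /andP[/vk v]; rewrite -ltNge => x0.
  rewrite mulr_le0_ge0 ?Pr_ge0// subr_le0 -[1 : R]/(1%:~R) ler_int; lia.
rewrite /s big_map big_seq [leRHS]big_seq; apply: ler_sum => k.
rewrite mem_filter => /andP[x0 /vk v].
have f0 : 0 <= 1 - (xnk mu 0 k)%:~R :> R by rewrite subr_ge0 -[1 : R]/(1%:~R) ler_int; lia.
by rewrite /f' max_l// ler_wpM2l// Pr_grounded_ge.
Qed.

Lemma P_bigcap1 (A : nat -> set Omega) : (forall n, measurable (A n)) ->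
  (forall n, P (A n) = 1%E) -> P (\bigcap_n A n) = 1%E.
Proof.
move=> mA PA; have mC n : measurable (~` A n) by exact: measurableC.
have -> : \bigcap_n A n = ~` (\bigcup_n ~` A n).
  by rewrite setC_bigcup; apply: eq_bigcapr => n _; rewrite setCK.
rewrite probability_setC; last exact: bigcup_measurable.
have -> : P (\bigcup_n ~` A n) = 0%E; last by rewrite sube0.
apply/negligibleP; first exact: bigcup_measurable.
apply: negligible_bigcup => n; apply/negligibleP => //.
transitivity (Pr P (~` A n))%:E; first exact: PrE.
by rewrite PrC// /Pr PA subrr.
Qed.

(** A coin with rho = 1 is zero only almost surely; the exceptional sets are discarded together in
    [regular]. *)
Definition sharp (n k : nat) : set Omega :=
  [set w | valid mu n k -> rho mu n k = 1 -> eta n k w = false].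

Lemma sharp_meas n k : measurable (sharp n k).
Proof.
by apply: (sa_imp (measurable_sa Omega)) => _; apply: (sa_imp (measurable_sa Omega)) => _;
  exact: meta.
Qed.

Definition regular : set Omega := good S `&` \bigcap_n \bigcap_k sharp n k.

Lemma regular_meas : measurable regular.
Proof.
apply: measurableI; first exact: (good_meas hS).
apply: bigcap_measurable => // n _; apply: bigcap_measurable => // k _.
exact: sharp_meas.
Qed.

Lemma P_regular : P regular = 1%E.
Proof.
apply: P_setI1; [exact: (good_meas hS)| |exact: (P_good hS)|].
  apply: bigcap_measurable => // n _; apply: bigcap_measurable => // k _.
  exact: sharp_meas.
apply: P_bigcap1 => n; first by apply: bigcap_measurable => // k _; exact: sharp_meas.
apply: P_bigcap1 => k; first exact: sharp_meas.
have [[v r]|h] := pselect (valid mu n k /\ rho mu n k = 1); last first.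
  have -> : sharp n k = setT by apply/seteqP; split=> // w _ v r; exfalso; exact: h.
  by rewrite probability_setT.
have -> : sharp n k = [set w | eta n k w = false] by apply/seteqP; split=> [w /(_ v r)|w e _ _].
by rewrite Peta// r.
Qed.

(** Otherwise a top atom would exist and, by unit steps, would have been visited by time [T], which
    stops the walk. *)
Lemma live_below T w : good S w -> live T w -> below_xbar mu `|Smax S T w|%N.
Proof.
move=> gw l; apply: contrapT => nb.
have ns u : (u <= T)%N -> ~ stopnow u w by move=> uT q; apply: l; apply/tau_leP; exists u.
have sup z : 0 < mu z -> z <= Smax S T w.
  move=> mz; rewrite leNgt; apply/negP => h; apply: nb; exists z.
  by rewrite abszSmax.
have hex : exists m : nat, 0 < mu m%:Z.
  case: xbar_pos => z [z0 mz]; exists `|z|%N.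
  by have -> : (`|z|%N)%:Z = z by lia.
have hub (m : nat) : 0 < mu m%:Z -> (m <= `|Smax S T w|)%N.
  by move=> /sup; have := abszSmax T w; lia.
case: (ex_maxnP hex hub) => m mm mmax.
have top z : 0 < mu z -> z <= m%:Z.
  move=> mz; have [z0|z0] : z < 0 \/ 0 <= z by lia.
    by lia.
  have := mmax `|z|%N; have -> : (`|z|%N)%:Z = z by lia.
  by move=> /(_ mz); lia.
have hT : exists t, m%:Z <= Smax S t w by exists T; exact: sup.
case: (ex_minnP hT) => t mt tmin.
have tT : (t <= T)%N by apply: tmin; exact: sup.
have hl u : (u < t)%N -> Smax S u w < m%:Z.
  by move=> ut; rewrite ltNge; apply/negP => /tmin; lia.
have [e1 _] := first_max hS gw mt hl.
by apply: (ns t tT); right; rewrite e1.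
Qed.

(** On [regular] the last coin of the current level is zero, so a live path stays above that
    barrier, and [last_barrier] makes the bound uniform. *)
Lemma live_lower : exists B : int, forall T w, regular w -> live T w ->
  1 <= Smax S T w -> B <= S T w.
Proof.
have [B hB] := last_barrier muM0; exists B => T w [gw sh] l m1.
have hb := live_below gw l; set n := `|Smax S T w|%N in hb.
have en : Smax S T w = n%:Z by rewrite abszSmax.
have n0 : (0 < n)%N by lia.
have [k [v r xk]] := hB n n0 hb.
have ek : eta n k w = false by exact: (sh n Logic.I k Logic.I).
rewrite leNgt; apply/negP => SB; apply: l; apply/tau_leP; exists T; split=> //.
by apply/stopnowE; left; exists n, k; split=> //; split=> //; lia.
Qed.

Lemma Ex_abs_live_small (e : R) : 0 < e -> exists T0, forall T, (T0 <= T)%N ->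
  Ex P (trunc (stopped S tau T) T (fun z => `|z|%:~R) (live T)) <= e.
Proof.
move=> e0; have [B hB] := live_lower.
have e4 : 0 < e / 4 by lra.
have [T1 h1] := Ex_live_small e4.
have [T2 h2] := Ex_ground_small e4.
have eB : 0 < e / 4 / (2 * `|B|%:~R + 1).
  by rewrite divr_gt0// ltr_wpDl// mulr_ge0// ler0z.
have [T3 h3] := Pr_alive_cvg hG tau_stopping_GG tau_finite eB.
exists (maxn T1 (maxn T2 T3)) => T TT.
have {}h1 := h1 T ltac:(lia); have {}h2 := h2 T ltac:(lia); have {}h3 := h3 T ltac:(lia).
pose X := stopped S tau T.
have b1 := bm_trunc T (fun z => z%:~R : R) (meas_X_live T).
have b2 := bm_trunc T (fun z => 1 - z%:~R : R) (meas_X_ground T).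
have b3 := bm_indic (R := R) (live_meas T).
have b4 := bm_trunc T (fun z => `|z|%:~R : R) (meas_X_live T).
have b2' : bm (fun w => 2 * trunc X T (fun z => 1 - z%:~R : R) (ground T) w).
  by apply: bmM => //; exact: bm_cst.
have b3' : bm (fun w => (2 * `|B|%:~R) * (\1_(live T) w : R)).
  by apply: bmM => //; exact: bm_cst.
have b12 := bmD b1 b2'.
(* Live paths with maximum 0 have S <= 0, so |S| = -S <= S + 2(1 - S); the other live paths have S
   >= B, so |S| <= S + 2|B|. The three expectations are at most e/4, 2e/4 and e/4. *)
have : Ex P (trunc X T (fun z => `|z|%:~R) (live T)) <=
  Ex P (fun w => trunc X T (fun z => z%:~R) (live T) w
    + 2 * trunc X T (fun z => 1 - z%:~R) (ground T) w + (2 * `|B|%:~R) * \1_(live T) w).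
  apply: (le_Ex regular_meas P_regular) => //; first exact: bmD.
  move=> w rw; have [gw _] := rw; have bX := stopped_bound hS tau T gw.
  rewrite !truncE//; have [l|nl] := pselect (live T w); last first.
    have ng : ~ ground T w by move=> [].
    by rewrite (indic0 nl) (indic0 ng) !mulr0 !addr0.
  rewrite (indic1 l) !mulr1 /X X_live//.
  have [m0|m1] : Smax S T w < 1 \/ 1 <= Smax S T w by lia.
    have g : ground T w by split.
    have s0 : S T w <= 0 by have := S_le_Smax S w (leqnn T); lia.
    rewrite (indic1 g) mulr1 ler0_norm// intrN.
    have : (S T w)%:~R <= (0 : R) by rewrite lerz0.
    have : 0 <= `|B|%:~R :> R by rewrite ler0z.
    lra.
  have ng : ~ ground T w by move=> [_ /=]; lia.
  rewrite (indic0 ng) !mulr0 addr0.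
  have h : `|S T w| <= S T w + 2 * `|B| by have := hB T w rw l m1; lia.
  by rewrite -(ler_int R) intrD intrM in h.
rewrite (ExD P b12 b3') (ExD P b1 b2') (ExZ P _ b2) (ExZ P _ b3) Ex_indic; last exact: live_meas.
have h4 : 2 * `|B|%:~R * Pr P (live T) <= e / 4.
  have c1 : (0 : R) < 2 * `|B|%:~R + 1 by rewrite ltr_wpDl// mulr_ge0// ler0z.
  move: h3; rewrite ler_pdivlMr// => h3.
  by apply: le_trans h3; rewrite mulrC ler_wpM2l ?Pr_ge0// lerDl.
rewrite -/X in h1 h2 *; lra.
Qed.

Lemma tau_UI : unif_integrable P (stopped S tau).
Proof.
move=> e e0; have e2 : 0 < e / 2 by lra.
have [N hN] := EX_tail muM0 lingrowth_norm e2.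
have [T0 hT0] := Ex_abs_live_small e2.
(* Since |X| <= T, a value beyond K >= T0 requires T > T0, so live paths contribute only when their
   bound is in force; K >= N takes care of the stopped ones. *)
pose K := maxn N T0; exists K%:R => T.
rewrite (tail_integralE hG _ (X_meas T) (stopped_bound hS tau T)) lee_fin.
pose X := stopped S tau T.
set h := fun z : int => _.
have mT z : measurable ([set w | X w = z] `&` setT) by rewrite setIT; exact: X_meas.
have md := meas_stopped_dead hG tau_stopping_GG T.
pose h1 (z : int) : R := `|z|%:~R * (N%:Z < `|z|)%R%:R.
pose h2 (z : int) : R := `|z|%:~R * (T0 <= T)%N%:R.
have b1 := bm_trunc T h mT.
have b2 := bm_trunc T h1 md.
have b3 := bm_trunc T h2 (meas_X_live T).
have : Ex P (trunc X T h setT) <=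
    Ex P (fun w => trunc X T h1 (~` live T) w + trunc X T h2 (live T) w).
  apply: (le_Ex (good_meas hS) (P_good hS)) => //; first exact: bmD.
  move=> w gw; have bX := stopped_bound hS tau T gw; rewrite !truncE// indicT mulr1.
  have hle (a : bool) (b : bool) (x : int) : (a -> b) ->
      `|x|%:~R * a%:R <= `|x|%:~R * b%:R :> R.
    by move=> ab; rewrite ler_wpM2l ?ler0z// ler_nat; case: a ab => // ->.
  rewrite /h -[`|(X w)%:~R|]intr_norm natr_intr ltr_int.
  have [l|nl] := pselect (live T w).
    rewrite (indic1 l) (indic0 (A := ~` live T)); last by apply.
    rewrite mulr0 add0r mulr1 /h2; apply: hle => KX.
    by rewrite leqNgt; apply/negP => TT; move: KX bX; rewrite /K /X; lia.
  rewrite (indic0 nl) (indic1 (A := ~` live T))// mulr0 addr0 mulr1 /h1.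
  by apply: hle; rewrite /K; lia.
rewrite ExD//.
have i1 : Ex P (trunc X T h1 (~` live T)) <= e / 2.
  apply: le_trans hN.
  exact: (Ex_stopped_dead hG tau_stopping_GG muM0 tau_law_P T (lingrowth_restr _ lingrowth_norm)).
have i2 : Ex P (trunc X T h2 (live T)) <= e / 2.
  have [TT|TT] := leqP T0 T.
    apply: le_trans (hT0 T TT); rewrite le_eqVlt; apply/orP; left; apply/eqP; congr Ex.
    apply/funext => w; rewrite /trunc; apply: eq_bigr => z _; rewrite /h2 TT mulr1//.
  have -> : trunc X T h2 (live T) = (fun=> 0).
    apply/funext => w; rewrite /trunc big1// => z _.
    by rewrite /h2 leqNgt TT /= mulr0 mul0r.
  by rewrite Ex_cst ltW.
lra.
Qed.

Lemma tau_SEP F : stopping_time F tau -> SEP P F S mu tau.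
Proof. by move=> st; split=> //; [exact: tau_finite|exact: tau_law_P|exact: tau_UI]. Qed.

(** * The maximum at tau and the theorem *)

Lemma tau_max_ge n : (forall m, (m < n)%N -> below_xbar mu m) ->
  gam mu n <= Pr P [set w | exists t, tau w = Some t /\ n%:Z <= Smax S t w].
Proof.
move=> hb; apply: le_trans (Pr_arrival_ge hb) _.
have mf : measurable (good S `&` [set w | tau w <> None]).
  apply: measurableI; first exact: (good_meas hS).
  apply: (sa_ext (F := measurable) (A := [set w | exists t, tau w = Some t])).
    move=> w; split=> /= [[t ->]//|]; by case: (tau w) => // t _; exists t.
  by apply: (sa_ex (measurable_sa Omega)) => t; exact: tau_meas.
have Pf : P (good S `&` [set w | tau w <> None]) = 1%E.
  apply: P_setI1; [exact: (good_meas hS)| |exact: (P_good hS)|exact: tau_finite].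
  apply: (sa_ext (F := measurable) (A := [set w | exists t, tau w = Some t])).
    move=> w; split=> /= [[t ->]//|]; by case: (tau w) => // t _; exists t.
  by apply: (sa_ex (measurable_sa Omega)) => t; exact: tau_meas.
apply: (le_Pr_ae mf Pf); first exact: arrival_meas.
  apply: (sa_ex (measurable_sa Omega)) => t.
  by apply: (sa_and (measurable_sa Omega)); [exact: tau_meas|exact: (Smax_meas t (fun x => n%:Z <= x))].
move=> w [gw tw] [T _ [t0 [_ [h1 h2]]]].
case et : (tau w) tw => [t|//] _; exists t; split=> //.
have /tau_SomeP[q _] := et.
have tt : (t0 <= t)%N by rewrite leqNgt; apply/negP => /h2[].
exact: le_trans h1 (Smax_mono _ _ tt).
Qed.

End AzemaYor.

Lemma SEP_max_le {R : realType} (mu : int -> R) (d : measure_display)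
    (Omega : measurableType d) (P : probability Omega R) (F : nat -> set (set Omega))
    (S : nat -> Omega -> int) (sigma : Omega -> option nat) (n : nat) :
  isM0 mu -> is_srw_wrt P F S -> SEP P F S mu sigma -> (0 < n)%N ->
  (P [set w | exists t, sigma w = Some t /\ (n%:Z <= Smax S t w)%R] <= (ay_bound mu n)%:E)%E.
Proof.
move=> muM0 hS [st fin law UI] n0.
have mA : measurable [set w | exists t, sigma w = Some t /\ (n%:Z <= Smax S t w)%R].
  apply: (sa_ex (measurable_sa Omega)) => t; apply: (sa_and (measurable_sa Omega)).
    exact: (F_meas hS (F_stop hS st t)).
  exact: (F_meas hS (F_Smax hS (fun x => n%:Z <= x) (leqnn t))).
have [b bn e] := ay_bound_call muM0 n0.
have p : (0 : R) < n%:R - b%:~R by rewrite natr_intr subr_gt0 ltr_int.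
rewrite PrE// lee_fin -(ler_pM2l p) e.
exact: (max_upper_bound hS st fin muM0 law UI).
Qed.

Theorem theorem2 (R : realType) (mu : int -> R) (d : measure_display)
  (Omega : measurableType d) (P : probability Omega R)
  (S : nat -> Omega -> int) (eta : nat -> nat -> Omega -> bool) :
  isM0 mu ->
  (* S is a simple symmetric random walk (w.r.t. its natural filtration) *)
  is_srw_wrt P (natF S) S ->
  (* the eta^n_k are random variables ... *)
  (forall n k b, measurable [set w | eta n k w = b]) ->
  (* ... Bernoulli with P(eta^n_k = 0) = rho^n_k ... *)
  (forall n k, valid mu n k -> P [set w | eta n k w = false] = (rho mu n k)%:E) ->
  (* ... mutually independent and independent of S *)
  (forall (T : nat) (s : nat -> int) (J : seq (nat * nat)) (bv : nat -> nat -> bool),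
     uniq J -> (forall j, j \in J -> valid mu j.1 j.2) ->
     P ([set w | forall u, (u <= T)%N -> S u w = s u] `&`
        [set w | forall j, j \in J -> eta j.1 j.2 w = bv j.1 j.2]) =
     (P [set w | forall u, (u <= T)%N -> S u w = s u] *
      \prod_(j <- J) P [set w | eta j.1 j.2 w = bv j.1 j.2])%E) ->
  SEP P (natF_eta mu S eta) S mu (tauAY mu S eta) /\
  (forall (F : nat -> set (set Omega)) (sigma : Omega -> option nat),
     is_srw_wrt P F S -> SEP P F S mu sigma ->
     forall n : nat, (1 <= n)%N ->
       (P [set w | exists t, sigma w = Some t /\ (n%:Z <= Smax S t w)%R] <=
        P [set w | exists t, tauAY mu S eta w = Some t /\ (n%:Z <= Smax S t w)%R])%E /\
       P [set w | exists t, tauAY mu S eta w = Some t /\ (n%:Z <= Smax S t w)%R] =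
        (ay_bound mu n)%:E).
Proof.
move=> muM0 hS meta Peta indep.
have [hb|nb] := pselect (below_xbar mu 0).
  have hG := GG_srw hS meta indep.
  split; first by apply: (tau_SEP muM0 hS meta Peta indep hb); exact: (tau_stopping_natF hS hb).
  move=> F sigma hF hs n n0.
  (* The maximal inequality applies to tau itself, but in the filtration with all coins revealed,
     where S is known to be a walk. *)
  have tauG : SEP P (GG mu S eta allj) S mu (tauAY mu S eta).
    by apply: (tau_SEP muM0 hS meta Peta indep hb); exact: (tau_stopping_GG hS hb).
  have mA : measurable [set w | exists t, tauAY mu S eta w = Some t /\ n%:Z <= Smax S t w].
    have [st _ _ _] := tauG.
    apply: (sa_ex (measurable_sa Omega)) => t; apply: (sa_and (measurable_sa Omega)).
      exact: (F_meas hG (F_stop hG st t)).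
    exact: (F_meas hG (F_Smax hG (fun x => n%:Z <= x) (leqnn t))).
  have eq : P [set w | exists t, tauAY mu S eta w = Some t /\ n%:Z <= Smax S t w]
      = (ay_bound mu n)%:E.
    apply/eqP; rewrite eq_le (SEP_max_le muM0 hG tauG n0)/= PrE// lee_fin.
    (* This condition says that [n] does not exceed the top of the support; beyond the top the bound
       is 0. *)
    have [hbn|hbn] := pselect (below_xbar mu n.-1); last first.
      by rewrite ay_bound_above// Pr_ge0.
    rewrite -gam_ay//; apply: (tau_max_ge muM0 hS meta Peta indep hb) => m mn.
    case: hbn => z [nz mz]; exists z; split=> //; lia.
  by split=> //; rewrite eq; exact: (SEP_max_le muM0 hF hs n0).
(* Degenerate law: tau is 0 and both sides of the maximal identity vanish for n >= 1. *)
have emu := delta0 muM0 nb.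
have etau w : tauAY mu S eta w = Some 0%N by rewrite /tauAY asboolT.
have S00 w : S 0%N w = 0 by exact: (S0 hS).
split.
  split.
  - move=> t; apply: (sa_ext (F := natF_eta mu S eta t) (A := [set w : Omega | True])).
      by move=> w; split=> // _; exists 0%N.
    exact: (sa_const (smallest_sigma_algebra _ _)).
  - have -> : [set w | tauAY mu S eta w <> None] = setT.
      by apply/seteqP; split=> // w _ /=; rewrite etau.
    by rewrite probability_setT.
  - move=> z; have [z0|z0] := eqVneq z 0.
      have -> : [set w | exists t, tauAY mu S eta w = Some t /\ S t w = z] = setT.
        by apply/seteqP; split=> // w _ /=; exists 0%N; rewrite etau S00.
      by rewrite probability_setT emu z0.
    have -> : [set w | exists t, tauAY mu S eta w = Some t /\ S t w = z] = set0.
      apply/seteqP; split=> // w [t]; rewrite etau => -[[<-]]; rewrite S00 => z0'.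
      by rewrite -z0' eqxx in z0.
    by rewrite measure0 emu (negbTE z0).
  - move=> e e0; exists 0 => t.
    have -> : [set w | (0 < `|(stopped S (tauAY mu S eta) t w)%:~R : R|)%R] = set0.
      apply/seteqP; split=> // w /=; rewrite /stopped etau minn0 S00.
      by rewrite normr0 ltxx.
    by rewrite integral_set0 lee_fin ltW.
move=> F sigma hF hs n n0.
have a0 : ay_bound mu n = 0.
  apply: ay_bound_above => // -[z [nz mz]]; apply: nb; exists z; split=> //; lia.
have -> : [set w | exists t, tauAY mu S eta w = Some t /\ n%:Z <= Smax S t w] = set0.
  apply/seteqP; split=> // w [t]; rewrite etau => -[[<-]]; rewrite Smax_0 S00; lia.
rewrite measure0 a0; split=> //.
by have := SEP_max_le muM0 hF hs n0; rewrite a0.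
Qed.
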